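(* MB Dom Game is fixed-parameter tractable (FPT) when parameterized by the distance to cluster of the input graph.
   Context: All graphs are finite, simple and undirected. The Maker-Breaker domination game on a graph $G$ is played by Dominator and Staller, who alternately claim one unclaimed vertex of $G$. Dominator wins if the vertices she claims contain a dominating set of $G$; otherwise Staller wins. MB Dom Game is the problem: given a graph $G$ and the first player (Dominator or Staller), decide which player has a winning strategy in the Maker-Breaker domination game on $G$ with the given player moving first. FPT with parameter $p$ means solvable in time $f(p)\cdot |V(G)|^{O(1)}$ for some computable function $f$. A cluster is a disjoint union of cliques. The distance to cluster of $G$ is the minimum number of vertices to delete from $G$ to obtain a cluster. *)

(* Defs.v *)
From mathcomp Require Import all_boot.

Set Implicit Arguments.
Unset Strict Implicit.
Unset Printing Implicit Defensive.

(** * Finite simple graphs *)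

Record sgraph (T : finType) := SGraph {
  adj :> rel T;
  adj_sym : symmetric adj;
  adj_irr : irreflexive adj
}.

Section Deletion.
Variables (T : finType) (G : sgraph T) (X : {set T}).

Definition del_adj : rel {v : T | v \notin X} := fun u v => adj G (val u) (val v).

Lemma del_adj_sym : symmetric del_adj.
Proof. by move=> u v; apply: adj_sym. Qed.

Lemma del_adj_irr : irreflexive del_adj.
Proof. by move=> u; apply: adj_irr. Qed.

Definition del_vertices : sgraph {v : T | v \notin X} :=
  SGraph del_adj_sym del_adj_irr.

End Deletion.

(* The blocks of the partition P are the cliques of the disjoint union. *)
Definition is_cluster (T : finType) (G : sgraph T) : bool :=
  [exists P : {set {set T}}, partition P [set: T] &&
    [forall u, forall v, adj G u v == (u != v) && (pblock P u == pblock P v)]].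

(* Deleting every vertex leaves the empty graph, which is a cluster, so the
   minimum is over a nonempty family; see dist_to_clusterP. *)
Definition dist_to_cluster (T : finType) (G : sgraph T) : nat :=
  #|[arg min_(X < [set: T] | is_cluster (del_vertices G X)) #|X| ]|.

Lemma is_cluster_delT (T : finType) (G : sgraph T) :
  is_cluster (del_vertices G [set: T]).
Proof.
have no (u : {v : T | v \notin [set: T]}) : False.
  by have := valP u; rewrite inE.
apply/existsP; exists set0; apply/andP; split; last by apply/forallP=> u; case: (no u).
have -> : [set: {v : T | v \notin [set: T]}] = set0.
  by apply/setP=> u; case: (no u).
by rewrite partition_set0.
Qed.

Lemma dist_to_clusterP (T : finType) (G : sgraph T) :
  (exists2 X : {set T},
     is_cluster (del_vertices G X) & #|X| = dist_to_cluster G) /\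
  (forall X : {set T},
     is_cluster (del_vertices G X) -> dist_to_cluster G <= #|X|).
Proof.
rewrite /dist_to_cluster.
by case: arg_minnP => [|X clX minX]; [exact: is_cluster_delT | split; [exists X|]].
Qed.

(** * The Maker-Breaker domination game *)

Definition dominating (T : finType) (G : sgraph T) (D : {set T}) : bool :=
  [forall v, (v \in D) || [exists u in D, adj G u v]].

Inductive player := Dominator | Staller.

Definition is_dominator (q : player) : bool :=
  if q is Dominator then true else false.

Definition opponent (q : player) : player :=
  if q is Dominator then Staller else Dominator.

Section Game.
Variables (T : finType) (G : sgraph T) (first : player).

(* The player making the move number i, counting from 0. *)
Definition mover (i : nat) : player := if odd i then opponent first else first.

(* A history is the list of the vertices claimed so far, in order; the game
   goes on until all vertices are claimed. *)
Definition complete_play (h : seq T) : Prop := uniq h /\ size h = #|T|.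

Definition dominator_claims (h : seq T) : {set T} :=
  [set v in h | is_dominator (mover (index v h))].

Definition won_by (q : player) (h : seq T) : bool :=
  let dom := [exists D : {set T}, (D \subset dominator_claims h) && dominating G D] in
  if q is Dominator then dom else ~~ dom.

(* Partial functions, since T may be empty. *)
Definition strategy := seq T -> option T.

Definition legal (s : strategy) : Prop :=
  forall h, uniq h -> size h < #|T| -> exists2 v, s h = Some v & v \notin h.

Definition follows (q : player) (s : strategy) (h : seq T) : Prop :=
  forall i, i < size h -> mover i = q -> onth h i = s (take i h).

Definition has_winning_strategy (q : player) : Prop :=
  exists2 s : strategy, legal s &
    forall h, complete_play h -> follows q s h -> won_by q h.

End Game.

(** * Random access machines *)

(* Unit-cost RAM over unbounded naturals.  Addition and (truncated) subtraction
   are the only arithmetic operations, so that running times agree with those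
   of Turing machines up to a polynomial.  Registers are addressed directly,
   and memory cells only indirectly. *)
Inductive instr :=
| Const (r c : nat)             (* R[r] := c *)
| Add (r a b : nat)             (* R[r] := R[a] + R[b] *)
| Sub (r a b : nat)             (* R[r] := R[a] - R[b] *)
| Read (r a : nat)              (* R[r] := M[R[a]] *)
| Write (a r : nat)             (* M[R[a]] := R[r] *)
| Jz (r l : nat).               (* if R[r] = 0, go to instruction l *)

Definition program := seq instr.

Record state := State { pc : nat; reg : nat -> nat; mem : nat -> nat }.

Definition upd (g : nat -> nat) (i x : nat) : nat -> nat :=
  fun j => if j == i then x else g j.

Definition exec (ins : instr) (s : state) : state :=
  let: State p R M := s in
  match ins with
  | Const r c => State p.+1 (upd R r c) M
  | Add r a b => State p.+1 (upd R r (R a + R b)) M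
  | Sub r a b => State p.+1 (upd R r (R a - R b)) M
  | Read r a => State p.+1 (upd R r (M (R a))) M
  | Write a r => State p.+1 R (upd M (R a) (R r))
  | Jz r l => State (if R r == 0 then l else p.+1) R M
  end.

Definition halted (P : program) (s : state) : bool := size P <= pc s.

(* A halted machine stays in its final state. *)
Definition step (P : program) (s : state) : state :=
  if onth P (pc s) is Some ins then exec ins s else s.

(* P halts within t steps, leaving y in register 0. *)
Definition outputs (P : program) (s : state) (t y : nat) : Prop :=
  let s' := iter t (step P) s in halted P s' /\ reg s' 0 = y.

Definition init (R M : nat -> nat) : state := State 0 R M.

Definition computable (f : nat -> nat) : Prop :=
  exists P : program, forall k,
    exists t, outputs P (init (upd (fun=> 0) 0 k) (fun=> 0)) t (f k).

(** * Fixed-parameter tractability *)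

Record problem := Problem {
  instance : Type;
  encode : instance -> state;
  isize : instance -> nat;
  answer : instance -> nat -> Prop
}.

(* The bound f(p) * (n + 1)^c is the same as f(p) * n^O(1) for n > 0, and is
   also meaningful for n = 0.  The parameter is not part of the input. *)
Definition FPT (Q : problem) (param : instance Q -> nat) : Prop :=
  exists (P : program) (f : nat -> nat) (c : nat), computable f /\
    forall x : instance Q, exists2 y,
      answer x y & outputs P (encode x) (f (param x) * (isize x).+1 ^ c) y.

(** * MB Dom Game *)

Record mbdg_instance := MBDG {
  nvertices : nat;
  graph : sgraph 'I_nvertices;
  first_player : player
}.

Definition player_code (q : player) : nat := is_dominator q.

(* Cell i * n + j holds the adjacency bit of i and j; all other cells hold 0. *)
Definition adj_matrix (n : nat) (G : sgraph 'I_n) (a : nat) : nat :=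
  match insub (a %/ n), insub (a %% n) with
  | Some i, Some j => adj G i j
  | _, _ => 0
  end.

Definition mbdg_encode (x : mbdg_instance) : state :=
  init (upd (upd (fun=> 0) 0 (nvertices x)) 1 (player_code (first_player x)))
       (adj_matrix (graph x)).

Definition mbdg_answer (x : mbdg_instance) (y : nat) : Prop :=
  exists2 q, has_winning_strategy (graph x) (first_player x) q & y = player_code q.

Definition MB_Dom_Game : problem :=
  {| instance := mbdg_instance;
     encode := mbdg_encode;
     isize := nvertices;
     answer := mbdg_answer |}.

(* Main.v *)
(* A maximal set of disjoint induced paths on three vertices covers a set X with
   |X| <= 3 * dist_to_cluster G and G - X a cluster.  A clique of G - X is
   described by the neighbourhoods in X ("links") of its vertices, together with
   the links that occur at least twice in it.  Two reductions keep the winner: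
   delete one of three true twins, and delete one of seven cliques with the same
   description.  The second one rests on pairing strategies if the cliques have a
   repeated link or at least three links, and on a pairing of single vertices if
   they have one link.  If they have two links, that is, if they are edges, then
   a strategy of Staller in the presence of five copies is turned into one in the
   presence of an additional copy, by renaming the copies in the course of the
   play.  What remains is a kernel of size bounded in dist_to_cluster G, whose
   positions, three states per vertex, are evaluated one after the other in a
   table.  The algorithm is written in a small language of bounded loops and
   compiled to random access machines with an exact account of the cost. *)

From HB Require Import structures.
From mathcomp Require Import all_boot fingroup perm zify.
Require Import Defs.

Set Implicit Arguments.
Unset Strict Implicit.
Unset Printing Implicit Defensive.

(** * Positional games and pairing strategies *)

(** A pairing strategy spends two vertices of each clique on dominating the clique itself, and it
    protects a vertex of X only by a pair inside the neighbourhood of that vertex. A repeated link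
    makes one pair do both; a third link leaves vertices over that can be paired across two cliques.
    An edge with two distinct links leaves nothing over, which is why this case needs a simulation
    of strategies. The number seven comes from the case of three links: the clique to be deleted and
    three pairs of cliques, each pair sparing a different one of the three links. No graph is ever
    rebuilt: a reduced instance is a set [W] of surviving vertices of the given graph. The program
    never learns the parameter; the distance enters only in the analysis, through the packing, as a
    bound on the number of table entries. *)

Section PositionalGame.
Variable T : finType.
Implicit Types (F P A B Q : {set T}) (phi : {set T} -> bool) (t : bool).

Definition up_closed phi := forall A B, A \subset B -> phi A -> phi B.

(** The number of free vertices serves as fuel, since the recursion is on sets. With a boolean
    value, determinacy becomes a matter of negation. *)
Fixpoint staller_wins_rec n phi F A t : bool :=
  if n is n'.+1 then
    if t then [exists v in F, staller_wins_rec n' phi (F :\ v) (v |: A) false]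
    else [forall v in F, staller_wins_rec n' phi (F :\ v) A true]
  else phi A.

(* Staller owns A, the vertices of F are free, Dominator owns the rest, t tells
   whether Staller moves next; Staller wins when phi holds of her final set. *)
Definition staller_wins phi F A t := staller_wins_rec #|F| phi F A t.

Lemma staller_wins_ext phi phi' F A t : phi =1 phi' ->
  staller_wins phi F A t = staller_wins phi' F A t.
Proof.
move=> E; rewrite /staller_wins; move: #|F| => m.
elim: m F A t => [|n IH] F A t /=; first exact: E.
by case: t; [apply: eq_existsb | apply: eq_forallb] => v; rewrite IH.
Qed.

Lemma staller_wins0 phi A t : staller_wins phi set0 A t = phi A.
Proof. by rewrite /staller_wins cards0. Qed.

Lemma staller_winsS phi F A : F != set0 ->
  staller_wins phi F A true =
  [exists v in F, staller_wins phi (F :\ v) (v |: A) false].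
Proof.
rewrite /staller_wins -card_gt0; case E: #|F| => [//|n] _ /=.
apply: eq_existsb => v; case vF: (v \in F) => //=.
by have := cardsD1 v F; rewrite vF E add1n => -[<-].
Qed.

Lemma staller_winsD phi F A : F != set0 ->
  staller_wins phi F A false =
  [forall v in F, staller_wins phi (F :\ v) A true].
Proof.
rewrite /staller_wins -card_gt0; case E: #|F| => [//|n] _ /=.
apply: eq_forallb => v; case vF: (v \in F) => //=.
by have := cardsD1 v F; rewrite vF E add1n => -[<-].
Qed.

Lemma staller_move phi F A v : v \in F ->
  staller_wins phi (F :\ v) (v |: A) false -> staller_wins phi F A true.
Proof.
move=> vF w; rewrite staller_winsS; last by apply/set0Pn; exists v.
by apply/existsP; exists v; rewrite vF.
Qed.

Lemma staller_moveP phi F A : F != set0 -> staller_wins phi F A true ->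
  exists2 v, v \in F & staller_wins phi (F :\ v) (v |: A) false.
Proof. by move=> F0; rewrite staller_winsS // => /existsP[v /andP[]]; exists v. Qed.

Lemma dominator_move phi F A v : v \in F ->
  staller_wins phi F A false -> staller_wins phi (F :\ v) A true.
Proof.
move=> vF; rewrite staller_winsD; last by apply/set0Pn; exists v.
by move/forallP/(_ v); rewrite vF.
Qed.

Lemma dominator_moveP phi F A : F != set0 ->
  (forall v, v \in F -> staller_wins phi (F :\ v) A true) ->
  staller_wins phi F A false.
Proof.
move=> F0 w; rewrite staller_winsD //.
by apply/forallP => v; apply/implyP; apply: w.
Qed.

Lemma card_set_ind (Pr : {set T} -> Prop) :
  (forall F, (forall F', #|F'| < #|F| -> Pr F') -> Pr F) -> forall F, Pr F.
Proof.
move=> IH F; have [n] := ubnP #|F|; elim: n F => // n IHn F ltF.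
by apply: IH => F' lt'; apply: IHn; apply: leq_trans lt' _.
Qed.

Lemma cardsD1_lt F v : v \in F -> #|F :\ v| < #|F|.
Proof. by move=> vF; rewrite (cardsD1 v F) vF. Qed.

(** Neither an additional vertex nor an additional move hurts Staller. The two claims need each
    other: when her strategy asks for the vertex [v] that she already owns, she is left with an
    additional move on a smaller set. *)
Lemma extra_move phi F : up_closed phi ->
  (forall A v t, v \in F -> staller_wins phi F A t ->
     staller_wins phi (F :\ v) (v |: A) t) /\
  (forall A, staller_wins phi F A false -> staller_wins phi F A true).
Proof.
move=> up; elim/card_set_ind: F => F IH.
have claim A v t : v \in F -> staller_wins phi F A t ->
    staller_wins phi (F :\ v) (v |: A) t.
  move=> vF; have F0 : F != set0 by apply/set0Pn; exists v.
  have [Fv0 | Fv0] := eqVneq (F :\ v) set0.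
    have -> : F = [set v] by rewrite -(setD1K vF) Fv0 setU0.
    have v0 : [set v] != set0 by apply/set0Pn; exists v; rewrite inE.
    rewrite setDv staller_wins0; case: t => w.
      have [u] := staller_moveP v0 w.
      by rewrite inE => /eqP ->; rewrite setDv staller_wins0.
    have := dominator_move (set11 v) w; rewrite setDv staller_wins0.
    by apply: up; apply: subsetUr.
  case: t => w.
    have [u uF wu] := staller_moveP F0 w.
    have [uv|uv] := eqVneq u v.
      by rewrite uv in wu; apply: (IH _ (cardsD1_lt vF)).2.
    apply: (@staller_move _ _ _ u); first by rewrite !inE uv.
    rewrite setDDl [v |: [set u]]setUC -setDDl setUCA.
    by apply: (IH _ (cardsD1_lt uF)).1; rewrite // !inE eq_sym uv.
  apply: dominator_moveP => // u; rewrite !inE => /andP[uv uF].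
  rewrite setDDl [v |: [set u]]setUC -setDDl.
  apply: (IH _ (cardsD1_lt uF)).1; first by rewrite !inE eq_sym uv.
  exact: dominator_move.
split=> // A w; have [F0 | /set0Pn[v vF]] := eqVneq F set0.
  by move: w; rewrite F0 !staller_wins0.
exact/(staller_move vF)/claim.
Qed.

(* Staller follows her strategy for phi on F and answers inside the pairs
   {v, p v} of P; vertices of P outside any pair serve as waiting moves. *)
Lemma staller_pairing phi phi' F P A A' (p : T -> T) t :
  up_closed phi -> [disjoint F & P] -> involutive p ->
  (forall B Q, B \subset F -> Q \subset P ->
    (forall v, v \in P -> p v \in P -> p v != v -> (v \in Q) || (p v \in Q)) ->
    phi (A :|: B) -> phi' (A' :|: B :|: Q)) ->
  staller_wins phi F A t -> staller_wins phi' (F :|: P) A' t.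
Proof.
move=> up + pK; have [n] := ubnP #|F :|: P|.
elim: n F P A A' t => // n IH F P A A' t ltn dis imp w.
have IHsub F1 P1 A1 A1' t1 v : v \in F :|: P ->
    F1 :|: P1 \subset (F :|: P) :\ v -> [disjoint F1 & P1] ->
    (forall B Q, B \subset F1 -> Q \subset P1 ->
      (forall v, v \in P1 -> p v \in P1 -> p v != v -> (v \in Q) || (p v \in Q)) ->
      phi (A1 :|: B) -> phi' (A1' :|: B :|: Q)) ->
    staller_wins phi F1 A1 t1 -> staller_wins phi' (F1 :|: P1) A1' t1.
  move=> vFP sub; apply: IH; apply: leq_ltn_trans (subset_leq_card sub) _.
  by apply: leq_trans (cardsD1_lt vFP) _.
have FP v : v \in F -> v \notin P.
  by move=> vF; apply/negP => vP; have := disjointFr dis vF; rewrite vP.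
have [FP0 | FP0] := eqVneq (F :|: P) set0.
  have F0 : F = set0 by apply/eqP; rewrite -subset0 -FP0 subsetUl.
  have P0 : P = set0 by apply/eqP; rewrite -subset0 -FP0 subsetUr.
  move: w; rewrite FP0 F0 !staller_wins0 => phiA.
  rewrite -[A']setU0 -[A' :|: set0]setU0; apply: imp; rewrite ?sub0set ?setU0 //.
  by move=> v; rewrite P0 inE.
have DUl v : v \in F -> (F :|: P) :\ v = (F :\ v) :|: P.
  by move=> vF; apply/setP => x; rewrite !inE; case: eqVneq => //= ->;
     rewrite (negPf (FP v vF)).
have DUr v : v \in P -> (F :|: P) :\ v = F :|: (P :\ v).
  move=> vP; apply/setP => x; rewrite !inE; case: eqVneq => //= ->.
  by rewrite orbF; symmetry; apply: contraTF vP; apply: FP.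
have disl v : [disjoint F :\ v & P] by apply: disjointWl (subD1set _ _) dis.
have disr v : [disjoint F & P :\ v] by apply: disjointWr (subD1set _ _) dis.
have impl v : v \in F -> forall B Q, B \subset F :\ v -> Q \subset P ->
    (forall v, v \in P -> p v \in P -> p v != v -> (v \in Q) || (p v \in Q)) ->
    (phi ((v |: A) :|: B) -> phi' ((v |: A') :|: B :|: Q)) /\
    (phi (A :|: B) -> phi' (A' :|: B :|: Q)).
  move=> vF B Q sB sQ hQ; split; last first.
    by apply: imp => //; apply: subset_trans sB (subD1set _ _).
  have sB' : v |: B \subset F.
    by rewrite subUset sub1set vF (subset_trans sB (subD1set _ _)).
  have -> : v |: A :|: B = A :|: (v |: B) by rewrite setUCA setUA.
  have -> : v |: A' :|: B = A' :|: (v |: B) by rewrite setUCA setUA.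
  exact: imp.
have inFPl v : v \in F -> v \in F :|: P by rewrite inE => ->.
have inFPr v : v \in P -> v \in F :|: P by rewrite inE orbC => ->.
case: t w => w.
  (* The play on [F] is over: Staller takes any vertex of [P], which can only help to meet the
     condition on pairs. *)
  have [F0 | F0] := eqVneq F set0.
    have /set0Pn[v vP] : P != set0 by move: FP0; rewrite F0 set0U.
    apply: (staller_move (inFPr v vP)); rewrite DUr //.
    apply: (@IHsub F (P :\ v) A (v |: A') false v) => //; rewrite ?DUr ?inFPr //.
      move=> B Q sB sQ hQ phiA.
      have -> : v |: A' :|: B :|: Q = A' :|: B :|: (v |: Q).
        by rewrite -setUA [v |: _]setUC -setUA -[A' :|: B :|: _]setUA;
           congr (_ :|: _); rewrite setUCA.
      apply: imp => //.
        by rewrite subUset sub1set vP (subset_trans sQ (subD1set _ _)).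
      move=> x xP pxP pxx; rewrite !inE.
      have [//|xv] := eqVneq x v; have [|pxv] /= := eqVneq (p x) v.
        by rewrite orbT.
      by apply: hQ; rewrite // !inE ?xv ?pxv.
    by move: w; rewrite F0 !staller_wins0.
  have [v vF wv] := staller_moveP F0 w.
  apply: (staller_move (inFPl v vF)); rewrite DUl //.
  apply: (IHsub _ _ _ _ _ v) wv; rewrite ?DUl ?inFPl //.
  by move=> B Q sB sQ hQ; apply: (impl v vF B Q sB sQ hQ).1.
apply: dominator_moveP => // v; rewrite inE => /orP[vF | vP].
  rewrite DUl //; apply: (IHsub _ _ _ _ _ v) (dominator_move vF w);
    rewrite ?DUl ?inFPl // => B Q sB sQ hQ.
  exact: (impl v vF B Q sB sQ hQ).2.
(* A move of Dominator outside all remaining pairs gives Staller the turn in the play on [F], where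
   an additional move does no harm. *)
have [pvP | pvP] := boolP ((p v \in P) && (p v != v)); last first.
  rewrite DUr //; apply: (IHsub _ _ A _ _ v); rewrite ?DUr ?inFPr //.
    move=> B Q sB sQ hQ; apply: imp => //.
      exact: subset_trans sQ (subD1set _ _).
    move=> x xP pxP pxx; apply: hQ; rewrite // !inE ?xP ?pxP ?andbT //.
      by apply: contraNneq pvP => <-; rewrite pxP.
    by apply: contraNneq pvP => <-; rewrite pK xP eq_sym.
  exact: (extra_move F up).2.
case/andP: pvP => pvP pvv; rewrite DUr //.
apply: (@staller_move _ _ _ (p v)); first by rewrite !inE pvv pvP orbT.
have -> : (F :|: P :\ v) :\ p v = F :|: (P :\ v :\ p v).
  rewrite setDUl; congr (_ :|: _); apply/setDidPl.
  rewrite disjoint_sym disjoints1; apply: contraL pvP; exact: FP.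
apply: (IHsub F (P :\ v :\ p v) A (p v |: A') false v); rewrite ?inFPr //.
- rewrite DUr //; apply: setUS; exact: subD1set.
- by apply: disjointWr (disr v); apply: subD1set.
move=> B Q sB sQ hQ phiA.
have -> : p v |: A' :|: B :|: Q = A' :|: B :|: (p v |: Q).
  by rewrite -setUA [p v |: _]setUC -setUA -[A' :|: B :|: _]setUA;
     congr (_ :|: _); rewrite setUCA.
apply: imp => //.
  rewrite subUset sub1set pvP (subset_trans sQ) //.
  by rewrite (subset_trans (subD1set _ _)) // subD1set.
move=> x xP pxP pxx; rewrite !inE (inv_eq pK) pK.
have [->|xv] := eqVneq x v; first by rewrite orbT.
have [//|xpv] := eqVneq x (p v).
rewrite /=; apply: hQ; rewrite // !inE ?xpv ?xv ?xP //.
by rewrite pxP (inj_eq (inv_inj pK)) xv (inv_eq pK) xpv.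
Qed.

(** The goal of Dominator, as a condition on the vertices that Dominator ends up with. *)
Definition dual phi A := ~~ phi (~: A).

Lemma up_closed_dual phi : up_closed phi -> up_closed (dual phi).
Proof.
move=> up A B sAB; apply: contra; apply: up.
by rewrite setCS.
Qed.

(** Determinacy: negation exchanges the two quantifiers, and Dominator starts from the vertices that
    are neither free nor Staller's. *)
Lemma staller_wins_dual phi F A t : [disjoint F & A] ->
  staller_wins (dual phi) F (~: (F :|: A)) (~~ t) = ~~ staller_wins phi F A t.
Proof.
elim/card_set_ind: F A t => F IH A t dis.
have [F0 | F0] := eqVneq F set0.
  by rewrite F0 !staller_wins0 set0U /dual setCK.
have FA v : v \in F -> v \notin A.
  by move=> vF; apply/negP => vA; have := disjointFr dis vF; rewrite vA.
case: t => /=.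
  rewrite staller_winsS // staller_winsD // negb_exists.
  apply: eq_forallb => v; rewrite negb_and -implybE.
  case vF: (v \in F) => //=; rewrite -IH ?cardsD1_lt //=.
    congr (staller_wins _ _ (~: _) _); apply/setP => x; rewrite !inE.
    by case: eqVneq => [->|_] /=; rewrite ?vF ?orbT.
  rewrite disjoint_subset; apply/subsetP => x; rewrite !inE => /andP[/negPf-> xF].
  by rewrite FA.
rewrite staller_winsS // staller_winsD // negb_forall.
apply: eq_existsb => v; rewrite negb_imply.
case vF: (v \in F) => //=; rewrite -IH ?cardsD1_lt //=.
  congr (staller_wins _ _ _ _); apply/setP => x; rewrite !inE.
  by case: eqVneq => [->|_] /=; rewrite ?(negPf (FA v vF)) ?orbF ?vF.
exact: disjointWl (subD1set _ _) dis.
Qed.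

(* Dominator's pairing strategy, in contrapositive form: the roles of the players
   are exchanged by [dual]. *)
Lemma dominator_pairing phi phi' F P A A' (p : T -> T) t :
  up_closed phi -> [disjoint F & P] -> [disjoint F & A] ->
  [disjoint F :|: P & A'] -> involutive p ->
  (forall B Q, B \subset F -> Q \subset P ->
    (forall v, v \in P -> p v \in P -> p v != v -> (v \notin Q) || (p v \notin Q)) ->
    phi' (A' :|: B :|: Q) -> phi (A :|: B)) ->
  staller_wins phi' (F :|: P) A' t -> staller_wins phi F A t.
Proof.
move=> up disFP disFA disFPA' pK imp; apply: contraTT.
rewrite -!staller_wins_dual //.
apply: (@staller_pairing _ _ _ _ _ _ p) => //; first exact: up_closed_dual.
move=> B Q sB sQ hQ; apply: contra.
have -> : ~: (~: (F :|: P :|: A') :|: B :|: Q) = A' :|: (F :\: B) :|: (P :\: Q).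
  apply/setP => x; rewrite !inE.
  have := subsetP sB x; have := subsetP sQ x.
  have := disjointFl disFPA' (x := x); have := disjointFr disFP (x := x).
  rewrite !inE; case: (x \in A'); case: (x \in F); case: (x \in P);
    case: (x \in B); case: (x \in Q) => //= h1 h2 h3 h4;
  first [by have := h1 isT | by have := h2 isT | by have := h3 isT | by have := h4 isT].
have -> : ~: (~: (F :|: A) :|: B) = A :|: (F :\: B).
  apply/setP => x; rewrite !inE.
  have := subsetP sB x; have := disjointFl disFA (x := x).
  by case: (x \in A); case: (x \in F); case: (x \in B) => //= h1 h2;
     first [by have := h2 isT | by have := h1 isT].
apply: imp; rewrite ?subsetDl // => v vP pvP pvv.
by rewrite !inE vP pvP !andbT !negbK; apply: hQ.
Qed.

Lemma staller_mono phi phi' F A A' t : up_closed phi ->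
  (forall B, B \subset F -> phi (A :|: B) -> phi' (A' :|: B)) ->
  staller_wins phi F A t -> staller_wins phi' F A' t.
Proof.
move=> up imp w; rewrite -[F]setU0.
apply: (@staller_pairing phi _ F set0 A A' id) => //.
  by rewrite -setI_eq0 setI0.
move=> B Q sB; rewrite subset0 => /eqP -> _; rewrite setU0; exact: imp.
Qed.

(** Symmetries of the winning condition allow copies to exchange their names in the middle of a
    play. *)
Lemma staller_wins_perm phi F A t (s : {perm T}) :
  (forall B, phi (s @: B) = phi B) ->
  staller_wins phi (s @: F) (s @: A) t = staller_wins phi F A t.
Proof.
move=> sphi; elim/card_set_ind: F A t => F IH A t.
have [-> | F0] := eqVneq F set0; first by rewrite imset0 !staller_wins0.
have sF0 : s @: F != set0 by rewrite imset_eq0.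
have memS (X : {set T}) v : (s v \in s @: X) = (v \in X) by rewrite mem_imset //; apply: perm_inj.
have mem v := memS F v.
have D v : (s @: F) :\ s v = s @: (F :\ v).
  apply/setP => x; rewrite -(permKV s x); move: (s^-1%g x) => y.
  by rewrite memS !inE memS (inj_eq perm_inj).
case: t.
  rewrite !staller_winsS //; apply/existsP/existsP.
    case=> v; have -> : v = s (s^-1%g v) by rewrite permKV.
    move: (s^-1%g v) => u; rewrite mem => /andP[uF w]; exists u; rewrite uF /=.
    by rewrite -IH ?cardsD1_lt // -D imsetU1.
  case=> u /andP[uF w]; exists (s u); rewrite mem uF /=.
  by rewrite D -imsetU1 IH ?cardsD1_lt.
rewrite !staller_winsD //; apply/forallP/forallP => w v.
  apply/implyP => vF; have := w (s v); rewrite mem vF /= D IH //.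
  exact: cardsD1_lt.
have -> : v = s (s^-1%g v) by rewrite permKV.
move: (s^-1%g v) => u; rewrite mem; apply/implyP => uF.
by rewrite D IH ?cardsD1_lt //; have := w u; rewrite uF.
Qed.
End PositionalGame.

(** * Copies of a pair of vertices *)

Section Swap.
Variables (T : eqType) (x1 x2 y1 y2 : T).
Hypothesis uniq4 : uniq [:: x1; x2; y1; y2].

(** It serves both as a pairing of the equal ends of two copies and as the permutation that
    exchanges two copies. *)
Definition swap2 x :=
  if x == x1 then x2 else if x == x2 then x1 else
  if x == y1 then y2 else if x == y2 then y1 else x.

Lemma swap2_neq : [/\ x2 != x1, y1 != x1, y2 != x1, y1 != x2 & [/\ y2 != x2 & y2 != y1]].
Proof.
move: uniq4; rewrite /= !inE !negb_or.
case/and4P => /and3P[h1 h2 h3] /andP[h4 h5] h6 _.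
by do ?split; rewrite eq_sym.
Qed.

Lemma swap2E : [/\ swap2 x1 = x2, swap2 x2 = x1, swap2 y1 = y2 & swap2 y2 = y1].
Proof.
have [h1 h2 h3 h4 [h5 h6]] := swap2_neq.
rewrite /swap2 !eqxx (negPf h1) (negPf h2) (negPf h3) (negPf h4) (negPf h5).
by rewrite (negPf h6).
Qed.

Lemma swap2K : involutive swap2.
Proof.
have [e1 e2 e3 e4] := swap2E => x; rewrite {2}/swap2.
case: eqVneq => [->//|n1]; case: eqVneq => [->//|n2].
case: eqVneq => [->//|n3]; case: eqVneq => [->//|n4].
by rewrite /swap2 (negPf n1) (negPf n2) (negPf n3) (negPf n4).
Qed.
End Swap.

Section TwoVertexCopies.
Variables (T I : finType) (R : {set T}).
Implicit Types (F P A B Q : {set T}) (t : bool) (J : {set I}) (a b : I -> T).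

(** Monotone and dependent only on the part inside [R], in one condition. *)
Definition local_up (rho : {set T} -> bool) :=
  forall A B, A :&: R \subset B -> rho A -> rho B.

Variables rho tau gamma : {set T} -> bool.
Hypotheses (rho_loc : local_up rho) (tau_loc : local_up tau).
Hypothesis gamma_loc : local_up gamma.

Lemma local_up_closed h : local_up h -> up_closed h.
Proof. by move=> loc A B sAB; apply: loc; apply: subset_trans sAB; apply: subsetIl. Qed.

Lemma local_upE h A B : local_up h -> A :&: R = B :&: R -> h A = h B.
Proof.
move=> loc E; apply/idP/idP; apply: loc; first by rewrite E subsetIl.
by rewrite -E subsetIl.
Qed.

Definition both_claimed a b J A := [exists i in J, (a i \in A) && (b i \in A)].

(* The final sets of Staller that leave some vertex undominated, when the copies
   {a i, b i} of an edge are joined to R in the same way: the vertices of R that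
   see no copy account for rho, those of the copies for tau, and those of R that
   see all a i, all b i, or all of both for alpha, beta and gamma. *)
Definition copies_phi a b (alpha beta : {set T} -> bool) J A :=
  [|| rho A, both_claimed a b J A && tau A,
      [forall i in J, a i \in A] && alpha A,
      [forall i in J, b i \in A] && beta A |
      [forall i in J, (a i \in A) && (b i \in A)] && gamma A].

Definition pair_of a b (i : I) : {set T} := [set a i; b i].

Definition copies_ok a b :=
  [/\ injective a, injective b, forall i j, a i != b j &
      forall i, (a i \notin R) && (b i \notin R)].

Definition within a b J F :=
  forall x, x \in F -> x \in R \/ exists2 i, i \in J & x \in pair_of a b i.

Lemma both_claimedC a b J A : both_claimed a b J A = both_claimed b a J A.
Proof. by apply: eq_existsb => i; rewrite (andbC (a i \in A)). Qed.

(** The two ends of the copies are interchangeable, so that only moves on the [a] side have to be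
    analysed. *)
Lemma copies_phiC a b alpha beta J A :
  copies_phi a b alpha beta J A = copies_phi b a beta alpha J A.
Proof.
rewrite /copies_phi both_claimedC; do 2!congr (_ || _); rewrite orbCA.
do 2!congr (_ || _); congr (_ && _); apply: eq_forallb => i.
by rewrite (andbC (a i \in A)).
Qed.

Lemma copies_phi_up a b alpha beta J : local_up alpha -> local_up beta ->
  up_closed (copies_phi a b alpha beta J).
Proof.
move=> al bl A B sAB; have sub x : x \in A -> x \in B by apply/subsetP.
case/or4P => [h|/andP[/existsP[i /and3P[iJ ai bi]] h]|/andP[/forall_inP f h]|].
- by rewrite /copies_phi (local_up_closed rho_loc sAB h).
- rewrite /copies_phi (local_up_closed tau_loc sAB h) andbT.
  by apply/orP; right; apply/orP; left; apply/existsP; exists i; rewrite iJ !sub.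
- rewrite /copies_phi (local_up_closed al sAB h) andbT.
  by apply/or4P; constructor 3; apply/forall_inP => i iJ; rewrite sub ?f.
case/orP => /andP[/forall_inP f h]; apply/or4P; constructor 4; apply/orP.
  left; rewrite (local_up_closed bl sAB h) andbT.
  by apply/forall_inP => i iJ; rewrite sub ?f.
right; rewrite (local_up_closed gamma_loc sAB h) andbT.
by apply/forall_inP => i iJ; have /andP[? ?] := f i iJ; rewrite !sub.
Qed.

Lemma setIR_U A B Q : [disjoint Q & R] -> (A :|: B :|: Q) :&: R \subset A :|: B.
Proof.
move=> dis; apply/subsetP => x; rewrite !inE => /andP[/orP[//|xQ] xR].
by rewrite (disjointFr dis xQ) in xR.
Qed.

Lemma local_setU h A B : local_up h -> h A -> h (A :|: B).
Proof. by move=> loc; apply: local_up_closed => //; apply: subsetUl. Qed.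

Lemma both_claimedU a b J J' A B : J \subset J' ->
  both_claimed a b J A -> both_claimed a b J' (A :|: B).
Proof.
move=> sJ /existsP[i /and3P[iJ ai bi]]; apply/existsP; exists i.
by rewrite (subsetP sJ) //= !inE ai bi.
Qed.

(* Dominator owns an a and a b, so only the rho and tau clauses survive. *)
Lemma dead_copies a b alpha beta J e F A t : local_up alpha -> local_up beta ->
  [disjoint F & pair_of a b e] ->
  (exists2 i, i \in J & a i \notin F :|: A) ->
  (exists2 i, i \in J & b i \notin F :|: A) ->
  staller_wins (copies_phi a b alpha beta J) F A t ->
  staller_wins (copies_phi a b alpha beta (e |: J)) (F :|: pair_of a b e) A t.
Proof.
move=> al bl dis [i iJ ai] [j jJ bj].
have up := copies_phi_up (a := a) (b := b) (J := J) al bl.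
(* The identity has no proper pairs: the new copy only supplies waiting moves. *)
apply: (@staller_pairing _ _ _ _ _ A A id) => // B Q sB sQ _ w.
have notin x : x \notin F :|: A -> x \in A :|: B = false.
  rewrite !inE negb_or => /andP[xF /negPf ->] /=.
  by apply: contraNF xF => /(subsetP sB).
case/or4P: w => [h|/andP[c h]|/andP[/forall_inP f _]|/orP[]/andP[/forall_inP f _]].
- by rewrite /copies_phi (local_setU _ rho_loc h).
- rewrite /copies_phi (both_claimedU _ (subsetUr [set e] J) c).
  by rewrite (local_setU _ tau_loc h) orbT.
- by have := f i iJ; rewrite notin.
- by have := f j jJ; rewrite notin.
- by have := f i iJ; rewrite notin.
Qed.

(** Given two untouched copies, Dominator can pair [a i1] with [a i2] and [b i1] with [b i2], which
    defeats the last three clauses of [copies_phi]. So Staller already wins the play on [R] for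
    [rho] or [tau], and [tau] is enough once some copy is wholly hers. Here [w1] and [w2] are two
    free vertices either of which completes a copy, and [w1 = w2] encodes that a copy is complete
    already. *)
Lemma collapse_copies a b alpha beta J e F A t i1 i2 :
  copies_ok a b -> local_up alpha -> local_up beta ->
  [disjoint F & A] -> [disjoint F & pair_of a b e] ->
  i1 \in J -> i2 \in J -> i1 != i2 ->
  [&& a i1 \in F, b i1 \in F, a i2 \in F & b i2 \in F] ->
  (exists w1 w2, [/\ (w1 == w2) || ((w1 \in F :\: R) && (w2 \in F :\: R)),
     (forall Q, w1 != w2 -> (w1 \in Q) || (w2 \in Q) -> both_claimed a b J (A :|: Q)) &
     (w1 = w2 -> both_claimed a b J A)]) ->
  staller_wins (copies_phi a b alpha beta J) F A t ->
  staller_wins (copies_phi a b alpha beta (e |: J)) (F :|: pair_of a b e) A t.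
Proof.
move=> [ainj binj abN abR] al bl disFA disFe i1J i2J i12 /and4P[ai1 bi1 ai2 bi2] hw w.
pose phi0 A := rho A || tau A.
have up0 : up_closed phi0.
  move=> B C sBC /orP[] h; rewrite /phi0.
    by rewrite (local_up_closed rho_loc sBC).
  by rewrite (local_up_closed tau_loc sBC) ?orbT.
have FE : (F :&: R) :|: (F :\: R) = F by rewrite setID.
have disR Q : Q \subset F :\: R -> [disjoint Q & R].
  move=> sQ; apply: disjointWl sQ _; rewrite disjoint_subset; apply/subsetP => x.
  by rewrite !inE => /andP[].
have disFR : [disjoint F :&: R & F :\: R].
  rewrite disjoint_sym disjoint_subset; apply/subsetP => x; rewrite !inE.
  by move=> /andP[/negPf->]; rewrite andbF.
have w0 : staller_wins phi0 (F :&: R) A t.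
  have u4 : uniq [:: a i1; a i2; b i1; b i2].
    by rewrite /= !inE !negb_or !abN (inj_eq ainj) (inj_eq binj) i12.
  have [e1 e2 e3 e4] := swap2E u4.
  have inP x : x \in F -> x \notin R -> x \in F :\: R by rewrite inE => -> ->.
  have notA B x : B \subset F :&: R -> x \in F -> x \notin R -> x \notin A :|: B.
    move=> sB ciF ciR; rewrite inE negb_or (disjointFr disFA ciF) /=.
    by apply: contra ciR => /(subsetP sB); rewrite inE => /andP[].
  apply: (@dominator_pairing _ phi0 (copies_phi a b alpha beta J) (F :&: R)
     (F :\: R) A A (swap2 (a i1) (a i2) (b i1) (b i2))) => //; rewrite ?FE //.
  - by apply: disjointWl (subsetIl _ _) disFA.
  - exact: swap2K.
  move=> B Q sB sQ hQ.
  have [ra1 rb1] := andP (abR i1); have [ra2 rb2] := andP (abR i2).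
  have noa : ~ (forall i, i \in J -> a i \in A :|: B :|: Q).
    move=> al'; have := al' i1 i1J; have := al' i2 i2J.
    rewrite !(in_setU _ (A :|: B)) !(negPf (notA B _ sB _ _)) //= => q2 q1.
    have := hQ (a i1) (inP _ ai1 ra1); rewrite e1 q1 q2 inP // => /(_ isT).
    by rewrite (inj_eq ainj) eq_sym i12 => /(_ isT).
  have nob : ~ (forall i, i \in J -> b i \in A :|: B :|: Q).
    move=> al'; have := al' i1 i1J; have := al' i2 i2J.
    rewrite !(in_setU _ (A :|: B)) !(negPf (notA B _ sB _ _)) //= => q2 q1.
    have := hQ (b i1) (inP _ bi1 rb1); rewrite e3 q1 q2 inP // => /(_ isT).
    by rewrite (inj_eq binj) eq_sym i12 => /(_ isT).
  rewrite /phi0; case/or4P => [h|/andP[_ h]|/andP[/forall_inP f _]|/orP[]/andP[/forall_inP f _]].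
  - by rewrite (rho_loc (setIR_U _ _ (disR Q sQ)) h).
  - by rewrite (tau_loc (setIR_U _ _ (disR Q sQ)) h) orbT.
  - by case: noa.
  - by case: nob.
  - by case: noa => i /f /andP[].
have [w1 [w2 [hw12 hQ hA]]] := hw.
have -> : F :|: pair_of a b e = (F :&: R) :|: ((F :\: R) :|: pair_of a b e).
  by rewrite setUA FE.
(* The pair of [w1] and [w2] secures a complete copy; all else outside [R], including the new copy,
   is a waiting move. *)
apply: (@staller_pairing _ phi0 _ _ _ A A (tperm w1 w2)) w0 => //.
- rewrite disjoint_subset; apply/subsetP => x; rewrite !inE => /andP[xF xR].
  by have := disjointFr disFe xF; rewrite !inE xR => /= ->.
- exact: tpermK.
move=> B Q sB sQ hp; rewrite /phi0 /copies_phi => /orP[] h.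
  by rewrite (local_setU _ rho_loc h).
rewrite (local_setU _ tau_loc h) andbT; apply/orP; right; apply/orP; left.
rewrite -setUA; have [w12|w12] := eqVneq w1 w2.
  exact: (both_claimedU _ (subsetUr _ _) (hA w12)).
rewrite -[e |: J]setUid.
have /(both_claimedU set0 (subsetUr [set e] J)) : both_claimed a b J (A :|: (B :|: Q)).
  apply: hQ => //; move: hw12; rewrite (negPf w12) /= => /andP[w1F w2F].
  have inU x : x \in F :\: R -> x \in F :\: R :|: pair_of a b e.
    by rewrite in_setU => ->.
  have := hp w1; rewrite tpermL eq_sym => /(_ (inU _ w1F) (inU _ w2F) w12).
  by rewrite !inE => /orP[] ->; rewrite ?orbT.
by rewrite setU0 setUid.
Qed.

Definition fresh a b F i := (a i \in F) && (b i \in F).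

(** A threat of Staller to complete copy [i]. *)
Definition half a b F A i :=
  ((a i \in A) && (b i \in F)) || ((a i \in F) && (b i \in A)).

(** Dominator owns one of the [a i], so Staller can no longer claim all of them. *)
Definition lost a J F A := [exists i in J, a i \notin F :|: A].

(* The last clause makes sure that at least two fresh copies are left when
   Staller claims both vertices of a copy, or half of each of two copies. *)
Definition copies_inv a b J F A :=
  [/\ within a b J F, [disjoint F & A], ~~ both_claimed a b J A,
      {in J &, forall i j, half a b F A i -> half a b F A j -> i = j} &
      4 < #|[set i in J | fresh a b F i]| + [exists i in J, half a b F A i] +
          (lost a J F A || lost b J F A)].

Lemma copies_okC a b : copies_ok a b -> copies_ok b a.
Proof. by case=> ? ? ab abR; split=> // [i j|i]; rewrite 1?eq_sym 1?andbC. Qed.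

Lemma pair_ofC a b i : pair_of a b i = pair_of b a i.
Proof. by rewrite /pair_of setUC. Qed.

Lemma halfC a b F A i : half a b F A i = half b a F A i.
Proof. by rewrite /half orbC andbC (andbC (a i \in A)). Qed.

Lemma copies_invC a b J F A : copies_inv a b J F A -> copies_inv b a J F A.
Proof.
case=> wi dis nb un; have -> : [set i in J | fresh a b F i] = [set i in J | fresh b a F i].
  by apply/setP => i; rewrite !inE /fresh (andbC (a i \in F)).
rewrite (eq_existsb (P2 := fun i => (i \in J) && half b a F A i)); last first.
  by move=> i; rewrite halfC.
rewrite orbC => lt; split=> //; last by move=> i j iJ jJ; rewrite !(halfC b a); apply: un.
  by move=> x /wi[]; [left | case=> i iJ; rewrite pair_ofC; right; exists i].
by rewrite both_claimedC.
Qed.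

(** * Exchanging two copies *)

Section Swapped.
Variables (a b : I -> T) (e i : I).
Hypotheses (ok : copies_ok a b) (ie : i != e).

Lemma copies_uniq4 : uniq [:: a e; a i; b e; b i].
Proof.
case: ok => ainj binj ab _.
by rewrite /= !inE !negb_or !ab (inj_eq ainj) (inj_eq binj) eq_sym ie.
Qed.

Definition copy_swap : {perm T} := perm (inv_inj (swap2K copies_uniq4)).

Lemma copy_swapE x : copy_swap x = swap2 (a e) (a i) (b e) (b i) x.
Proof. by rewrite permE. Qed.

Lemma copy_swapK : involutive copy_swap.
Proof. by move=> x; rewrite !copy_swapE swap2K // copies_uniq4. Qed.

Lemma mem_copy_swap (X : {set T}) x : (x \in copy_swap @: X) = (copy_swap x \in X).
Proof. by rewrite -{1}(copy_swapK x) mem_imset //; apply: perm_inj. Qed.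

Lemma copy_swapa j : copy_swap (a j) = a (tperm e i j).
Proof.
case: ok => ainj binj ab _; have [e1 e2 e3 e4] := swap2E copies_uniq4.
rewrite copy_swapE; case: tpermP => [->|->|/eqP je /eqP ji]; rewrite ?e1 ?e2 //.
by rewrite /swap2 !(inj_eq ainj) !(negPf (ab _ _)) (negPf je) (negPf ji).
Qed.

Lemma copy_swapb j : copy_swap (b j) = b (tperm e i j).
Proof.
case: ok => ainj binj ab _; have [e1 e2 e3 e4] := swap2E copies_uniq4.
rewrite copy_swapE; case: tpermP => [->|->|/eqP je /eqP ji]; rewrite ?e3 ?e4 //.
have ba k : (b j == a k) = false by rewrite eq_sym; apply: negbTE (ab _ _).
by rewrite /swap2 !ba !(inj_eq binj) (negPf je) (negPf ji).
Qed.

Lemma copy_swapR x : x \in R -> copy_swap x = x.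
Proof.
case: ok => _ _ _ abR xR; rewrite copy_swapE /swap2.
have [/andP[ae be] /andP[ai bi]] := (abR e, abR i).
have ne y : y \notin R -> (x == y) = false by move=> yR; apply: contraNF yR => /eqP <-.
by rewrite !ne.
Qed.

Lemma copy_swap_id x : x != a e -> x != a i -> x != b e -> x != b i -> copy_swap x = x.
Proof.
by move=> h1 h2 h3 h4; rewrite copy_swapE /swap2 (negPf h1) (negPf h2) (negPf h3) (negPf h4).
Qed.

Lemma copy_swap_set (X Y : {set T}) :
  (a e \in Y) = (a i \in X) -> (a i \in Y) = (a e \in X) ->
  (b e \in Y) = (b i \in X) -> (b i \in Y) = (b e \in X) ->
  (forall x, x != a e -> x != a i -> x != b e -> x != b i -> (x \in Y) = (x \in X)) ->
  copy_swap @: X = Y.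
Proof.
move=> h1 h2 h3 h4 h; have [s1 s2 s3 s4] := swap2E copies_uniq4.
apply/setP => x; rewrite mem_copy_swap.
have [->|n1] := eqVneq x (a e); first by rewrite copy_swapE s1.
have [->|n2] := eqVneq x (a i); first by rewrite copy_swapE s2.
have [->|n3] := eqVneq x (b e); first by rewrite copy_swapE s3.
have [->|n4] := eqVneq x (b i); first by rewrite copy_swapE s4.
by rewrite copy_swap_id // h.
Qed.

Lemma copies_phi_swap alpha beta J B : local_up alpha -> local_up beta ->
  e \in J -> i \in J ->
  copies_phi a b alpha beta J (copy_swap @: B) = copies_phi a b alpha beta J B.
Proof.
move=> al bl eJ iJ.
have tJ j : (tperm e i j \in J) = (j \in J) by case: tpermP => [->|->|//]; rewrite ?eJ ?iJ.
have R_eq h : local_up h -> h (copy_swap @: B) = h B.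
  move=> loc; apply: local_upE => //; apply/setP => x; rewrite !inE mem_copy_swap.
  by case xR: (x \in R); rewrite ?andbF // copy_swapR.
have all_eq (p q : pred I) : (forall j, p j = q (tperm e i j)) ->
    [forall (j | j \in J), p j] = [forall (j | j \in J), q j].
  move=> pq; apply/forall_inP/forall_inP => h j jJ.
    by have := h (tperm e i j); rewrite tJ pq tpermK; apply.
  by rewrite pq; apply: h; rewrite tJ.
rewrite /copies_phi (R_eq _ rho_loc) (R_eq _ tau_loc) (R_eq _ al) (R_eq _ bl).
rewrite (R_eq _ gamma_loc); congr (_ || ((_ && _) || ((_ && _) || ((_ && _) || (_ && _))))).
- apply/existsP/existsP => -[j].
    by rewrite !mem_copy_swap copy_swapa copy_swapb => h; exists (tperm e i j); rewrite tJ.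
  by move=> h; exists (tperm e i j); rewrite tJ !mem_copy_swap copy_swapa copy_swapb tpermK.
- by apply: all_eq => j; rewrite mem_copy_swap copy_swapa.
- by apply: all_eq => j; rewrite mem_copy_swap copy_swapb.
- by apply: all_eq => j; rewrite !mem_copy_swap copy_swapa copy_swapb.
Qed.
End Swapped.

Lemma within_notin a b J F j : copies_ok a b -> within a b J F -> j \notin J ->
  (a j \notin F) && (b j \notin F).
Proof.
case=> ainj binj ab abR wi jJ; have /andP[aR bR] := abR j.
apply/andP; split.
  apply/negP => /wi[|[i iJ]]; first by rewrite (negPf aR).
  rewrite !inE (negPf (ab _ _)) orbF => /eqP/ainj E.
  by rewrite E iJ in jJ.
apply/negP => /wi[|[i iJ]]; first by rewrite (negPf bR).
rewrite !inE eq_sym (negPf (ab _ _)) /= => /eqP/binj E.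
by rewrite E iJ in jJ.
Qed.

Lemma fresh_setD a b J F i : copies_ok a b ->
  [set k in J | fresh a b (F :\ a i) k] = [set k in J | fresh a b F k] :\ i.
Proof.
case=> ainj binj ab abR; apply/setP => k.
rewrite !inE /fresh !inE (inj_eq ainj) [b k == _]eq_sym (negPf (ab _ _)) /=.
by case: (k == i); rewrite ?andbF.
Qed.

Lemma half_dominator a b F A i k : copies_ok a b -> [disjoint F & A] -> a i \in F ->
  half a b (F :\ a i) A k = half a b F A k && (k != i).
Proof.
case=> ainj binj ab abR dis aiF.
rewrite /half !inE (inj_eq ainj) [b k == _]eq_sym (negPf (ab _ _)) /=.
case: eqVneq => [->|_]; last by rewrite andbT.
by rewrite (disjointFr dis aiF) !andbF.
Qed.

Lemma half_staller a b F A i k : copies_ok a b ->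
  half a b (F :\ a i) (a i |: A) k = if k == i then b i \in F else half a b F A k.
Proof.
case=> ainj binj ab abR.
rewrite /half !inE (inj_eq ainj) [b k == _]eq_sym (negPf (ab _ _)) /=.
by case: eqVneq => [->|_] //=; rewrite orbF.
Qed.

(** Three untouched copies always remain: one for the move under consideration and two for
    [collapse_copies]. Five at the start are enough because a threat and a loss are each counted
    once. *)
Lemma gt2_of_gt4 m (x y : bool) : 4 < m + x + y -> 2 < m.
Proof.
by case: x; case: y; case: m => [|[|[|m]]].
Qed.

Section Simulation.
Variables (e : I) (J : {set I}).
Hypothesis eJ : e \notin J.

(** The induction hypothesis, general in the two ends and their goals so that it also applies with
    the ends exchanged. *)
Definition simulation_below n := forall a b alpha beta F A t, #|F| < n ->
  copies_ok a b -> local_up alpha -> local_up beta ->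
  a e \notin A -> b e \notin A -> copies_inv a b J F A ->
  staller_wins (copies_phi a b alpha beta J) F A t ->
  staller_wins (copies_phi a b alpha beta (e |: J)) (F :|: pair_of a b e) A t.

Lemma disjoint_pair a b F : copies_ok a b -> within a b J F -> [disjoint F & pair_of a b e].
Proof.
move=> ok wi; have /andP[ae be] := within_notin ok wi eJ.
rewrite disjoint_subset; apply/subsetP => x xF; rewrite !inE.
by apply/norP; split; apply: contraTneq xF => ->.
Qed.

(** A loss on the other side makes the copies dead, and a first loss is balanced in the count of the
    invariant. A repeated loss on the same side is a wasted move: Staller answers in such a way
    that, after an exchange of two copies, the play is back at the position before the move, with an
    additional [b e] of her own. *)
Lemma dominator_copy_move n a b alpha beta F A i : simulation_below n ->
  #|F| < n.+1 -> copies_ok a b -> local_up alpha -> local_up beta ->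
  a e \notin A -> b e \notin A -> copies_inv a b J F A -> i \in J -> a i \in F ->
  staller_wins (copies_phi a b alpha beta J) F A false ->
  staller_wins (copies_phi a b alpha beta (e |: J)) ((F :|: pair_of a b e) :\ a i) A true.
Proof.
move=> IH ltF ok al bl aeA beA inv iJ aiF w.
have [wi dis nb un cnt] := inv; have [ainj binj ab abR] := ok.
have ei : i != e by apply: contraNneq eJ => <-.
have w1 := dominator_move aiF w.
have /andP[aeF beF] := within_notin ok wi eJ.
have FE : (F :|: pair_of a b e) :\ a i = (F :\ a i) :|: pair_of a b e.
  apply/setP => x; rewrite !inE; case: eqVneq => [->|//].
  by rewrite (inj_eq ainj) (negPf ei) (negPf (ab _ _)).
have wi1 : within a b J (F :\ a i) by move=> x; rewrite inE => /andP[_ /wi].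
have aiA : a i \notin A by rewrite (disjointFr dis aiF).
have lost1 : lost a J (F :\ a i) A.
  by apply/existsP; exists i; rewrite iJ !inE eqxx (negPf aiA).
case lostb: (lost b J F A).
  rewrite FE; apply: dead_copies => //; first exact: disjoint_pair.
    by have /existsP[k /andP[]] := lost1; exists k.
  have /existsP[k /andP[kJ kF]] := lostb; exists k => //.
  by move: kF; rewrite !inE !negb_or => /andP[/negPf -> ->]; rewrite andbF.
have bFA k : k \in J -> b k \in F :|: A.
  by move=> kJ; move/existsPn/(_ k): lostb; rewrite kJ negbK.
case losta: (lost a J F A); last first.
  rewrite FE; apply: IH w1 => //.
    by rewrite -ltnS; apply: leq_trans ltF; rewrite ltnS cardsD1_lt.
  split=> //; first exact: disjointWl (subD1set _ _) dis.
    by move=> k l kJ lJ; rewrite !half_dominator // => /andP[hk _] /andP[hl _]; apply: un.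
  rewrite lost1 fresh_setD //; move: cnt; rewrite losta lostb addn0.
  set fr := [set k in J | _].
  have := bFA i iJ; rewrite inE; case biF: (b i \in F) => /= biA.
    have -> : [exists k in J, half a b (F :\ a i) A k] = [exists k in J, half a b F A k].
      apply: eq_existsb => k; rewrite half_dominator //; case: eqVneq => [->|_]; rewrite ?andbT //.
      by rewrite andbF /half biF aiF (negPf aiA) (disjointFr dis biF) andbF.
    have ifr : i \in fr by rewrite inE iJ /fresh aiF biF.
    by rewrite (cardsD1 i fr) ifr add1n addn1 addSn.
  have -> : fr :\ i = fr.
    by apply/setDidPl; rewrite disjoint_sym disjoints1 inE /fresh biF andbF andbF.
  move=> lt; apply: leq_trans lt _; rewrite -addnA leq_add2l.
  by case: [exists k in J, half a b F A k]; rewrite ?addn1.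
(* The goals that involve all [a] are out of reach, and the additional [b e] extends the goal over
   all [b] to the new copy. *)
have back B : B \subset F -> copies_phi a b alpha beta J (A :|: B) ->
    copies_phi a b alpha beta (e |: J) ((b e |: A) :|: B).
  move=> sB; have /existsP[k /andP[kJ kFA]] := losta.
  have kAB : a k \in A :|: B = false.
    apply: contraNF kFA; rewrite !inE => /orP[->|/(subsetP sB) ->]; by rewrite ?orbT.
  have -> : (b e |: A) :|: B = (A :|: B) :|: [set b e] by rewrite -setUA setUC.
  case/or4P => [h|/andP[c h]|/andP[/forall_inP f _]|/orP[]/andP[/forall_inP f h]].
  - by rewrite /copies_phi (local_setU _ rho_loc h).
  - rewrite /copies_phi (both_claimedU _ (subsetUr [set e] J) c).
    by rewrite (local_setU _ tau_loc h) orbT.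
  - by have := f k kJ; rewrite kAB.
  - apply/or4P; constructor 4; apply/orP; left; rewrite (local_setU _ bl h) andbT.
    by apply/forall_inP => j /setU1P[->|/f]; rewrite !inE ?eqxx ?orbT // => ->.
  - by have := f k kJ; rewrite kAB.
have phis B : copies_phi a b alpha beta (e |: J) (copy_swap ok ei @: B) =
    copies_phi a b alpha beta (e |: J) B.
  by apply: copies_phi_swap; rewrite // !inE ?eqxx ?iJ ?orbT.
have ba k l : (b k == a l) = false by rewrite eq_sym; apply: negbTE (ab _ _).
have ab' k l : (a k == b l) = false by apply: negbTE (ab _ _).
have simpl := (ba, ab', inj_eq ainj, inj_eq binj, eqxx,
  negPf ei, negPf aeF, negPf beF, negPf aeA, negPf beA, negPf aiA, aiF).
have ie : (e == i) = false by rewrite eq_sym; apply: negbTE.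
(* Staller takes the other end of copy [i]; the untouched copy [e] then takes the place of [i]. *)
case biF: (b i \in F).
  have biA : (b i \in A) = false by rewrite (disjointFr dis biF).
  apply: (@staller_move _ _ _ _ (b i)); first by rewrite !inE ba biF.
  rewrite -(staller_wins_perm _ _ _ phis).
  have -> : copy_swap ok ei @: (((F :|: pair_of a b e) :\ a i) :\ b i) = F.
    apply: copy_swap_set; rewrite ?inE ?(simpl, ie, biF) //.
    by move=> x /negPf n1 /negPf n2 /negPf n3 /negPf n4; rewrite !inE n1 n2 n3 n4 /= orbF.
  have -> : copy_swap ok ei @: (b i |: A) = b e |: A.
    apply: copy_swap_set; rewrite ?inE ?(simpl, ie, biA) //.
    by move=> x _ _ /negPf n3 /negPf n4; rewrite !inE n3 n4.
  by apply: staller_mono w; [apply: copies_phi_up | apply: back].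
(* Staller owns [b i] already and takes [b e], so that the free [a e] replaces the lost [a i]. *)
have biA : b i \in A by have := bFA i iJ; rewrite inE biF.
apply: (@staller_move _ _ _ _ (b e)); first by rewrite !inE ba eqxx !orbT.
rewrite -(staller_wins_perm _ _ _ phis).
have -> : copy_swap ok ei @: (((F :|: pair_of a b e) :\ a i) :\ b e) = F.
  apply: copy_swap_set; rewrite ?inE ?(simpl, ie, biF) //.
  by move=> x /negPf n1 /negPf n2 /negPf n3 _; rewrite !inE n1 n2 n3 /= orbF.
have -> : copy_swap ok ei @: (b e |: A) = b e |: A.
  by apply: copy_swap_set; rewrite ?inE ?(simpl, ie, biA).
by apply: staller_mono w; [apply: copies_phi_up | apply: back].
Qed.

(** Completing a copy or making a second threat ends the simulation by [collapse_copies]; a first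
    threat, or a move in a copy that Dominator has entered, keeps the invariant. *)
Lemma staller_copy_move n a b alpha beta F A i : simulation_below n ->
  #|F| < n.+1 -> copies_ok a b -> local_up alpha -> local_up beta ->
  a e \notin A -> b e \notin A -> copies_inv a b J F A -> i \in J -> a i \in F ->
  staller_wins (copies_phi a b alpha beta J) (F :\ a i) (a i |: A) false ->
  staller_wins (copies_phi a b alpha beta (e |: J))
    (F :\ a i :|: pair_of a b e) (a i |: A) false.
Proof.
move=> IH ltF ok al bl aeA beA inv iJ aiF w.
have [wi dis nb un cnt] := inv; have [ainj binj ab abR] := ok.
have ba k l : (b k == a l) = false by rewrite eq_sym; apply: negbTE (ab _ _).
have wi1 : within a b J (F :\ a i) by move=> x; rewrite inE => /andP[_ /wi].
have aiA : a i \notin A by rewrite (disjointFr dis aiF).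
have ie : (e == i) = false by apply: contraNF eJ => /eqP ->.
have dis1 : [disjoint F :\ a i & a i |: A].
  rewrite disjoint_subset; apply/subsetP => x; rewrite !inE => /andP[/negPf -> xF].
  by rewrite (disjointFr dis xF).
set fr := [set k in J | fresh a b F k] in cnt *.
have frE : [set k in J | fresh a b (F :\ a i) k] = fr :\ i by apply: fresh_setD.
have collapse w1 w2 : (w1 == w2) || ((w1 \in (F :\ a i) :\: R) && (w2 \in (F :\ a i) :\: R)) ->
     (forall Q, w1 != w2 -> (w1 \in Q) || (w2 \in Q) ->
        both_claimed a b J ((a i |: A) :|: Q)) ->
     (w1 = w2 -> both_claimed a b J (a i |: A)) -> 1 < #|fr :\ i| ->
    staller_wins (copies_phi a b alpha beta (e |: J))
      (F :\ a i :|: pair_of a b e) (a i |: A) false.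
  move=> hw hQ hA /card_gt1P[i1 [i2 []]].
  rewrite -frE !inE => /and3P[i1J a1 b1] /and3P[i2J a2 b2] i12.
  apply: (@collapse_copies _ _ _ _ _ _ _ _ _ i1 i2) w => //.
  - exact: disjoint_pair.
  - by move: a1 b1 a2 b2; rewrite !inE => -> -> -> ->.
  - by exists w1, w2.
case biA: (b i \in A).
  have fri : fr :\ i = fr.
    apply/setDidPl; rewrite disjoint_sym disjoints1 inE /fresh.
    by rewrite (disjointFl dis biA) !andbF.
  (* Copy [i] is now complete, which the equal arguments express. *)
  apply: (collapse (a i) (a i)) => //; rewrite ?eqxx //.
    move=> _; apply/existsP; exists i; by rewrite iJ !inE eqxx biA orbT.
  by rewrite fri; apply: ltnW (gt2_of_gt4 cnt).
case biF: (b i \in F); last first.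
  apply: IH w => //.
  - by rewrite -ltnS; apply: leq_trans ltF; rewrite ltnS cardsD1_lt.
  - by rewrite !inE (inj_eq ainj) ie.
  - by rewrite !inE ba.
  have hE k : half a b (F :\ a i) (a i |: A) k = half a b F A k.
    rewrite half_staller //; case: eqVneq => [->|//].
    by rewrite /half biF biA !andbF.
  split=> //.
  - apply: contra nb => /existsP[k]; rewrite !inE ba (inj_eq ainj) /= => /and3P[kJ ak bk].
    apply/existsP; exists k; rewrite kJ bk andbT.
    by case/orP: ak => // /eqP E; rewrite E biA in bk.
  - by move=> k l kJ lJ; rewrite !hE; apply: un.
  have lostE c : lost c J (F :\ a i) (a i |: A) = lost c J F A.
    apply: eq_existsb => k; rewrite !inE; case: eqVneq => [->|//].
    by rewrite aiF.
  rewrite !lostE frE (eq_existsb (P2 := fun k => (k \in J) && half a b F A k)).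
    have -> // : fr :\ i = fr.
    by apply/setDidPl; rewrite disjoint_sym disjoints1 inE /fresh biF !andbF.
  by move=> k; rewrite hE.
have lostE c : lost c J (F :\ a i) (a i |: A) = lost c J F A.
  apply: eq_existsb => k; rewrite !inE; case: eqVneq => [->|//].
  by rewrite aiF.
have ifr : i \in fr by rewrite inE iJ /fresh aiF biF.
have hi : half a b F A i = false by rewrite /half (negPf aiA) biA !andbF.
(* Two threats, on [i] and on [k]: Dominator cannot parry both, so the free ends of the two copies
   form the pair. *)
have [/existsP[k /andP[kJ kh]] | nohalf] := boolP [exists k in J, half a b F A k].
  have ki : k != i by apply: contraTneq kh => ->; rewrite hi.
  have cnt1 : 1 < #|fr :\ i|.
    by have := gt2_of_gt4 cnt; rewrite (cardsD1 i fr) ifr add1n.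
  have hQi Q : b i \in Q -> both_claimed a b J ((a i |: A) :|: Q).
    by move=> bQ; apply/existsP; exists i; rewrite iJ !inE eqxx bQ orbT.
  have [ak bk] := andP (abR k); have [ai' bi'] := andP (abR i).
  have bkbi : (b i == b k) = false by rewrite (inj_eq binj) eq_sym (negPf ki).
  case/orP: kh => /andP[h1 h2].
    apply: (collapse (b i) (b k)) => //; last by move/eqP; rewrite bkbi.
      by rewrite !inE !ba bi' bk biF h2 orbT.
    move=> Q _ /orP[/hQi //|bkQ]; apply/existsP; exists k.
    by rewrite kJ !inE h1 bkQ !orbT.
  apply: (collapse (b i) (a k)) => //; last by move/eqP; rewrite ba.
    by rewrite !inE !ba (inj_eq ainj) ki bi' ak biF h1 orbT.
  move=> Q _ /orP[/hQi //|akQ]; apply/existsP; exists k.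
  by rewrite kJ !inE h2 akQ !orbT.
have hE k : k \in J -> half a b (F :\ a i) (a i |: A) k = (k == i).
  move=> kJ; rewrite half_staller // biF; case: (k == i) => //.
  by move/existsPn: nohalf => /(_ k); rewrite kJ => /negPf.
apply: IH w => //.
- by rewrite -ltnS; apply: leq_trans ltF; rewrite ltnS cardsD1_lt.
- by rewrite !inE (inj_eq ainj) ie.
- by rewrite !inE ba.
split=> //.
- apply: contra nb => /existsP[k]; rewrite !inE ba (inj_eq ainj) /= => /and3P[kJ ak bk].
  apply/existsP; exists k; rewrite kJ bk andbT.
  by case/orP: ak => // /eqP E; rewrite E biA in bk.
- by move=> k l kJ lJ; rewrite (hE k kJ) (hE l lJ) => /eqP -> /eqP ->.
have -> : [exists k in J, half a b (F :\ a i) (a i |: A) k].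
  by apply/existsP; exists i; rewrite iJ hE /=.
move: cnt; rewrite !lostE frE (negPf nohalf) addn0 (cardsD1 i fr) ifr.
by rewrite addn1 add1n.
Qed.

(** The additional copy is kept untouched as a reserve: a move of Dominator in it is read, by
    symmetry, as a move in an untouched copy [i0] of [J]. *)
Lemma copies_simulation a b alpha beta F A t :
  copies_ok a b -> local_up alpha -> local_up beta ->
  a e \notin A -> b e \notin A -> copies_inv a b J F A ->
  staller_wins (copies_phi a b alpha beta J) F A t ->
  staller_wins (copies_phi a b alpha beta (e |: J)) (F :|: pair_of a b e) A t.
Proof.
have [n] := ubnP #|F|; elim: n a b alpha beta F A t => // n IH.
move=> a b alpha beta F A t ltF ok al bl aeA beA inv w.
have [wi dis nb un cnt] := inv; have [ainj binj ab abR] := ok.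
have [i0 i0fr] : exists i, i \in [set i in J | fresh a b F i].
  apply/set0Pn; rewrite -card_gt0.
  by apply: leq_ltn_trans (gt2_of_gt4 cnt).
move: i0fr; rewrite inE => /and3P[i0J ai0 bi0].
have F0 : F != set0 by apply/set0Pn; exists (a i0).
have disP := disjoint_pair ok wi.
have ok' := copies_okC ok; have inv' := copies_invC inv.
have FE v : v \in F -> (F :|: pair_of a b e) :\ v = F :\ v :|: pair_of a b e.
  move=> vF; apply/setP => x; rewrite !inE; case: eqVneq => [->|//].
  by have := disjointFr disP vF; rewrite !inE => ->.
have inF v : v \in F -> v \in F :|: pair_of a b e by rewrite in_setU => ->.
have swC X A' u : staller_wins (copies_phi a b alpha beta (e |: J)) X A' u =
    staller_wins (copies_phi b a beta alpha (e |: J)) X A' u.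
  by apply: staller_wins_ext => B; apply: copies_phiC.
have swCJ X A' u : staller_wins (copies_phi a b alpha beta J) X A' u =
    staller_wins (copies_phi b a beta alpha J) X A' u.
  by apply: staller_wins_ext => B; apply: copies_phiC.
have ltFv v : v \in F -> #|F :\ v| < n.
  by move=> vF; rewrite -ltnS; apply: leq_trans ltF; rewrite ltnS cardsD1_lt.
(* Moves in [R] do not affect the state of any copy. *)
have Rstep v : v \in F -> v \in R ->
    copies_inv a b J (F :\ v) A /\ copies_inv a b J (F :\ v) (v |: A).
  move=> vF vR.
  have nv i : (a i == v = false) * (b i == v = false).
    have /andP[ai bi] := abR i.
    by split; apply/negP => /eqP E; rewrite E vR in ai bi.
  have wiv : within a b J (F :\ v) by move=> x; rewrite inE => /andP[_ /wi].
  have frE : [set i in J | fresh a b (F :\ v) i] = [set i in J | fresh a b F i].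
    by apply/setP => i; rewrite !inE /fresh !inE !nv.
  have hE i : (half a b (F :\ v) A i = half a b F A i) *
              (half a b (F :\ v) (v |: A) i = half a b F A i).
    by rewrite /half !inE !nv.
  have lE : lost a J (F :\ v) A = lost a J F A /\ lost b J (F :\ v) A = lost b J F A.
    by split; apply: eq_existsb => i; rewrite !inE !nv.
  have lE' c : lost c J (F :\ v) (v |: A) = lost c J F A.
    apply: eq_existsb => i; rewrite !inE; case: eqVneq => [->|//]; by rewrite vF.
  have exE A1 : (forall i, half a b (F :\ v) A1 i = half a b F A i) ->
      [exists i in J, half a b (F :\ v) A1 i] = [exists i in J, half a b F A i].
    by move=> E; apply: eq_existsb => i; rewrite E.
  split; split=> //.
  - exact: disjointWl (subD1set _ _) dis.
  - by move=> i j iJ jJ; rewrite !hE; apply: un.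
  - by rewrite frE exE ?lE.1 ?lE.2 // => i; rewrite hE.
  - rewrite disjoint_subset; apply/subsetP => x; rewrite !inE => /andP[/negPf -> xF].
    by rewrite (disjointFr dis xF).
  - apply: contra nb => /existsP[i]; rewrite !inE !nv /= => h.
    by apply/existsP; exists i.
  - by move=> i j iJ jJ; rewrite !hE; apply: un.
  - by rewrite frE exE ?lE' // => i; rewrite hE.
have notR v : v \in R -> (a e == v = false) * (b e == v = false).
  move=> vR; have /andP[ai bi] := abR e.
  by split; apply/negP => /eqP E; rewrite E vR in ai bi.
case: t w => w.
  have [v vF wv] := staller_moveP F0 w.
  apply: (staller_move (inF _ vF)); rewrite FE //.
  case: (wi v vF) => [vR | [i iJ]].
    by apply: IH wv; rewrite ?ltFv // ?inE ?notR //; apply: (Rstep v vF vR).2.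
  rewrite !inE => /orP[]/eqP E; rewrite E in vF wv *.
    by apply: (staller_copy_move IH ltF ok _ _ _ _ inv iJ vF wv).
  rewrite pair_ofC swC; rewrite swCJ in wv.
  by apply: (staller_copy_move IH ltF ok' _ _ _ _ inv' iJ vF wv).
have stepa i : i \in J -> a i \in F ->
    staller_wins (copies_phi a b alpha beta (e |: J)) ((F :|: pair_of a b e) :\ a i) A true.
  by move=> iJ aiF; apply: dominator_copy_move IH ltF ok _ _ _ _ inv iJ aiF w.
have stepb i : i \in J -> b i \in F ->
    staller_wins (copies_phi a b alpha beta (e |: J)) ((F :|: pair_of a b e) :\ b i) A true.
  move=> iJ biF; rewrite pair_ofC swC; rewrite swCJ in w.
  by apply: dominator_copy_move IH ltF ok' _ _ _ _ inv' iJ biF w.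
apply: dominator_moveP => [|v]; first by apply/set0Pn; exists (a i0); apply: inF.
rewrite in_setU => /orP[vF|].
  case: (wi v vF) => [vR | [i iJ]].
    rewrite FE //; apply: IH (dominator_move vF w); rewrite ?ltFv //.
    exact: (Rstep v vF vR).1.
  by rewrite !inE => /orP[]/eqP E; rewrite E in vF *; [apply: stepa | apply: stepb].
have ei : i0 != e by apply: contraNneq eJ => <-.
have phis B : copies_phi a b alpha beta (e |: J) (copy_swap ok ei @: B) =
    copies_phi a b alpha beta (e |: J) B.
  by apply: copies_phi_swap; rewrite // !inE ?eqxx ?i0J ?orbT.
have aE : copy_swap ok ei (a e) = a i0 by rewrite copy_swapa tpermL.
have bE : copy_swap ok ei (b e) = b i0 by rewrite copy_swapb tpermL.
have notA := (disjointFr dis ai0, disjointFr dis bi0, negPf aeA, negPf beA).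
have sA : copy_swap ok ei @: A = A by apply: copy_swap_set; rewrite ?notA.
have sF : copy_swap ok ei @: (F :|: pair_of a b e) = F :|: pair_of a b e.
  by apply: copy_swap_set => //; rewrite !inE ?ai0 ?bi0 !eqxx ?orbT.
have sFD y : copy_swap ok ei @: ((F :|: pair_of a b e) :\ y) =
    (F :|: pair_of a b e) :\ copy_swap ok ei y.
  apply/setP => x; rewrite mem_copy_swap in_setD1 in_setD1 -{2}sF mem_copy_swap.
  by rewrite (inv_eq (@copy_swapK _ _ _ _ _ _)).
rewrite !inE => /orP[] /eqP ->; rewrite -(staller_wins_perm _ _ _ phis) sA sFD.
  by rewrite aE; apply: stepa.
by rewrite bE; apply: stepb.
Qed.
End Simulation.
End TwoVertexCopies.

(** * Reductions of the domination game *)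

Section GraphGame.
Variables (T : finType) (G : sgraph T).
Implicit Types (W V K C A B Q S : {set T}) (t : bool).

(** Closed neighbourhoods among the surviving vertices: a vertex stays undominated exactly when
    Staller claims all of its own. *)
Definition nbhd W v := [set w in W | (w == v) || G v w].

Definition undominated W A := [exists v in W, nbhd W v \subset A].

Definition outcome W t := staller_wins (undominated W) W set0 t.

Lemma nbhd_sub W v : nbhd W v \subset W.
Proof. by apply/subsetP => w; rewrite inE => /andP[]. Qed.

Lemma nbhd_sym W v w : v \in W -> w \in W -> (w \in nbhd W v) = (v \in nbhd W w).
Proof. by move=> vW wW; rewrite !inE vW wW eq_sym adj_sym. Qed.

Lemma nbhd_refl W v : v \in W -> v \in nbhd W v.
Proof. by move=> vW; rewrite inE vW eqxx. Qed.

Lemma nbhdD W C v : nbhd (W :\: C) v = nbhd W v :\: C.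
Proof. by apply/setP => w; rewrite !inE andbA. Qed.

Definition undominated_off W K A :=
  [exists v in W, [disjoint nbhd W v & K] && (nbhd W v \subset A)].

Lemma undominated_off_up W K : up_closed (undominated_off W K).
Proof.
move=> A B sAB /existsP[v /and3P[vW d s]]; apply/existsP; exists v.
by rewrite vW d (subset_trans s).
Qed.

(** Each player can treat [K] by pairing: Dominator thereby dominates every vertex whose
    neighbourhood meets [K], and Staller loses nothing on the other neighbourhoods. So both secure
    the value of the game off [K]. *)
Lemma outcome_paired W K p t : K \subset W -> involutive p ->
  (forall v, v \in W -> ~~ [disjoint nbhd W v & K] -> exists w,
     [/\ w \in K, p w \in K, p w != w, w \in nbhd W v & p w \in nbhd W v]) ->
  outcome W t = staller_wins (undominated_off W K) (W :\: K) set0 t.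
Proof.
move=> sKW pK pair; have WE : (W :\: K) :|: K = W.
  by rewrite setUC -{1}(setIidPr sKW) setID.
have dis : [disjoint W :\: K & K].
  by rewrite disjoint_subset; apply/subsetP => x; rewrite !inE => /andP[].
have dis0 (F : {set T}) : [disjoint F & (set0 : {set T})] by rewrite -setI_eq0 setI0.
apply/idP/idP; rewrite /outcome.
  rewrite -{2}WE; apply: (@dominator_pairing _ _ _ _ _ _ _ p) => //; first exact: undominated_off_up.
  move=> B Q sB sQ hQ; rewrite !set0U => /existsP[v /andP[vW sv]].
  apply/existsP; exists v; rewrite vW /=.
  have d : [disjoint nbhd W v & K].
    apply/negPn/negP => /(pair v vW)[w [wK pwK pww wv pwv]].
    have nB x : x \in K -> x \in nbhd W v -> x \in Q.
      move=> xK /(subsetP sv); rewrite inE => /orP[/(subsetP sB)|//].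
      by rewrite inE xK.
    by have := hQ w wK pwK pww; rewrite !nB.
  rewrite d /=; apply/subsetP => x xv; move: (subsetP sv _ xv).
  rewrite inE => /orP[//|/(subsetP sQ) xK].
  by have := disjointFr d xv; rewrite xK.
have := @staller_pairing _ (undominated_off W K) (undominated W) (W :\: K) K set0 set0 p t.
rewrite WE; apply=> //; first exact: undominated_off_up.
move=> B Q sB sQ hQ; rewrite !set0U => /existsP[v /and3P[vW d s]].
by apply/existsP; exists v; rewrite vW (subset_trans s) // subsetUl.
Qed.

(** Both graphs have the value of the same game off [K]. A vertex of [C] may rely on a pair that
    meets [C], because the vertex disappears as well. *)
Lemma outcome_delete W K C p t : C \subset K -> K \subset W -> involutive p ->
  (forall v, v \in W -> ~~ [disjoint nbhd W v & K] ->
     (exists w, [/\ w \in K :\: C, p w \in K :\: C, p w != w,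
       w \in nbhd W v & p w \in nbhd W v]) \/
     (v \in C /\ exists w, [/\ w \in K, p w \in K, p w != w,
       w \in nbhd W v & p w \in nbhd W v])) ->
  outcome W t = outcome (W :\: C) t.
Proof.
move=> sCK sKW pK pair.
have CK x : x \in C -> x \in K by apply/subsetP.
rewrite (@outcome_paired W K p) //; last first.
  move=> v vW /(pair v vW)[|[_ //]] [w [wK pwK *]]; exists w.
  by split=> //; [move: wK | move: pwK]; rewrite inE => /andP[].
rewrite (@outcome_paired (W :\: C) (K :\: C) p) ?setSD //; last first.
  move=> v; rewrite inE nbhdD => /andP[vC vW] nd.
  have nd' : ~~ [disjoint nbhd W v & K].
    by apply: contra nd; apply: disjointW; apply: subsetDl.
  have [[w [wK pwK pww wv pwv]]|[]] := pair v vW nd'; last by rewrite (negPf vC).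
  exists w; move: wK pwK; rewrite !in_setD wv pwv.
  by move=> /andP[-> ->] /andP[-> ->].
have -> : (W :\: C) :\: (K :\: C) = W :\: K.
  apply/setP => x; rewrite !inE; case xC: (x \in C) => //=.
  by rewrite CK.
apply: staller_wins_ext => A; apply: eq_existsb => v.
rewrite !inE nbhdD; case vW: (v \in W); rewrite ?andbF //= andbT.
case vC: (v \in C) => /=.
  apply/negP => /andP[d _]; have := disjointFr d (nbhd_refl vW).
  by rewrite CK.
case d: [disjoint nbhd W v & K] => /=.
  have -> : nbhd W v :\: C = nbhd W v.
    by apply/setDidPl; apply: disjointWr d.
  by rewrite (disjointWr (subsetDl _ _) d).
symmetry; apply/negbTE; rewrite negb_and.
have [[w [wK _ _ wv _]]|[]] := pair v vW (negbT d); last by rewrite vC.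
apply/orP; left; apply/negP => d'; have := disjointFr d' (x := w).
by have /setDP[_ wC] := wK; rewrite wK in_setD wC wv => /(_ isT).
Qed.

(** Whoever sees one of the three sees all of them, so the pair of the two that stay protects every
    neighbourhood concerned. *)
Lemma outcome_true_twins W u1 u2 u3 t : u1 \in W -> u2 \in W -> u3 \in W ->
  uniq [:: u1; u2; u3] -> nbhd W u1 = nbhd W u2 -> nbhd W u1 = nbhd W u3 ->
  outcome W t = outcome (W :\ u3) t.
Proof.
move=> w1 w2 w3; rewrite /= !inE negb_or => /and3P[/andP[n12 n13] n23 _] E2 E3.
have sub : [set u1; u2; u3] \subset W.
  by apply/subsetP => x; rewrite !inE => /orP[/orP[]|] /eqP ->.
apply: (@outcome_delete W [set u1; u2; u3] [set u3] (tperm u1 u2)) => //.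
- by rewrite sub1set !inE eqxx orbT.
- exact: tpermK.
move=> v vW nd; left; exists u1; rewrite tpermL.
have v1 : v \in nbhd W u1.
  case/pred0Pn: nd => x /= /andP[xv xK].
  have {}xK : [|| x == u1, x == u2 | x == u3] by move: xK; rewrite !inE orbA.
  have xW := subsetP (nbhd_sub _ _) _ xv.
  rewrite nbhd_sym // in xv.
  by case/or3P: xK => /eqP E; rewrite E -?E2 -?E3 in xv.
have h1 : u1 \in nbhd W v by rewrite nbhd_sym.
have h2 : u2 \in nbhd W v by rewrite nbhd_sym // -E2.
by split; rewrite // ?inE ?eqxx ?orbT ?andbT // eq_sym.
Qed.

Definition undominated_or W V S A :=
  (S \subset A) || [exists v in W :\: V :\: S, nbhd W v \subset A].

(** By pairing [u1] with [u2], each player can secure one of them. The one of Dominator dominates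
    [S]; the one of Staller is undominated as soon as all of [S] is hers. Hence the value does not
    depend on the size of [V]. *)
Lemma outcome_singles W V S u1 u2 t : V \subset W -> u1 \in V -> u2 \in V -> u1 != u2 ->
  (forall v, v \in V -> nbhd W v = v |: S) -> [disjoint S & V] ->
  outcome W t = staller_wins (undominated_or W V S) (W :\: V) set0 t.
Proof.
move=> sVW u1V u2V u12 nbV disSV.
have up : up_closed (undominated_or W V S).
  move=> A B sAB; rewrite /undominated_or => /orP[s|/existsP[v /andP[vW s]]].
    by rewrite (subset_trans s).
  by apply/orP; right; apply/existsP; exists v; rewrite vW (subset_trans s).
have VW x : x \in V -> x \in W by apply/subsetP.
have SV x : x \in S -> x \notin V by move=> xS; rewrite (disjointFr disSV xS).
have nbS v : v \in W -> v \notin V -> v \in S -> (u1 \in nbhd W v) && (u2 \in nbhd W v).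
  move=> vW vV vS; rewrite !(nbhd_sym vW) ?VW // !nbV //.
  by rewrite !inE vS !orbT.
have nbN v x : v \in W -> v \notin V -> v \notin S -> x \in V -> x \notin nbhd W v.
  move=> vW vV vS xV; rewrite (nbhd_sym vW) ?VW // nbV // in_setU1 negb_or vS andbT.
  by apply: contraNneq vV => ->.
have WE : (W :\: V) :|: V = W by rewrite setUC -{1}(setIidPr sVW) setID.
have dis : [disjoint W :\: V & V].
  by rewrite disjoint_subset; apply/subsetP => x; rewrite !inE => /andP[].
have dis0 (F : {set T}) : [disjoint F & (set0 : {set T})] by rewrite -setI_eq0 setI0.
have SB B Q : Q \subset V -> S \subset B :|: Q -> S \subset B.
  move=> sQ s; apply/subsetP => x xS; have := subsetP s x xS.
  by rewrite inE => /orP[//|/(subsetP sQ)]; rewrite (negPf (SV x xS)).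
apply/idP/idP; rewrite /outcome.
  rewrite -{2}WE; apply: (@dominator_pairing _ _ _ _ _ _ _ (tperm u1 u2)) => //.
    exact: tpermK.
  move=> B Q sB sQ hQ; rewrite !set0U => /existsP[v /andP[vW sv]].
  have nB x : x \in V -> x \in B :|: Q -> x \in Q.
    by move=> xV; rewrite inE => /orP[/(subsetP sB)|//]; rewrite inE xV.
  rewrite /undominated_or; case vV: (v \in V).
    by rewrite (SB B Q) // (subset_trans _ sv) // nbV // subsetUr.
  case vS: (v \in S).
    have /andP[h1 h2] := nbS v vW (negbT vV) vS.
    have := hQ u1 u1V; rewrite tpermL u2V eq_sym u12 => /(_ isT isT).
    by rewrite !nB ?(subsetP sv).
  apply/orP; right; apply/existsP; exists v; rewrite !inE vW vV vS /=.
  apply/subsetP => x xv; have := subsetP sv _ xv; rewrite inE => /orP[//|/(subsetP sQ) xV].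
  by have := nbN v x vW (negbT vV) (negbT vS) xV; rewrite xv.
have := @staller_pairing _ (undominated_or W V S) (undominated W) (W :\: V) V set0 set0
  (tperm u1 u2) t.
rewrite WE; apply=> //; first exact: tpermK.
move=> B Q sB sQ hQ; rewrite !set0U => /orP[s | /existsP[v /andP[]]].
  have hV u : u \in V -> u \in Q -> undominated W (B :|: Q).
    move=> uV uQ; apply/existsP; exists u; rewrite VW //= nbV // subUset sub1set inE uQ orbT /=.
    by rewrite (subset_trans s) // subsetUl.
  by have := hQ u1 u1V; rewrite tpermL u2V eq_sym u12 => /(_ isT isT) /orP[] /hV; apply.
rewrite !inE => /and3P[_ _ vW] sv; apply/existsP; exists v.
by rewrite vW (subset_trans sv) // subsetUl.
Qed.

(** Two vertices are enough for [outcome_singles], which gives the same game with and without the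
    third. *)
Lemma outcome_false_twins W S u1 u2 u3 t : [set u1; u2; u3] \subset W ->
  uniq [:: u1; u2; u3] -> [disjoint S & [set u1; u2; u3]] ->
  (forall u, u \in [set u1; u2; u3] -> nbhd W u = u |: S) ->
  outcome W t = outcome (W :\ u3) t.
Proof.
move=> sub; rewrite /= !inE negb_or => /and3P[/andP[n12 n13] n23 _] dis nb.
have in1 : u1 \in [set u1; u2; u3] by rewrite !inE eqxx.
have in2 : u2 \in [set u1; u2; u3] by rewrite !inE eqxx orbT.
have in3 : u3 \in [set u1; u2; u3] by rewrite !inE eqxx orbT.
have S3 : u3 \notin S by rewrite (disjointFl dis in3).
rewrite (@outcome_singles W [set u1; u2; u3] S u1 u2) //.
have sub2 : [set u1; u2] \subset [set u1; u2; u3] by apply: subsetUl.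
have nb2 v : v \in [set u1; u2] -> nbhd (W :\ u3) v = v |: S.
  move=> v12; rewrite nbhdD nb ?(subsetP sub2) //; apply/setDidPl.
  rewrite disjoint_sym disjoints1 in_setU1 negb_or S3 andbT eq_sym.
  by move: v12; rewrite !inE => /orP[] /eqP ->.
rewrite (@outcome_singles (W :\ u3) [set u1; u2] S u1 u2) //; last 4 first.
- apply/subsetP => x x12; rewrite !inE (subsetP sub) ?(subsetP sub2) // andbT.
  by move: x12; rewrite !inE => /orP[] /eqP ->.
- by rewrite !inE eqxx.
- by rewrite !inE eqxx orbT.
- exact: disjointWr sub2 dis.
have -> : (W :\ u3) :\: [set u1; u2] = W :\: [set u1; u2; u3].
  by apply/setP => x; rewrite !inE !negb_or -!andbA; case: (x == u3); rewrite ?andbF.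
apply: staller_wins_ext => A; congr (_ || _).
have -> : (W :\ u3) :\: [set u1; u2] :\: S = W :\: [set u1; u2; u3] :\: S.
  congr (_ :\: S).
  by apply/setP => x; rewrite !inE !negb_or -!andbA; case: (x == u3); rewrite ?andbF.
apply: eq_existsb => v; rewrite 2!in_setD; case vS: (v \in S) => //=.
case v3: (v \in [set u1; u2; u3]) => //=; case vW: (v \in W) => //=.
rewrite nbhdD; have -> // : nbhd W v :\ u3 = nbhd W v.
apply/setDidPl; rewrite disjoint_sym disjoints1 nbhd_sym ?nb ?in_setU1 ?vS ?orbF //.
  by apply: contraFN v3 => /eqP ->.
exact: (subsetP sub).
Qed.
End GraphGame.

(** * Domination on a graph with identically attached edges *)

Section Pairs.
Variables (T I : finType) (G : sgraph T) (R S1 S2 : {set T}) (a b : I -> T).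
Hypothesis ok : copies_ok R a b.
Hypotheses (S1R : S1 \subset R) (S2R : S2 \subset R).
Hypotheses (adj_a : forall i x, x \in R -> G (a i) x = (x \in S1))
  (adj_b : forall i x, x \in R -> G (b i) x = (x \in S2))
  (adj_aa : forall i j, G (a i) (a j) = false)
  (adj_bb : forall i j, G (b i) (b j) = false)
  (adj_ab : forall i j, G (a i) (b j) = (i == j)).
Implicit Types (J : {set I}) (A B Q : {set T}).

Definition with_pairs J := R :|: [set x | [exists i in J, x \in pair_of a b i]].

Definition pairs_phi J := copies_phi
  (fun A => [exists v in R :\: (S1 :|: S2), nbhd G R v \subset A])
  (fun A => (S1 \subset A) || (S2 \subset A))
  (fun A => [exists v in S1 :&: S2, nbhd G R v \subset A]) a b
  (fun A => [exists v in S1 :\: S2, nbhd G R v \subset A])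
  (fun A => [exists v in S2 :\: S1, nbhd G R v \subset A]) J.

Lemma in_with_pairsa J i : (a i \in with_pairs J) = (i \in J).
Proof.
case: ok => ainj binj ab abR; have /andP[/negPf ai /negPf bi] := abR i.
rewrite !inE ai /=; apply/existsP/idP => [[j /andP[jJ]]|iJ].
  by rewrite !inE (negPf (ab _ _)) orbF => /eqP/ainj ->.
by exists i; rewrite iJ !inE eqxx.
Qed.

Lemma in_with_pairsb J i : (b i \in with_pairs J) = (i \in J).
Proof.
case: ok => ainj binj ab abR; have /andP[/negPf ai /negPf bi] := abR i.
rewrite !inE bi /=; apply/existsP/idP => [[j /andP[jJ]]|iJ].
  by rewrite !inE eq_sym (negPf (ab _ _)) /= => /eqP/binj ->.
by exists i; rewrite iJ !inE eqxx orbT.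
Qed.

Lemma in_with_pairsR J x : x \in R -> x \in with_pairs J.
Proof. by rewrite inE => ->. Qed.

Lemma with_pairsP J x : x \in with_pairs J ->
  [\/ x \in R, exists2 i, i \in J & x = a i | exists2 i, i \in J & x = b i].
Proof.
rewrite !inE => /orP[xR | /existsP[i /andP[iJ]]]; first by constructor 1.
by rewrite !inE => /orP[]/eqP ->; [constructor 2 | constructor 3]; exists i.
Qed.

Lemma undominated_with_pairs J A :
  undominated G (with_pairs J) A = pairs_phi J A.
Proof.
case: ok => ainj binj ab abR.
have inJ i : i \in J -> (a i \in with_pairs J) * (b i \in with_pairs J).
  by move=> iJ; rewrite in_with_pairsa in_with_pairsb.
have RE x : x \in R -> nbhd G (with_pairs J) x \subset A =
    [&& nbhd G R x \subset A, (x \in S1) ==> [forall i in J, a i \in A] &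
        (x \in S2) ==> [forall i in J, b i \in A]].
  move=> xR; have nx i : (a i == x = false) * (b i == x = false).
    have /andP[ai bi] := abR i.
    by split; apply/negP => /eqP E; rewrite E xR in ai bi.
  apply/idP/and3P => [s | [s s1 s2]].
    split.
    - apply: subset_trans s; apply/subsetP => y; rewrite !inE.
      by move=> /andP[-> ->].
    - apply/implyP => xS; apply/forall_inP => i iJ; apply: (subsetP s).
      by rewrite inE inJ //= nx adj_sym adj_a.
    - apply/implyP => xS; apply/forall_inP => i iJ; apply: (subsetP s).
      by rewrite inE inJ //= nx adj_sym adj_b.
  apply/subsetP => y; rewrite inE => /andP[/with_pairsP[yR|[i iJ ->]|[i iJ ->]]].
  - by move=> h; apply: (subsetP s); rewrite inE yR.
  - rewrite nx adj_sym adj_a //= => xS; move: s1; rewrite xS => /forall_inP; exact.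
  - rewrite nx adj_sym adj_b //= => xS; move: s2; rewrite xS => /forall_inP; exact.
have aE i : i \in J -> nbhd G (with_pairs J) (a i) \subset A =
    [&& a i \in A, b i \in A & S1 \subset A].
  move=> iJ; apply/idP/and3P => [s | [sa sb s]].
    split; try apply: (subsetP s); try by rewrite inE inJ //= ?eqxx ?adj_ab ?eqxx ?orbT.
    apply: subset_trans s; apply/subsetP => x xS; have xR := subsetP S1R _ xS.
    by rewrite inE in_with_pairsR //= adj_a // xS orbT.
  apply/subsetP => y; rewrite inE => /andP[/with_pairsP[yR|[j jJ ->]|[j jJ ->]]].
  - rewrite adj_a // => /orP[/eqP E|]; last exact: (subsetP s).
    by have := abR i; rewrite -E yR.
  - by rewrite adj_aa orbF => /eqP ->.
  - by rewrite eq_sym (negPf (ab _ _)) adj_ab /= => /eqP <-.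
have bE i : i \in J -> nbhd G (with_pairs J) (b i) \subset A =
    [&& a i \in A, b i \in A & S2 \subset A].
  move=> iJ; apply/idP/and3P => [s | [sa sb s]].
    split; try apply: (subsetP s);
      try by rewrite inE inJ //= ?eqxx // adj_sym adj_ab eqxx orbT.
    apply: subset_trans s; apply/subsetP => x xS; have xR := subsetP S2R _ xS.
    by rewrite inE in_with_pairsR //= adj_b // xS orbT.
  apply/subsetP => y; rewrite inE => /andP[/with_pairsP[yR|[j jJ ->]|[j jJ ->]]].
  - rewrite adj_b // => /orP[/eqP E|]; last exact: (subsetP s).
    by have := abR i; rewrite -E yR andbF.
  - by rewrite (negPf (ab _ _)) adj_sym adj_ab /= => /eqP ->.
  - by rewrite adj_bb orbF => /eqP ->.
apply/existsP/idP => [[v /andP[/with_pairsP[vR|[i iJ ->]|[i iJ ->]]]]|].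
- rewrite RE // => /and3P[s]; rewrite /pairs_phi /copies_phi.
  case v1: (v \in S1); case v2: (v \in S2) => /= f1 f2.
  + apply/or4P; constructor 4; apply/orP; right; apply/andP; split.
      by apply/forall_inP => i iJ; rewrite (forall_inP f1) // (forall_inP f2).
    by apply/existsP; exists v; rewrite inE v1 v2.
  + apply/or4P; constructor 3; rewrite f1 /=.
    by apply/existsP; exists v; rewrite inE v1 v2.
  + apply/or4P; constructor 4; rewrite f2 /=; apply/orP; left.
    by apply/existsP; exists v; rewrite inE v1 v2.
  + apply/or4P; constructor 1.
    by apply/existsP; exists v; rewrite !inE v1 v2 vR.
- rewrite aE // => /and3P[sa sb s]; apply/or4P; constructor 2.
  by rewrite s andbT; apply/existsP; exists i; rewrite iJ sa.
- rewrite bE // => /and3P[sa sb s]; apply/or4P; constructor 2.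
  by rewrite s orbT andbT; apply/existsP; exists i; rewrite iJ sa.
case/or4P => [/existsP[v]|/andP[/existsP[i /and3P[iJ sa sb]]]||].
- rewrite !inE negb_or => /andP[/andP[/andP[/negPf v1 /negPf v2] vR] s].
  by exists v; rewrite in_with_pairsR // RE // v1 v2 s.
- by move=> /orP[] s; [exists (a i) | exists (b i)]; rewrite inJ //= ?aE ?bE // sa sb.
- case/andP=> f /existsP[v]; rewrite !inE => /andP[/andP[/negPf v2 v1] s].
  have vR := subsetP S1R _ v1.
  by exists v; rewrite in_with_pairsR // RE // v1 v2 s f.
case/orP=> /andP[f /existsP[v]]; rewrite !inE => /andP[/andP[v1 v2] s].
  have vR := subsetP S2R _ v2.
  by exists v; rewrite in_with_pairsR // RE // (negPf v1) v2 s f.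
have vR := subsetP S1R _ v1.
exists v; rewrite in_with_pairsR // RE // v1 v2 s /=.
by apply/andP; split; apply/forall_inP => i /(forall_inP f) /andP[].
Qed.

(** An additional copy does not help Staller, since Dominator can pair its two ends; that it does
    not hurt her either is the simulation, started with at least five untouched copies. *)
Lemma outcome_with_pairs J e t : e \notin J -> 4 < #|J| ->
  outcome G (with_pairs (e |: J)) t = outcome G (with_pairs J) t.
Proof.
move=> eJ J4; have [ainj binj ab abR] := ok.
have loc1 (S : {set T}) : S \subset R -> local_up R (fun A => S \subset A).
  move=> SR A B sAB sS /=; apply: (subset_trans _ sAB); by rewrite subsetI sS.
have loc2 (S : {set T}) : local_up R (fun A => [exists v in S, nbhd G R v \subset A]).
  move=> A B sAB /existsP[v /andP[vS s]]; apply/existsP; exists v; rewrite vS /=.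
  by apply: (subset_trans _ sAB); rewrite subsetI s nbhd_sub.
have loc3 : local_up R (fun A => (S1 \subset A) || (S2 \subset A)).
  by move=> A B sAB /orP[] /(loc1 _ _ _ _ sAB) ->; rewrite ?orbT.
pose ext K := undominated_with_pairs K.
have WE : with_pairs (e |: J) = with_pairs J :|: pair_of a b e.
  apply/setP => x; rewrite !inE -orbA; congr (_ || _).
  apply/existsP/orP => [[i /andP[]]|[/existsP[i /andP[iJ xi]]|xe]].
  - rewrite !inE => /orP[/eqP -> xe|iJ xi]; first by right.
    by left; apply/existsP; exists i; rewrite iJ !inE.
  - by exists i; rewrite in_setU1 iJ orbT xi.
  - by exists e; rewrite !inE eqxx.
rewrite /outcome (staller_wins_ext _ _ _ (ext _)) (staller_wins_ext _ _ _ (ext J)) WE.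
have ae : a e \notin with_pairs J by rewrite in_with_pairsa.
have be : b e \notin with_pairs J by rewrite in_with_pairsb.
have dis : [disjoint with_pairs J & pair_of a b e].
  rewrite disjoint_sym disjoint_subset; apply/subsetP => x /set2P xe.
  by rewrite inE; case: xe => ->.
have dis0 (F : {set T}) : [disjoint F & (set0 : {set T})] by rewrite -setI_eq0 setI0.
apply/idP/idP.
  apply: (@dominator_pairing _ _ _ _ _ _ _ (tperm (a e) (b e))) => //.
  - exact: copies_phi_up.
  - exact: tpermK.
  move=> B Q sB sQ hQ; rewrite !set0U.
  have notQ x : x \in R -> x \notin Q.
    move=> xR; apply/negP => /(subsetP sQ) /set2P[] E; have := abR e; rewrite -E xR //.
    by rewrite andbF.
  have inB x : x \in R -> x \in B :|: Q -> x \in B.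
    by move=> xR; rewrite inE (negPf (notQ x xR)) orbF.
  have inBa i : i \in J -> a i \in B :|: Q -> a i \in B.
    move=> iJ; rewrite inE => /orP[//|/(subsetP sQ) /set2P[/ainj E|/eqP]].
      by rewrite E (negPf eJ) in iJ.
    by rewrite (negPf (ab _ _)).
  have inBb i : i \in J -> b i \in B :|: Q -> b i \in B.
    move=> iJ; rewrite inE => /orP[//|/(subsetP sQ) /set2P[/eqP|/binj E]].
      by rewrite eq_sym (negPf (ab _ _)).
    by rewrite E (negPf eJ) in iJ.
  have sub h : local_up R h -> h (B :|: Q) -> h B.
    by move=> loc; apply: loc; apply/subsetP => x /setIP[xBQ xR]; apply: inB.
  have sub2 (S : {set T}) : [exists v in S, nbhd G R v \subset B :|: Q] ->
      [exists v in S, nbhd G R v \subset B] by apply: (sub _ (loc2 S)).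
  case/or4P => [h|/andP[/existsP[i /and3P[iJ ai bi]] h]|/andP[f h]|/orP[]/andP[f h]].
  - by apply/or4P; constructor 1; apply: sub2 h.
  - apply/or4P; constructor 2; rewrite (sub _ loc3 h) andbT; apply/existsP; exists i.
    move: iJ; rewrite !inE => /orP[/eqP E|iJ]; last by rewrite iJ inBa ?inBb.
    have notB x : x \in pair_of a b e -> x \in B :|: Q -> x \in Q.
      move=> xe; rewrite inE => /orP[/(subsetP sB)|//].
      by rewrite (disjointFl dis xe).
    rewrite E in ai bi; have pa : a e \in pair_of a b e by rewrite !inE eqxx.
    have pb : b e \in pair_of a b e by rewrite !inE eqxx orbT.
    have := hQ (a e); rewrite tpermL eq_sym => /(_ pa pb (ab _ _)).
    by rewrite (notB (a e)) ?(notB (b e)).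
  - apply/or4P; constructor 3; rewrite (sub2 _ h) andbT.
    by apply/forall_inP => i iJ; rewrite inBa ?(forall_inP f) // inE iJ orbT.
  - apply/or4P; constructor 4; apply/orP; left; rewrite (sub2 _ h) andbT.
    by apply/forall_inP => i iJ; rewrite inBb ?(forall_inP f) // inE iJ orbT.
  - apply/or4P; constructor 4; apply/orP; right; rewrite (sub2 _ h) andbT.
    apply/forall_inP => i iJ.
    by have /andP[? ?] := forall_inP f i (setU1r e iJ); rewrite inBa ?inBb.
apply: copies_simulation => //; rewrite ?inE //.
split=> //.
- move=> x /with_pairsP[xR|[i iJ ->]|[i iJ ->]]; first by left.
    by right; exists i => //; rewrite !inE eqxx.
  by right; exists i => //; rewrite !inE eqxx orbT.
- by apply/existsP => -[i]; rewrite !inE /= andbF.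
- by move=> i j _ _; rewrite /half !inE /= andbF.
have -> : [set i in J | fresh a b (with_pairs J) i] = J.
  apply/setP => i; rewrite inE /fresh in_with_pairsa in_with_pairsb.
  by rewrite !andbb.
by rewrite -addnA; apply: leq_trans J4 (leq_addr _ _).
Qed.
End Pairs.

Lemma card_fibers (A B : finType) (f : A -> B) (S : {set A}) m :
  (forall x, x \in S -> #|[set y in S | f y == f x]| <= m) -> #|S| <= #|f @: S| * m.
Proof.
move=> fib; rewrite -sum1_card (partition_big_imset f) /= -sum_nat_const.
apply: leq_sum => y /imsetP[x xS ->]; apply: leq_trans (fib x xS).
by rewrite sum1dep_card; apply: eq_leq; apply: eq_card => z; rewrite !inE.
Qed.

(** The absence of induced paths on three vertices, the form in which a maximal packing yields a
    cluster. *)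
Definition cluster_off (T : finType) (G : sgraph T) (X : {set T}) :=
  forall u v w, u \notin X -> v \notin X -> w \notin X ->
    G u v -> G v w -> u != w -> G u w.

(** * Cliques outside X and their kinds *)

Section Kinds.
Variables (T : finType) (G : sgraph T) (X : {set T}).
Hypothesis cluster : cluster_off G X.
Implicit Types (W A B Q S : {set T}) (t : bool).

Definition clique_of W u := nbhd G W u :\: X.
Definition link u := [set x in X | G u x].
Definition links W u := [set link w | w in clique_of W u].
Definition twin_links W u :=
  [set link w | w in clique_of W u &
     [exists w' in clique_of W u, (w' != w) && (link w' == link w)]].

Lemma clique_ofE W u w : w \in clique_of W u = [&& w \notin X, w \in W & (w == u) || G u w].
Proof. by rewrite !inE. Qed.

Lemma clique_of_refl W u : u \in W -> u \notin X -> u \in clique_of W u.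
Proof. by move=> uW uX; rewrite clique_ofE uX uW eqxx. Qed.

Lemma clique_of_adj W u v w : v \in clique_of W u -> w \in clique_of W u ->
  u \notin X -> v != w -> G v w.
Proof.
rewrite !clique_ofE => /and3P[vX vW vu] /and3P[wX wW wu] uX vw.
case/orP: vu => [/eqP E|uv]; case/orP: wu => [/eqP E'|uw].
- by rewrite E E' eqxx in vw.
- by rewrite E.
- by rewrite E' adj_sym.
- by apply: (cluster (v := u)) => //; rewrite adj_sym.
Qed.

Lemma clique_of_eq W u v : u \in W -> u \notin X -> v \in clique_of W u ->
  clique_of W v = clique_of W u.
Proof.
move=> uW uX vC; have := vC; rewrite clique_ofE => /and3P[vX vW _].
apply/setP => w; apply/idP/idP => wC.
  have [-> //|wv] := eqVneq w v.
  have := wC; rewrite !clique_ofE => /and3P[-> -> ]; rewrite (negPf wv) /= => vw.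
  have [//|wu] := eqVneq w u.
  have [E|uv] := eqVneq u v; first by rewrite E.
  have wX : w \notin X by move: wC; rewrite clique_ofE => /and3P[].
  rewrite /=; apply: (cluster uX vX wX) => //; last by rewrite eq_sym.
  exact: (clique_of_adj (clique_of_refl uW uX) vC).
have /and3P[wX wW _] : [&& w \notin X, w \in W & (w == u) || G u w].
  by rewrite -clique_ofE.
rewrite clique_ofE wX wW /=.
by have [//|wv] := eqVneq w v; apply: clique_of_adj vC wC uX _; rewrite eq_sym.
Qed.

Lemma nbhd_clique W v : X \subset W -> v \notin X -> nbhd G W v = clique_of W v :|: link v.
Proof.
move=> XW vX; rewrite -(setID (nbhd G W v) X) setUC; congr (_ :|: _).
apply/setP => x; rewrite !inE; case xX: (x \in X); rewrite ?andbF ?andbT //=.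
rewrite (subsetP XW) //=; case: eqVneq => [E|//].
by rewrite -E xX in vX.
Qed.

(* None is the clique to be deleted; the other six form three pairs, indexed by
   the ordinal. *)
Notation copy := (option ('I_3 * bool)).

Section SameKind.
Variables (W : {set T}) (u : copy -> T) (Ty Tw : {set {set T}}).
Hypotheses (XW : X \subset W) (uW : forall i, u i \in W) (uX : forall i, u i \notin X).
Hypothesis u_sep : forall i j, i != j -> u i \notin clique_of W (u j).
Hypotheses (linksE : forall i, links W (u i) = Ty) (twinsE : forall i, twin_links W (u i) = Tw).

Let C i := clique_of W (u i).

Lemma same_kind_disjoint i j w : w \in C i -> w \in C j -> i = j.
Proof.
move=> wi wj; apply/eqP/negPn/negP => /u_sep/negP; apply.
by rewrite -(clique_of_eq (uW j) (uX j) wj) (clique_of_eq (uW i) (uX i) wi) clique_of_refl.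
Qed.

Lemma same_kind_pick i w : w \in C i -> [pick k | w \in C k] = Some i.
Proof.
move=> wi; case: pickP => [k wk|/(_ i)]; last by rewrite wi.
by rewrite (same_kind_disjoint wk wi).
Qed.

Lemma same_kind_nbhd i v : v \in C i -> nbhd G W v = C i :|: link v.
Proof.
move=> vC; rewrite /C -(clique_of_eq (uW i) (uX i) vC); apply: nbhd_clique => //.
by move: vC; rewrite /C clique_ofE => /and3P[].
Qed.

Lemma same_kind_outside i v w : v \in W -> v \notin C i -> w \in C i -> v \in nbhd G W w ->
  v \in link w.
Proof.
by move=> vW vC wC; rewrite (same_kind_nbhd wC) inE (negPf vC).
Qed.

Lemma same_kind_sub i w : w \in C i -> (w \in W) && (w \notin X).
Proof. by rewrite /C clique_ofE => /and3P[-> ->]. Qed.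

Lemma in_Ty i w : w \in C i -> link w \in Ty.
Proof. by move=> wC; rewrite -(linksE i) imset_f. Qed.

(** The default [u i] is never met for [tau] in [Ty]. *)
Definition rep i tau := odflt (u i) [pick w in C i | link w == tau].

Lemma repP i tau : tau \in Ty -> (rep i tau \in C i) /\ link (rep i tau) = tau.
Proof.
rewrite -(linksE i) => /imsetP[w wC ->]; rewrite /rep.
case: pickP => [v /andP[vC /eqP]|/(_ w)] //.
by rewrite -/(C i) in wC; rewrite wC eqxx.
Qed.

Section Kill.
Variables (Th : 'I_3 -> {set {set T}}) (x y : copy -> T).
Hypotheses (xC : forall i, x i \in C i) (yC : forall i, y i \in C i).
Hypothesis xy : forall i, x i != y i.
Hypotheses (xTh : forall j c, link (x (Some (j, c))) \in Th j)
  (yTh : forall j c, link (y (Some (j, c))) \in Th j).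
Hypothesis cover : forall tau, tau \in Ty -> (exists j, tau \notin Th j) \/
  (exists j c, link (x (Some (j, c))) = tau /\ link (y (Some (j, c))) = tau).

(* Inside each clique x i is paired with y i.  A link outside Th j is taken care of
   by pairing its representatives in the two cliques (j, true) and (j, false). *)
Definition kill_pairing w :=
  if [pick k | w \in C k] is Some i then
    if w == x i then y i else if w == y i then x i else
    if i is Some (j, c) then
      if (link w \notin Th j) && (w == rep (Some (j, c)) (link w))
      then rep (Some (j, ~~ c)) (link w) else w
    else w
  else w.

Lemma kill_pairing_x i : kill_pairing (x i) = y i.
Proof. by rewrite /kill_pairing (same_kind_pick (xC i)) eqxx. Qed.

Lemma kill_pairing_y i : kill_pairing (y i) = x i.
Proof. by rewrite /kill_pairing (same_kind_pick (yC i)) eq_sym (negPf (xy i)) eqxx. Qed.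

Lemma kill_pairing_rep j c tau : tau \in Ty -> tau \notin Th j ->
  kill_pairing (rep (Some (j, c)) tau) = rep (Some (j, ~~ c)) tau.
Proof.
move=> tTy tTh; have [rC rl] := repP (Some (j, c)) tTy.
rewrite /kill_pairing (same_kind_pick rC) rl tTh eqxx.
case: eqVneq => [E|_]; first by have := xTh j c; rewrite -E rl (negPf tTh).
by case: eqVneq => [E|//]; have := yTh j c; rewrite -E rl (negPf tTh).
Qed.

Lemma kill_pairingK : involutive kill_pairing.
Proof.
move=> w; rewrite {2}/kill_pairing; case: pickP => [i wC|nC]; last first.
  by rewrite /kill_pairing; case: pickP => // i; rewrite nC.
case: eqVneq => [->|wx]; first exact: kill_pairing_y.
case: eqVneq => [->|wy]; first exact: kill_pairing_x.
have E : kill_pairing w = if i is Some (j, c) then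
      if (link w \notin Th j) && (w == rep (Some (j, c)) (link w))
      then rep (Some (j, ~~ c)) (link w) else w
    else w.
  by rewrite /kill_pairing (same_kind_pick wC) (negPf wx) (negPf wy).
case: i wC wx wy E => [[j c]|//] wC wx wy E.
case: ifP => [/andP[wTh /eqP wr]|nr]; last by rewrite E nr.
by rewrite kill_pairing_rep ?negbK -?wr // (in_Ty wC).
Qed.

(** A vertex of a clique sees the pair [x], [y] of that clique. A vertex of X that sees some vertex
    of a clique sees all vertices with the same link, hence representatives paired across two
    cliques, or a pair [x], [y] whose members both have that link; this is what [cover] provides.
    Only the vertices of the deleted clique rely on the pair inside it. *)
Lemma outcome_kill t : outcome G W t = outcome G (W :\: C None) t.
Proof.
pose K := [set w | [exists i, w \in C i]].
have CK i w : w \in C i -> w \in K by move=> wC; rewrite inE; apply/existsP; exists i.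
have CKN i w : i != None -> w \in C i -> w \in K :\: C None.
  move=> iN wC; rewrite inE (CK _ _ wC) andbT.
  by apply: contra iN => wN; rewrite (same_kind_disjoint wC wN).
apply: (@outcome_delete _ _ _ K _ kill_pairing) => //.
- by apply/subsetP => w; apply: CK.
- by apply/subsetP => w; rewrite inE => /existsP[i /same_kind_sub/andP[]].
- exact: kill_pairingK.
move=> v vW nd; case vK: (v \in K).
  move: vK; rewrite inE => /existsP[i vC].
  have sub w : w \in C i -> w \in nbhd G W v.
    by move=> wC; rewrite (same_kind_nbhd vC) inE wC.
  case: i vC sub => [jc|] vC sub; [left | right; split=> //].
    exists (x (Some jc)); rewrite kill_pairing_x eq_sym xy !sub ?xC ?yC //.
    by rewrite !(CKN (Some jc)).
  exists (x None); rewrite kill_pairing_x eq_sym xy !sub ?xC ?yC //.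
  by rewrite !(CK None).
left; case/pred0Pn: nd => w /= /andP[wv wK].
move: (wK); rewrite inE => /existsP[i wC]; have /andP[wW wX] := same_kind_sub wC.
have vl : v \in link w.
  apply: same_kind_outside wC _ => //; last by rewrite nbhd_sym.
  by apply: contraFN vK; apply: CK.
have all_w w' k : w' \in C k -> link w' = link w -> w' \in nbhd G W v.
  move=> w'C E; have /andP[w'W w'X] := same_kind_sub w'C.
  by rewrite nbhd_sym // (same_kind_nbhd w'C) inE E vl orbT.
case: (cover (in_Ty wC)) => [[j jTh]|[j [c [ex ey]]]].
  have [r0 l0] := repP (Some (j, false)) (in_Ty wC).
  have [r1 l1] := repP (Some (j, true)) (in_Ty wC).
  exists (rep (Some (j, false)) (link w)); rewrite kill_pairing_rep ?(in_Ty wC) //=.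
  split; try exact: (CKN _ _ _ r0); try exact: (CKN _ _ _ r1);
    try exact: (all_w _ _ r0); try exact: (all_w _ _ r1).
  by apply/eqP => E; rewrite E in r1; have := same_kind_disjoint r0 r1.
exists (x (Some (j, c))); rewrite kill_pairing_x.
split; try exact: (CKN _ _ _ (xC _)); try exact: (CKN _ _ _ (yC _));
  try exact: (all_w _ _ (xC _)); try exact: (all_w _ _ (yC _)).
by rewrite eq_sym.
Qed.
End Kill.

Lemma link_sub w : link w \subset X.
Proof. by apply/subsetP => v; rewrite inE => /andP[]. Qed.

Lemma same_kind_nadj i j v w : i != j -> v \in C i -> w \in C j -> G v w = false.
Proof.
move=> ij vC wC; apply: contraNF ij => vw; apply/eqP.
apply: (same_kind_disjoint (w := w)) => //.
have /andP[wW wX] := same_kind_sub wC.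
by rewrite -/(C i) /C -(clique_of_eq (uW i) (uX i) vC) clique_ofE wX wW vw orbT.
Qed.

(** Two vertices with the repeated link [tau] form the pair in each clique, which also protects the
    vertices of X in [tau]; every other link stays available for pairs across cliques. *)
Lemma outcome_twin_kind tau t : tau \in Tw -> outcome G W t = outcome G (W :\: C None) t.
Proof.
move=> tTw.
have get i : exists p : T * T, [&& p.1 \in C i, p.2 \in C i, p.1 != p.2,
    link p.1 == tau & link p.2 == tau].
  have : tau \in twin_links W (u i) by rewrite twinsE.
  case/imsetP => w; rewrite inE => /andP[wC /existsP[w' /and3P[w'C ww' /eqP E]]] ->.
  by exists (w, w'); rewrite /= E -!/(C i) in wC w'C *; rewrite wC w'C eq_sym ww' !eqxx.
pose pr i := xchoose (get i).
have prP i := xchooseP (get i).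
have h i := and5P (prP i).
apply: (@outcome_kill (fun=> [set tau]) (fun i => (pr i).1) (fun i => (pr i).2)).
- by move=> i; case: (h i).
- by move=> i; case: (h i).
- by move=> i; case: (h i).
- by move=> j c; case: (h (Some (j, c))) => _ _ _ /eqP E _; rewrite inE -E eqxx.
- by move=> j c; case: (h (Some (j, c))) => _ _ _ _ /eqP E; rewrite inE -E eqxx.
move=> tau' _; have [->|n] := eqVneq tau' tau.
  right; exists ord0, true; by case: (h (Some (ord0, true))) => _ _ _ /eqP -> /eqP ->.
by left; exists ord0; rewrite inE.
Qed.

Lemma outcome_three_types t : 2 < #|Ty| -> outcome G W t = outcome G (W :\: C None) t.
Proof.
case/card_gt2P => t1 [t2 [t3 [[h1 h2 h3] [n12 n23 n31]]]].
(* The cliques of pair [j] spend two of the three links internally; the third one and any further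
   link stay available for pairs across. So every link is available for some [j]. *)
pose f (j : 'I_3) := match nat_of_ord j with 0 => (t1, t2) | 1 => (t2, t3) | _ => (t3, t1) end.
have fTy j : ((f j).1 \in Ty) /\ ((f j).2 \in Ty) by case: j => [[|[|m]]] lt.
have fne j : (f j).1 != (f j).2 by case: j => [[|[|m]]] lt.
pose g (i : copy) := if i is Some (j, _) then f j else f ord0.
have gTy i : ((g i).1 \in Ty) /\ ((g i).2 \in Ty) by case: i => [[j c]|]; apply: fTy.
have gne i : (g i).1 != (g i).2 by case: i => [[j c]|]; apply: fne.
apply: (@outcome_kill (fun j => [set (f j).1; (f j).2])
  (fun i => rep i (g i).1) (fun i => rep i (g i).2)).
- by move=> i; have [] := repP i (gTy i).1.
- by move=> i; have [] := repP i (gTy i).2.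
- move=> i; apply: contraNneq (gne i) => E.
  by rewrite -(repP i (gTy i).1).2 E (repP i (gTy i).2).2.
- by move=> j c; rewrite (repP _ (fTy j).1).2 !inE eqxx.
- by move=> j c; rewrite (repP _ (fTy j).2).2 !inE eqxx orbT.
move=> tau _; left.
have [E1|e1] := eqVneq tau t1.
  by exists (Ordinal (isT : 1 < 3)); rewrite !inE E1 /= negb_or n12 eq_sym n31.
have [E2|e2] := eqVneq tau t2.
  by exists (Ordinal (isT : 2 < 3)); rewrite !inE E2 /= negb_or n23 eq_sym n12.
by exists ord0; rewrite !inE /= negb_or e1 e2.
Qed.

Lemma link_inj : Tw = set0 -> forall i, {in C i &, injective link}.
Proof.
move=> Tw0 i v w vC wC E; apply/eqP/negPn/negP => vw.
have : link v \in twin_links W (u i).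
  apply/imsetP; exists v => //; rewrite inE vC /=.
  by apply/existsP; exists w; rewrite wC eq_sym vw E eqxx.
by rewrite twinsE Tw0 inE.
Qed.

(** A single link without repetition forces the cliques to be single vertices, which are false
    twins. *)
Lemma outcome_one_type t : Tw = set0 -> #|Ty| = 1 ->
  outcome G W t = outcome G (W :\: C None) t.
Proof.
move=> Tw0 /eqP /cards1P[tau TyE].
have uC i : u i \in C i by apply: clique_of_refl.
have CE i : C i = [set u i].
  apply/setP => w; rewrite inE; apply/idP/eqP => [wC|->//].
  apply: (link_inj Tw0 wC (uC i)).
  by have := in_Ty wC; have := in_Ty (uC i); rewrite TyE !inE => /eqP -> /eqP ->.
have lE i : link (u i) = tau by have := in_Ty (uC i); rewrite TyE inE => /eqP.
have une i j : i != j -> u i != u j.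
  move=> ij; apply: contraNneq ij => E; apply/eqP.
  by apply: same_kind_disjoint (uC i) _; rewrite E.
rewrite CE.
apply: (@outcome_false_twins _ _ _ tau (u (Some (ord0, false))) (u (Some (ord0, true)))).
- by apply/subsetP => x; rewrite !inE => /orP[/orP[]|] /eqP ->.
- by rewrite /= !inE negb_or !une.
- rewrite disjoint_sym disjoint_subset; apply/subsetP => x xs; rewrite inE -(lE None).
  apply/negP => /(subsetP (link_sub _)) xX.
  by move: xs; rewrite !inE => /orP[/orP[]|] /eqP E; move: xX; rewrite E (negPf (uX _)).
move=> x; rewrite !inE => /orP[/orP[]|] /eqP ->;
  by rewrite (same_kind_nbhd (uC _)) CE lE.
Qed.

(** Two links without repetition force the cliques to be edges; six of them remain after the
    deletion, where the simulation needs five. *)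
Lemma outcome_two_types t : Tw = set0 -> #|Ty| = 2 ->
  outcome G W t = outcome G (W :\: C None) t.
Proof.
move=> Tw0 /eqP /cards2P[t1 [t2 [t12 TyE]]].
have T1 : t1 \in Ty by rewrite TyE !inE eqxx.
have T2 : t2 \in Ty by rewrite TyE !inE eqxx orbT.
pose a i := rep i t1; pose b i := rep i t2.
have aC i : a i \in C i := (repP i T1).1.
have bC i : b i \in C i := (repP i T2).1.
have aL i : link (a i) = t1 := (repP i T1).2.
have bL i : link (b i) = t2 := (repP i T2).2.
have CE i : C i = pair_of a b i.
  apply/setP => w; rewrite in_set2; apply/idP/idP => [wC|/orP[]/eqP -> //].
  have := in_Ty wC; rewrite TyE !inE => /orP[] /eqP E; apply/orP; [left|right]; apply/eqP.
    by apply: (link_inj Tw0 wC (aC i)); rewrite E aL.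
  by apply: (link_inj Tw0 wC (bC i)); rewrite E bL.
pose R := W :\: [set w | [exists i, w \in C i]].
have inR x : (x \in R) = ~~ [exists i, x \in C i] && (x \in W).
  by rewrite in_setD in_set.
have CR i w : w \in C i -> w \notin R.
  by move=> wC; rewrite inR negb_and negbK; apply/orP; left; apply/existsP; exists i.
have ab i j : a i != b j.
  apply/eqP => E; have ij : i = j by apply: same_kind_disjoint (aC i) _; rewrite E.
  by move: t12; rewrite -(aL i) -(bL j) E eqxx.
have ok : copies_ok R a b.
  split=> //.
  - by move=> i j E; apply: same_kind_disjoint (aC i) _; rewrite E.
  - by move=> i j E; apply: same_kind_disjoint (bC i) _; rewrite E.
  - by move=> i; rewrite !(CR i).
have sTR tau i w : w \in C i -> link w = tau -> tau \subset R.
  move=> wC <-; apply/subsetP => x xl; have xX := subsetP (link_sub w) x xl.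
  rewrite inR (subsetP XW) // andbT; apply/existsP => -[j /same_kind_sub/andP[_]].
  by rewrite xX.
have adjR i w x : w \in C i -> x \in R -> G w x = (x \in link w).
  move=> wC; rewrite inR => /andP[/existsPn nC xW].
  have -> : G w x = (x \in nbhd G W w).
    rewrite inE xW /=; case: eqVneq => [E|//].
    by have := nC i; rewrite E wC.
  by rewrite (same_kind_nbhd wC) in_setU (negPf (nC i)).
have adjC i j v w : v \in C i -> w \in C j -> G v w = (i == j) && (v != w).
  move=> vC wC; have [E|ij] := eqVneq i j; last exact: same_kind_nadj ij vC wC.
  rewrite -E in wC; have [->|vw] := eqVneq v w; first by rewrite adj_irr.
  exact: (clique_of_adj vC wC (uX i)).
have inWP J x : (x \in with_pairs R a b J) =
    (x \in R) || [exists i in J, x \in C i].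
  by rewrite in_setU in_set; congr (_ || _); apply: eq_existsb => i; rewrite CE.
have WE : W = with_pairs R a b (None |: ~: [set None]).
  apply/setP => x; rewrite inWP inR; case xW: (x \in W); rewrite ?andbT ?andbF /=.
    rewrite -implybE; apply/esym/implyP => /existsP[i xC]; apply/existsP; exists i.
    by rewrite in_setU1 in_setC in_set1 orbN.
  apply/esym/negbTE/existsP => -[i /andP[_]] /same_kind_sub.
  by rewrite xW.
have WCE : W :\: C None = with_pairs R a b (~: [set None]).
  apply/setP => x; rewrite in_setD inWP inR; case xW: (x \in W); rewrite ?andbT ?andbF /=.
    case xN: (x \in C None) => /=.
      apply/esym/negbTE; rewrite negb_or negbK; apply/andP; split.
        by apply/existsP; exists None.
      apply/existsP => -[i]; rewrite in_setC in_set1 => /andP[iN xi].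
      by rewrite (same_kind_disjoint xN xi) eqxx in iN.
    rewrite -implybE; apply/esym/implyP => /existsP[i xC].
    apply/existsP; exists i; rewrite xC in_setC in_set1 andbT.
    by apply: contraFneq xN => <-.
  by apply/esym/negbTE/existsP => -[i /andP[_]] /same_kind_sub; rewrite xW.
rewrite WCE {1}WE.
apply: (@outcome_with_pairs _ _ _ R t1 t2) => //.
- exact: sTR (aC None) (aL None).
- exact: sTR (bC None) (bL None).
- by move=> i x xR; rewrite (adjR i) // aL.
- by move=> i x xR; rewrite (adjR i) // bL.
- move=> i j; rewrite (adjC i j) //; case: eqVneq => [->|//]; by rewrite eqxx.
- move=> i j; rewrite (adjC i j) //; case: eqVneq => [->|//]; by rewrite eqxx.
- by move=> i j; rewrite (adjC i j) // ab andbT.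
- by rewrite !inE eqxx.
by rewrite cardsC1 card_option card_prod card_ord card_bool.
Qed.

Lemma outcome_same_kind t : outcome G W t = outcome G (W :\: C None) t.
Proof.
have [Tw0|/set0Pn[tau]] := eqVneq Tw set0; last exact: outcome_twin_kind.
have : 0 < #|Ty|.
  by apply/card_gt0P; exists (link (u None)); apply: (@in_Ty None); apply: clique_of_refl.
case E: #|Ty| => [|[|[|m]]] // _.
- exact: outcome_one_type.
- exact: outcome_two_types.
- by apply: outcome_three_types; rewrite E.
Qed.
End SameKind.

(** * Exhaustive reduction in a single pass *)

Implicit Types (P : {set T}) (u v w : T).

Definition twins_of W v := [set u in clique_of W v | link u == link v].

Definition same_kind W u v :=
  [&& link u == link v, links W u == links W v & twin_links W u == twin_links W v].

Definition kin W v := [set u in W :\: X | same_kind W u v].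

(** [P] collects the vertices already inspected. Twin classes only shrink, so no vertex has to be
    inspected twice. *)
Definition twin_reduced W P :=
  [/\ X \subset W, forall t, outcome G W t = outcome G setT t &
      forall v, v \in P -> v \in W -> v \notin X -> #|twins_of W v| <= 2].

Definition twin_step W v :=
  if [&& v \in W, v \notin X & 2 < #|twins_of W v|] then W :\ v else W.

Lemma clique_of_mono W W' v : W' \subset W -> clique_of W' v \subset clique_of W v.
Proof.
move=> sW; apply/subsetP => x; rewrite !clique_ofE => /and3P[-> xW ->].
by rewrite (subsetP sW).
Qed.

Lemma twins_of_mono W W' v : W' \subset W -> #|twins_of W' v| <= #|twins_of W v|.
Proof.
move=> sW; apply: subset_leq_card; apply/subsetP => x; rewrite inE => /andP[xC xl].
by rewrite inE xl andbT (subsetP (clique_of_mono _ sW)).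
Qed.

Lemma twin_stepP W P v : twin_reduced W P -> twin_reduced (twin_step W v) (v |: P).
Proof.
case=> XW out red; rewrite /twin_step; case: ifP => [/and3P[vW vX c]|nc]; last first.
  split=> // u; rewrite in_setU1 => /orP[/eqP ->|]; last exact: red.
  by move=> vW vX; move: nc; rewrite vW vX /= ltnNge => /negbFE.
split.
- by apply/subsetP => x xX; rewrite !inE (subsetP XW) // andbT; apply: contraNneq vX => <-.
- move=> t; rewrite -out; symmetry.
  have vT : v \in twins_of W v by rewrite inE clique_of_refl ?eqxx.
  have : 1 < #|twins_of W v :\ v| by move: c; rewrite (cardsD1 v) vT.
  case/card_gt1P => u1 [u2 [h1 h2 n12]].
  have nb u : u \in twins_of W v :\ v -> (u \in W) /\ nbhd G W u = nbhd G W v.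
    rewrite in_setD1 => /andP[_]; rewrite inE => /andP[uC /eqP lu].
    have := uC; rewrite clique_ofE => /and3P[uX uW _]; split=> //.
    by rewrite !nbhd_clique // lu (clique_of_eq vW vX uC).
  have [w1 e1] := nb _ h1; have [w2 e2] := nb _ h2.
  apply: (@outcome_true_twins _ _ _ u1 u2); rewrite ?e1 ?e2 //.
  move: h1 h2; rewrite !in_setD1 => /andP[n1 _] /andP[n2 _].
  by rewrite /= !inE negb_or n12 n1 n2.
move=> u; rewrite in_setU1 in_setD1 => /orP[/eqP ->|uP]; first by rewrite eqxx.
case/andP=> uv uW uX; apply: leq_trans (red u uP uW uX).
exact: twins_of_mono (subD1set _ _).
Qed.

(* Without triples of true twins, fourteen vertices with the same link meet seven
   cliques. *)
Definition kind_reduced W P :=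
  [/\ X \subset W, forall t, outcome G W t = outcome G setT t,
      forall v, v \in W -> v \notin X -> #|twins_of W v| <= 2 &
      forall v, v \in P -> v \in W -> v \notin X -> #|kin W v| <= 13].

Definition kind_step W v :=
  if [&& v \in W, v \notin X & 13 < #|kin W v|] then W :\: clique_of W v else W.

Lemma outcome_kin W u0 t : X \subset W -> u0 \in W -> u0 \notin X ->
  (forall v, v \in W -> v \notin X -> #|twins_of W v| <= 2) ->
  13 < #|kin W u0| -> outcome G W t = outcome G (W :\: clique_of W u0) t.
Proof.
move=> XW u0W u0X tw big; pose CC := clique_of W @: kin W u0.
have kinP v : v \in kin W u0 -> [/\ v \in W, v \notin X & same_kind W v u0].
  by rewrite inE in_setD => /andP[/andP[-> ->] ->].
have u0kin : u0 \in kin W u0 by rewrite inE in_setD u0W u0X /same_kind !eqxx.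
have CC7 : 6 < #|CC|.
  (* Kin share a link, so by the bound on twins each clique contains at most two of them. *)
  have h : #|kin W u0| <= #|CC| * 2.
    apply: card_fibers => v /kinP[vW vX /and3P[/eqP lv _ _]].
    apply: leq_trans (tw v vW vX); apply: subset_leq_card; apply/subsetP => u.
    rewrite inE => /andP[/kinP[uW uX /and3P[/eqP lu _ _]] /eqP cu].
    by rewrite inE -cu clique_of_refl // lu lv eqxx.
  by rewrite -(ltn_pmul2r (isT : 0 < 2)); apply: ltnW (leq_trans big h).
have CC6 : 6 <= #|CC :\ clique_of W u0|.
  by rewrite -ltnS; move: CC7; rewrite (cardsD1 (clique_of W u0)) imset_f.
(* Six further cliques, one for each element of ['I_3 * bool], are picked by the rank of that
   element. *)
pose e := enum (CC :\ clique_of W u0).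
have rk (i : 'I_3 * bool) : enum_rank i < size e.
  rewrite /e -cardE; apply: leq_trans CC6.
  by apply: leq_trans (ltn_ord _) _; rewrite card_prod card_ord card_bool.
pose c (i : 'I_3 * bool) := nth set0 e (enum_rank i).
have cP i : c i \in CC :\ clique_of W u0 by rewrite -mem_enum mem_nth ?rk.
have c_inj i j : c i = c j -> i = j.
  move/eqP; rewrite nth_uniq ?enum_uniq ?rk // => /eqP/val_inj/enum_rank_inj; exact.
have ex i : exists v, (v \in kin W u0) && (clique_of W v == c i).
  have := cP i; rewrite in_setD1 => /andP[_ /imsetP[v vk ->]]; exists v; by rewrite vk eqxx.
pose u (i : option ('I_3 * bool)) := if i is Some j then xchoose (ex j) else u0.
have uk i : u i \in kin W u0.
  by case: i => [i|] //=; have /andP[] := xchooseP (ex i).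
have uC i : clique_of W (u (Some i)) = c i.
  by have /andP[_ /eqP] := xchooseP (ex i).
have uX i : u i \notin X by have [] := kinP _ (uk i).
have uW i : u i \in W by have [] := kinP _ (uk i).
have cN i : (c i == clique_of W u0) = false.
  by have := cP i; rewrite in_setD1 => /andP[/negPf].
apply: (@outcome_same_kind W u (links W u0) (twin_links W u0)) => //.
- move=> i j ij; apply/negP => /(clique_of_eq (uW j) (uX j)).
  case: i j ij => [i|] [j|] //= ij; rewrite ?uC.
  + by move/c_inj => E; rewrite E eqxx in ij.
  + by move/eqP; rewrite cN.
  + by move/eqP; rewrite eq_sym cN.
- by move=> i; have [_ _ /and3P[_ /eqP]] := kinP _ (uk i).
- by move=> i; have [_ _ /and3P[_ _ /eqP]] := kinP _ (uk i).
Qed.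

(** Deleting a whole clique leaves all others intact, hence also the kinds of the surviving
    vertices; the sets [kin] can only shrink, and one pass suffices. *)
Lemma kind_stepP W P v : kind_reduced W P -> kind_reduced (kind_step W v) (v |: P).
Proof.
case=> XW out tw red; rewrite /kind_step; case: ifP => [/and3P[vW vX c]|nc]; last first.
  split=> // u; rewrite in_setU1 => /orP[/eqP ->|]; last exact: red.
  by move=> vW vX; move: nc; rewrite vW vX /= ltnNge => /negbFE.
have sub : W :\: clique_of W v \subset W by apply: subsetDl.
split.
- apply/subsetP => x xX; rewrite in_setD (subsetP XW) // andbT.
  by rewrite clique_ofE xX.
- by move=> t; rewrite -out; symmetry; apply: outcome_kin.
- move=> u; rewrite in_setD => /andP[_ uW] uX.
  exact: leq_trans (twins_of_mono _ sub) (tw u uW uX).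
have clE u : u \in W :\: clique_of W v -> u \notin X ->
    clique_of (W :\: clique_of W v) u = clique_of W u.
  rewrite in_setD => /andP[uC uW] uX; apply/setP => x.
  rewrite !clique_ofE in_setD; case xX: (x \in X) => //=.
  case xW: (x \in W); rewrite ?andbF ?andbT //=; apply/andb_idl => xu.
  have xCu : x \in clique_of W u by rewrite clique_ofE xX xW xu.
  apply: contra uC => xC.
  rewrite -(clique_of_eq vW vX xC) (clique_of_eq uW uX xCu).
  exact: clique_of_refl.
move=> u; rewrite in_setU1 => /orP[/eqP ->|uP].
  by rewrite in_setD clique_of_refl.
move=> uW uX; have := uW; rewrite in_setD => /andP[_ uW0].
apply: leq_trans (red u uP uW0 uX); apply: subset_leq_card; apply/subsetP => x.
rewrite !inE => /andP[/andP[xX xW'] xk].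
have xW : x \in W :\: clique_of W v by move: xW'; rewrite !inE.
have /and3P[l1 l2 l3] := xk.
rewrite /same_kind in xk *.
rewrite /links /twin_links !clE // in l2 l3.
rewrite xX l1 /links /twin_links l2 l3 andbT.
by move: xW; rewrite in_setD => /andP[_ ->].
Qed.

(** Vertices are counted rather than cliques: a vertex is classified by its link and the two sets of
    links of its clique, that is, by one subset of X and two families of such subsets, and each
    class has at most 13 members. *)
Lemma kind_reduced_card W : kind_reduced W setT ->
  #|W| <= #|X| + 13 * (2 ^ #|X| * (2 ^ 2 ^ #|X| * 2 ^ 2 ^ #|X|)).
Proof.
case=> XW _ _ red; rewrite -(cardsID X W) (setIidPr XW) leq_add2l mulnC.
pose f v := (link v, (links W v, twin_links W v)).
have fib : #|W :\: X| <= #|f @: (W :\: X)| * 13.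
  apply: card_fibers => v; rewrite in_setD => /andP[vX vW].
  apply: leq_trans (red v (in_setT v) vW vX); apply: eq_leq; apply: eq_card => u.
  by rewrite !in_set /same_kind !xpair_eqE.
apply: leq_trans fib _; rewrite leq_mul2r /=.
pose cod := setX (powerset X) (setX (powerset (powerset X)) (powerset (powerset X))).
have -> : 2 ^ #|X| * (2 ^ 2 ^ #|X| * 2 ^ 2 ^ #|X|) = #|cod|.
  by rewrite !cardsX !card_powerset.
apply: subset_leq_card; apply/subsetP => _ /imsetP[v _ ->].
rewrite !in_setX /= !powersetE link_sub /=; apply/andP; split;
  by apply/subsetP => _ /imsetP[w _ ->]; rewrite powersetE link_sub.
Qed.
End Kinds.

(** * Packings of induced paths *)

Section Packing.
Variables (T : finType) (G : sgraph T).
Implicit Types X Y : {set T}.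

Definition induced_path u v w := [&& G u v, G v w, u != w & ~~ G u w].

(* Holds for every union of disjoint induced paths, as each of them meets every Y
   whose removal leaves a cluster. *)
Definition packed X := forall Y, cluster_off G Y -> #|X| <= 3 * #|X :&: Y|.

Lemma packed0 : packed set0.
Proof. by move=> Y _; rewrite cards0. Qed.

(** A set whose removal leaves a cluster contains a vertex of the new path, and this vertex pays for
    the three that are added. *)
Lemma packed_add X u v w : packed X -> u \notin X -> v \notin X -> w \notin X ->
  induced_path u v w -> packed (X :|: [set u; v; w]).
Proof.
move=> pX uX vX wX /and4P[uv vw uw nuw] Y cY; have := pX Y cY.
have hit : 0 < #|[set u; v; w] :&: Y|.
  rewrite card_gt0; apply/set0Pn.
  case uY: (u \in Y); first by exists u; rewrite !inE eqxx uY.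
  case vY: (v \in Y); first by exists v; rewrite !inE eqxx vY orbT.
  case wY: (w \in Y); first by exists w; rewrite !inE eqxx wY !orbT.
  by move: nuw; rewrite (cY u v w) ?uY ?vY ?wY.
have dis : [disjoint X & [set u; v; w]].
  rewrite disjoint_sym disjoint_subset; apply/subsetP => x.
  by rewrite !inE => /orP[/orP[]|] /eqP ->.
have S3 : #|[set u; v; w]| <= 3.
  rewrite cardsU cardsU !cards1.
  by apply: leq_trans (leq_subr _ _) _; rewrite addn1 ltnS leq_subr.
move: dis hit S3; move: [set u; v; w] => S dis hit S3.
rewrite cardsU (disjoint_setI0 dis) cards0 subn0 setIUl cardsU.
have -> : (X :&: Y) :&: (S :&: Y) = set0.
  by rewrite setIACA (disjoint_setI0 dis) set0I.
rewrite cards0 subn0 mulnDr => h; apply: leq_add h _.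
exact: leq_trans S3 (leq_pmulr _ hit).
Qed.

Lemma packed_dist X : packed X -> #|X| <= 3 * dist_to_cluster G.
Proof.
move=> pX; have [[Y clY <-] _] := dist_to_clusterP G.
(* Equality of blocks is transitive, so a disjoint union of cliques contains no induced path on
   three vertices. *)
have cY : cluster_off G Y.
  move=> u v w uY vY wY uv vw uw.
  case/existsP: clY => P /andP[_ /forallP adjP].
  have adjE (x y : {z | z \notin Y}) : G (val x) (val y) = (x != y) && (pblock P x == pblock P y).
    by apply/eqP; have /forallP/(_ y) := adjP x.
  pose sub z (zY : z \notin Y) : {z | z \notin Y} := exist _ z zY.
  have /andP[_ /eqP puv] : (sub u uY != sub v vY) && (pblock P (sub u uY) == pblock P (sub v vY)).
    by rewrite -adjE.
  have /andP[_ pvw] : (sub v vY != sub w wY) && (pblock P (sub v vY) == pblock P (sub w wY)).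
    by rewrite -adjE.
  by rewrite (adjE (sub u uY) (sub w wY)) puv pvw andbT -val_eqE.
by apply: leq_trans (pX Y cY) _; rewrite leq_mul2l subset_leq_card ?subsetIr.
Qed.
End Packing.

(** * Strategies as functions of histories *)

Section Strategies.
Variables (T : finType) (G : sgraph T) (first : player).
Implicit Types (h : seq T) (q : player).

Definition staller_turn i := ~~ is_dominator (mover first i).
Definition staller_claims h := [set v in h | staller_turn (index v h)].
Definition free h := ~: [set v in h].
Definition value h :=
  staller_wins (undominated G setT) (free h) (staller_claims h) (staller_turn (size h)).

Lemma free_rcons h v : free (rcons h v) = free h :\ v.
Proof. by apply/setP => x; rewrite !inE mem_rcons in_cons negb_or. Qed.

Lemma staller_claims_rcons h v : v \notin h ->
  staller_claims (rcons h v) =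
  if staller_turn (size h) then v |: staller_claims h else staller_claims h.
Proof.
move=> vh; apply/setP => x; rewrite (fun_if (fun A : {set T} => x \in A)) !inE.
rewrite mem_rcons in_cons -cats1 index_cat /=.
have [->|xv] := eqVneq x v.
  by rewrite (negPf vh) /= addn0; case: ifP.
by case xh: (x \in h) => /=; case: ifP.
Qed.

Lemma staller_turnS i : staller_turn i.+1 = ~~ staller_turn i.
Proof. by rewrite /staller_turn /mover /=; case: first; case: (odd i). Qed.

Lemma value_rcons h v : v \notin h -> value (rcons h v) =
  staller_wins (undominated G setT) (free h :\ v)
    (if staller_turn (size h) then v |: staller_claims h else staller_claims h)
    (~~ staller_turn (size h)).
Proof.
by move=> vh; rewrite /value free_rcons staller_claims_rcons // size_rcons staller_turnS.
Qed.

Lemma free_neq0 h : uniq h -> size h < #|T| -> free h != set0.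
Proof.
move=> uh lt; rewrite -card_gt0 cardsCs setCK cardsE (card_uniqP uh).
by rewrite subn_gt0.
Qed.

Lemma value_own q h : uniq h -> size h < #|T| -> mover first (size h) = q ->
  value h = ~~ is_dominator q -> exists2 v, v \notin h & value (rcons h v) = ~~ is_dominator q.
Proof.
move=> uh lt mq; have F0 := free_neq0 uh lt.
rewrite {1}/value /staller_turn mq; case: q mq => mq /=.
  move/negbT; rewrite staller_winsD // negb_forall => /existsP[v].
  rewrite negb_imply !inE => /andP[vh w]; exists v => //.
  by rewrite value_rcons // /staller_turn mq /=; apply: negbTE.
case/(staller_moveP F0) => v; rewrite !inE => vh w; exists v => //.
by rewrite value_rcons // /staller_turn mq.
Qed.

Lemma value_other q h v : mover first (size h) <> q -> v \notin h ->
  value h = ~~ is_dominator q -> value (rcons h v) = ~~ is_dominator q.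
Proof.
move=> mq vh; have vF : v \in free h by rewrite !inE.
have F0 : free h != set0 by apply/set0Pn; exists v.
rewrite value_rcons // {1}/value /staller_turn.
case: q mq; case E: (mover first (size h)) => // _ /=.
  move/negbT; rewrite staller_winsS // negb_exists => /forallP/(_ v).
  by rewrite vF => /= /negbTE.
exact: dominator_move.
Qed.

(** The second branch keeps the strategy legal in positions that are already lost. *)
Definition value_strategy q : strategy T := fun h =>
  if [pick v | (v \notin h) && (value (rcons h v) == ~~ is_dominator q)] is Some v
  then Some v else [pick v | v \notin h].

Lemma value_strategy_legal q : legal (value_strategy q).
Proof.
move=> h uh lt; rewrite /value_strategy.
case: pickP => [v /andP[vh _]|_]; first by exists v.
case: pickP => [v vh|]; first by exists v.
have /set0Pn[v] := free_neq0 uh lt; rewrite !inE => vh /(_ v).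
by rewrite vh.
Qed.

Lemma value_strategy_keeps q h : complete_play h -> follows first q (value_strategy q) h ->
  value [::] = ~~ is_dominator q -> value h = ~~ is_dominator q.
Proof.
case=> uh sh fol v0; rewrite -(take_size h); move: (leqnn (size h)).
elim: {1 3}(size h) => [|i IH] lt; first by rewrite take0.
have [x0] : exists x : T, x \in h by case: (h) lt => // x l _; exists x; rewrite inE eqxx.
move=> _; have vi := IH (ltnW lt).
rewrite (take_nth x0 lt).
have szi : size (take i h) = i by rewrite size_takel // ltnW.
have nh : nth x0 h i \notin take i h.
  have := uh; rewrite -{1}(cat_take_drop i h) cat_uniq => /and3P[_ /hasPn nn _].
  by apply: nn; rewrite (drop_nth x0 lt) inE eqxx.
case E: (is_dominator (mover first i) == is_dominator q); last first.
  by apply: value_other => //; rewrite szi => Eq; rewrite Eq eqxx in E.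
have mq : mover first i = q by move: E; case: (mover first i); case: (q).
have := fol i lt mq; rewrite /value_strategy.
(* The default branch is excluded, since [value_own] provides a move that keeps the value. *)
case: pickP => [v /andP[_ /eqP vv] /(onth_nth x0) -> // | none _].
have ut : uniq (take i h) by rewrite take_uniq.
have lt' : size (take i h) < #|T| by rewrite szi -sh.
have mq' : mover first (size (take i h)) = q by rewrite szi.
have [v vh vv] := value_own ut lt' mq' vi.
by have := none v; rewrite vh vv eqxx.
Qed.

Lemma value_complete q h : complete_play h -> value h = ~~ is_dominator q ->
  won_by G first q h.
Proof.
case=> uh sh; have F0 : free h = set0.
  by apply/eqP; rewrite -cards_eq0 cardsCs setCK cardsE (card_uniqP uh) sh subnn.
rewrite /value F0 staller_wins0.
have all_h x : x \in h by have := in_set0 x; rewrite -F0 !inE => /negbFE.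
have dE : undominated G setT (staller_claims h) =
    ~~ [exists D : {set T}, (D \subset dominator_claims first h) && dominating G D].
  apply/idP/idP => [/existsP[v /andP[_ s]]|/existsPn nd].
    apply/existsPn => D; apply/negP => /andP[sD /forallP/(_ v)].
    have notS x : x \in D -> x \notin nbhd G setT v.
      move=> /(subsetP sD); rewrite inE => /andP[_ dx]; apply/negP => /(subsetP s).
      by rewrite !inE /staller_turn dx andbF.
    case/orP => [/notS|/existsP[w /andP[/notS wv]]]; first by rewrite nbhd_refl ?inE.
    by move=> wv'; move: wv; rewrite !inE adj_sym wv' orbT.
  (* If no subset of the claims of Dominator is dominating, then neither is the set of all of
     them. *)
  have := nd (dominator_claims first h); rewrite subxx /= negb_forall => /existsP[v].
  rewrite negb_or negb_exists => /andP[vD /forallP nb]; apply/existsP; exists v.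
  rewrite inE /=; apply/subsetP => x; rewrite !inE => xv; rewrite all_h /=.
  case/orP: xv => [/eqP ->|vx].
    by move: vD; rewrite inE all_h.
  by have := nb x; rewrite inE all_h /= adj_sym vx andbT.
by rewrite dE; case: q => /= [/negbFE|].
Qed.

Lemma outcome_strategy q : outcome G setT (~~ is_dominator first) = ~~ is_dominator q ->
  has_winning_strategy G first q.
Proof.
move=> o; exists (value_strategy q); first exact: value_strategy_legal.
move=> h cp fol; apply: value_complete => //; apply: value_strategy_keeps => //.
rewrite -o /value /outcome; congr (staller_wins _ _ _ _); by apply/setP => x; rewrite !inE.
Qed.
End Strategies.

(** * A loop language and its compilation *)

(** Bounded sums are the only iteration inside expressions; counting, quantification and
    multiplication are derived from them. *)
Inductive exp :=
| Var (x : nat)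
| Cst (c : nat)
| Plus (e f : exp)
| Minus (e f : exp)
| Peek (e : exp)
| Ite (e f g : exp)
| Sum (x : nat) (e f : exp).

Fixpoint eval e (R M : nat -> nat) : nat :=
  match e with
  | Var x => R x
  | Cst c => c
  | Plus e f => eval e R M + eval f R M
  | Minus e f => eval e R M - eval f R M
  | Peek e => M (eval e R M)
  | Ite e f g => if eval e R M == 0 then eval g R M else eval f R M
  | Sum x e f => \sum_(i < eval e R M) eval f (upd R x i) M
  end.

Inductive cmd :=
| Assign (x : nat) (e : exp)
| Store (e f : exp)
| Seq (c d : cmd)
| If (e : exp) (c : cmd)
| For (x : nat) (e : exp) (c : cmd).

Definition memory := ((nat -> nat) * (nat -> nat))%type.

(* The index of a loop runs downwards. *)
Fixpoint loop (body : nat -> memory -> memory) n (s : memory) : memory :=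
  if n is m.+1 then loop body m (body m s) else s.

Fixpoint run c (s : memory) : memory :=
  match c with
  | Assign x e => (upd s.1 x (eval e s.1 s.2), s.2)
  | Store e f => (s.1, upd s.2 (eval e s.1 s.2) (eval f s.1 s.2))
  | Seq c d => run d (run c s)
  | If e c => if eval e s.1 s.2 == 0 then s else run c s
  | For x e c => loop (fun i s => run c (upd s.1 x i, s.2)) (eval e s.1 s.2) s
  end.

(** The numerals count the instructions executed around the code of the subexpressions. Reading a
    variable takes two of them, as the machine has no instruction that copies a register. *)
Fixpoint eval_cost e (R M : nat -> nat) : nat :=
  match e with
  | Var _ => 2
  | Cst _ => 1
  | Plus e f | Minus e f => eval_cost e R M + (eval_cost f R M + 1)
  | Peek e => eval_cost e R M + 1
  | Ite e f g => eval_cost e R M +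
      (if eval e R M == 0 then 1 + eval_cost g R M else 1 + (eval_cost f R M + 2))
  | Sum x e f => eval_cost e R M + (3 +
      (\sum_(i < eval e R M) (5 + (eval_cost f (upd R x i) M + 3)) + 5))
  end.

Fixpoint loop_cost (cost : nat -> memory -> nat) (body : nat -> memory -> memory) n s : nat :=
  if n is m.+1 then cost m s + loop_cost cost body m (body m s) else 0.

Fixpoint run_cost c (s : memory) : nat :=
  match c with
  | Assign x e => eval_cost e s.1 s.2 + 2
  | Store e f => eval_cost e s.1 s.2 + (eval_cost f s.1 s.2 + 1)
  | Seq c d => run_cost c s + run_cost d (run c s)
  | If e c => eval_cost e s.1 s.2 +
      (if eval e s.1 s.2 == 0 then 1 else 1 + run_cost c s)
  | For x e c => eval_cost e s.1 s.2 +
      (loop_cost (fun i s => 5 + (run_cost c (upd s.1 x i, s.2) + 2))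
         (fun i s => run c (upd s.1 x i, s.2)) (eval e s.1 s.2) s + 1)
  end.

(* The value of e is left in register d; the registers above d are scratch. *)
Fixpoint cexp e d l : program :=
  match e with
  | Var x => [:: Const d 0; Add d d x]
  | Cst c => [:: Const d c]
  | Plus e f =>
      let ce := cexp e d l in ce ++ cexp f d.+1 (l + size ce) ++ [:: Add d d d.+1]
  | Minus e f =>
      let ce := cexp e d l in ce ++ cexp f d.+1 (l + size ce) ++ [:: Sub d d d.+1]
  | Peek e => cexp e d l ++ [:: Read d d]
  | Ite e f g =>
      let ce := cexp e d l in
      let lf := l + size ce + 1 in
      let cf := cexp f d lf in
      let lg := lf + size cf + 2 in
      let cg := cexp g d lg in
      ce ++ [:: Jz d lg] ++ cf ++ [:: Const d.+1 0; Jz d.+1 (lg + size cg)] ++ cg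
  | Sum x e f =>
      let ce := cexp e d l in
      let ll := l + size ce + 3 in
      let cf := cexp f d.+3 (ll + 5) in
      ce ++ [:: Const d.+1 0; Add d.+1 d.+1 x; Const d.+2 0] ++
      [:: Jz d (ll + 5 + size cf + 3); Const d.+3 1; Sub d d d.+3; Const x 0; Add x x d] ++
      cf ++ [:: Add d.+2 d.+2 d.+3; Const d.+3 0; Jz d.+3 ll] ++
      [:: Const x 0; Add x x d.+1; Const d 0; Add d d d.+2]
  end.

(** Jumps are absolute, so the address [l] of the first instruction is passed along. A zero constant
    followed by [Jz] is an unconditional jump. The counter of a loop stays in register [d] while the
    scratch registers of the body start at [d.+1]. *)
Fixpoint ccmd c d l : program :=
  match c with
  | Assign x e => cexp e d l ++ [:: Const x 0; Add x x d]
  | Store e f =>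
      let ce := cexp e d l in ce ++ cexp f d.+1 (l + size ce) ++ [:: Write d d.+1]
  | Seq c1 c2 => let p1 := ccmd c1 d l in p1 ++ ccmd c2 d (l + size p1)
  | If e c =>
      let ce := cexp e d l in
      let p := ccmd c d (l + size ce + 1) in
      ce ++ [:: Jz d (l + size ce + 1 + size p)] ++ p
  | For x e c =>
      let ce := cexp e d l in
      let ll := l + size ce in
      let p := ccmd c d.+1 (ll + 5) in
      ce ++ [:: Jz d (ll + 5 + size p + 2); Const d.+1 1; Sub d d d.+1; Const x 0; Add x x d] ++
      p ++ [:: Const d.+1 0; Jz d.+1 ll]
  end.

Fixpoint exp_below nv e : bool :=
  match e with
  | Var x => x < nv
  | Cst _ => true
  | Plus e f | Minus e f => exp_below nv e && exp_below nv f
  | Peek e => exp_below nv e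
  | Ite e f g => [&& exp_below nv e, exp_below nv f & exp_below nv g]
  | Sum x e f => [&& x < nv, exp_below nv e & exp_below nv f]
  end.

Fixpoint cmd_below nv c : bool :=
  match c with
  | Assign x e => (x < nv) && exp_below nv e
  | Store e f => exp_below nv e && exp_below nv f
  | Seq c d => cmd_below nv c && cmd_below nv d
  | If e c => exp_below nv e && cmd_below nv c
  | For x e c => [&& x < nv, exp_below nv e & cmd_below nv c]
  end.

Definition agree nv (R R' : nat -> nat) := forall r, r < nv -> R r = R' r.

Lemma agree_upd nv R R' x i : agree nv R R' -> agree nv (upd R x i) (upd R' x i).
Proof. by move=> ag r lt; rewrite /upd; case: eqP => // _; apply: ag. Qed.

(** Neither value nor cost depends on the scratch registers, whose contents are not controlled. *)
Lemma eval_agree nv e R R' M : agree nv R R' -> exp_below nv e ->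
  eval e R M = eval e R' M /\ eval_cost e R M = eval_cost e R' M.
Proof.
elim: e R R' => [x|c|e IHe f IHf|e IHe f IHf|e IHe|e IHe f IHf g IHg|x e IHe f IHf] R R' ag /=.
- by move=> lt; rewrite ag.
- by [].
- by case/andP=> be bf; have [-> ->] := IHe _ _ ag be; have [-> ->] := IHf _ _ ag bf.
- by case/andP=> be bf; have [-> ->] := IHe _ _ ag be; have [-> ->] := IHf _ _ ag bf.
- by move=> be; have [-> ->] := IHe _ _ ag be.
- case/and3P=> be bf bg; have [-> ->] := IHe _ _ ag be.
  by have [-> ->] := IHf _ _ ag bf; have [-> ->] := IHg _ _ ag bg.
case/and3P=> ltx be bf; have [-> ->] := IHe _ _ ag be.
have IH i := IHf _ _ (agree_upd x i ag) bf.
split; first by apply: eq_bigr => i _; case: (IH i).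
congr (_ + (_ + (_ + _))); apply: eq_bigr => i _.
by case: (IH i) => _ ->.
Qed.

Lemma run_agree nv c R R' M : agree nv R R' -> cmd_below nv c ->
  [/\ agree nv (run c (R, M)).1 (run c (R', M)).1, (run c (R, M)).2 = (run c (R', M)).2 &
      run_cost c (R, M) = run_cost c (R', M)].
Proof.
elim: c R R' M => [x e|e f|c IHc d IHd|e c IHc|x e c IHc] R R' M ag /=.
- case/andP=> ltx be; have [-> ->] := eval_agree M ag be.
  by split=> //; apply: agree_upd.
- case/andP=> be bf; have [-> ->] := eval_agree M ag be.
  by have [-> ->] := eval_agree M ag bf.
- case/andP=> bc bd; have := IHc _ _ M ag bc.
  case: (run c (R, M)) (run c (R', M)) => [R1 M1] [R2 M2] /= [ag' -> ->].
  by have [? -> ->] := IHd _ _ M2 ag' bd.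
- case/andP=> be bc; have [-> ->] := eval_agree M ag be.
  by case: ifP => // _; have [? -> ->] := IHc _ _ M ag bc.
case/and3P=> ltx be bc; have [-> ->] := eval_agree M ag be.
move: (eval e R' M) => n; elim: n R R' M ag {be} => [|n IH] R R' M ag //=.
have := IHc _ _ M (agree_upd x n ag) bc.
case: (run c (upd R x n, M)) (run c (upd R' x n, M)) => [R1 M1] [R2 M2] /= [ag' -> ->].
have [? -> E] := IH _ _ M2 ag'; split=> //; lia.
Qed.

(** * Correctness and exact cost of the compiled code *)

Section Execution.
Variable P : program.

Definition steps t s s' := iter t (step P) s = s'.

Definition code_at l (c : program) := forall i, i < size c -> onth P (l + i) = onth c i.

Lemma steps_trans t t' s1 s2 s3 : steps t s1 s2 -> steps t' s2 s3 -> steps (t + t') s1 s3.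
Proof. by rewrite /steps addnC iterD => ->. Qed.

Lemma code_at_cat l c1 c2 : code_at l (c1 ++ c2) ->
  code_at l c1 /\ code_at (l + size c1) c2.
Proof.
move=> h; split=> i lt.
  by rewrite h ?size_cat ?ltn_addr // onth_cat lt.
rewrite -addnA h ?size_cat ?ltn_add2l // onth_cat ltnNge leq_addr /=.
by rewrite addKn.
Qed.

Lemma code_at_cons l ins c : code_at l (ins :: c) -> onth P l = Some ins /\ code_at l.+1 c.
Proof.
move=> h; split; first by rewrite -[l]addn0 h.
by move=> i lt; rewrite addSnnS h.
Qed.

Lemma step_cons ins p R M s t : onth P p = Some ins ->
  steps t (exec ins (State p R M)) s -> steps t.+1 (State p R M) s.
Proof.
move=> h h'; rewrite -add1n; apply: steps_trans h'.
by rewrite /steps /= /step /= h.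
Qed.

Lemma updE R x i r : upd R x i r = if r == x then i else R r. Proof. by []. Qed.

Ltac onestep h := let h1 := fresh in let h2 := fresh in
  case: (code_at_cons h) => h1 h2; apply: (step_cons h1); rewrite /exec /=;
  clear h h1; rename h2 into h.

Ltac fin := rewrite /steps /=; congr State; rewrite ?size_cat /=; lia.

Lemma steps0 s : steps 0 s s. Proof. by []. Qed.

Lemma agree_trans d R1 R2 R3 : agree d R1 R2 -> agree d R2 R3 -> agree d R1 R3.
Proof. by move=> h h' r lt; rewrite h // h'. Qed.

Lemma agreeW d d' R R' : d' <= d -> agree d R R' -> agree d' R R'.
Proof. by move=> le h r lt; apply: h; apply: leq_trans lt le. Qed.

Lemma exp_belowW d d' e : d <= d' -> exp_below d e -> exp_below d' e.
Proof.
move=> le; elim: e => //= [x lt|e IHe f IHf|e IHe f IHf|e IHe f IHf g IHg|x e IHe f IHf].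
- exact: leq_trans lt le.
- by case/andP=> /IHe -> /IHf ->.
- by case/andP=> /IHe -> /IHf ->.
- by case/and3P=> /IHe -> /IHf -> /IHg ->.
by case/and3P=> lt /IHe -> /IHf ->; rewrite (leq_trans lt le).
Qed.

Lemma steps_eq t t' s s' : steps t s s' -> t = t' -> steps t' s s'.
Proof. by move=> h <-. Qed.

Lemma neq_succ d : ((d == d.+1) = false) * ((d == d.+2) = false) * ((d == d.+3) = false) *
  ((d.+1 == d.+2) = false) * ((d.+1 == d.+3) = false) * ((d.+2 == d.+3) = false).
Proof. by do !split; apply/eqP; lia. Qed.

(** The counter in [d] runs downwards, so each round contributes the last term of the remaining sum.
    Register [x] is overwritten here; the surrounding code has saved it in [d.+1] and restores it
    afterwards. *)
Lemma sum_loopP d ll x f n cf R M :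
  cf = cexp f d.+3 (ll + 5) -> x < d -> exp_below d f ->
  code_at ll ([:: Jz d (ll + 5 + size cf + 3); Const d.+3 1; Sub d d d.+3; Const x 0; Add x x d] ++
      cf ++ [:: Add d.+2 d.+2 d.+3; Const d.+3 0; Jz d.+3 ll]) ->
  (forall R', exists R'', [/\ steps (eval_cost f R' M) (State (ll + 5) R' M)
      (State (ll + 5 + size cf) R'' M), R'' d.+3 = eval f R' M & agree d.+3 R'' R']) ->
  R d = n -> exists R', [/\ steps (\sum_(i < n) (5 + (eval_cost f (upd R x i) M + 3)) + 1)
    (State ll R M) (State (ll + 5 + size cf + 3) R' M),
    R' d.+1 = R d.+1, R' d.+2 = R d.+2 + \sum_(i < n) eval f (upd R x i) M &
    forall r, r < d -> r != x -> R' r = R r].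
Proof.
move=> cfE ltx bf code body; elim: n R => [|n IH] R Rd.
  exists R; rewrite !big_ord0 addn0; split=> //.
  by case/code_at_cat: code => h _; onestep h; rewrite Rd eqxx.
have [h /code_at_cat[_ h']] := code_at_cat code; rewrite /= in h'.
pose R1 := upd (upd (upd (upd R d.+3 1) d n) x 0) x n.
have [R2 [s2 v2 a2]] := body R1.
have R2d : R2 d = n by rewrite a2 ?ltnS ?leqW // /R1 !updE eqxx (gtn_eqF ltx).
have R1x r : r < d.+3 -> r != x -> r != d -> R1 r = R r.
  by move=> lt rx rd; rewrite /R1 !updE (negPf rx) (negPf rd) (ltn_eqF lt).
have ag1 : agree d R1 (upd R x n).
  move=> r lt; rewrite /R1 !updE; case: eqP => // _.
  by rewrite (ltn_eqF lt) (ltn_eqF (_ : r < d.+3)) //; lia.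
have [Ef Cf] := eval_agree M ag1 bf.
pose R3 := upd (upd R2 d.+2 (R2 d.+2 + R2 d.+3)) d.+3 0.
have R3d : R3 d = n by rewrite /R3 !updE !neq_succ.
have R3x r : r < d -> r != x -> R3 r = R r.
  move=> lt rx; have lt2 : r < d.+2 by lia.
  have lt3 : r < d.+3 by lia.
  by rewrite /R3 !updE (ltn_eqF lt3) (ltn_eqF lt2) a2 // R1x // (ltn_eqF lt).
have [R' [s' v1 v2' v3]] := IH R3 R3d.
have agi i : agree d (upd R3 x i) (upd R x i).
  by move=> r lt; rewrite !updE; case: (r =P x) => // /eqP rx; apply: R3x.
exists R'; split.
- rewrite big_ord_recr /=.
  have E : \sum_(i < n) (5 + (eval_cost f (upd R x i) M + 3)) =
           \sum_(i < n) (5 + (eval_cost f (upd R3 x i) M + 3)).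
    by apply: eq_bigr => i _; have [_ ->] := eval_agree M (agi i) bf.
  rewrite E -Cf; apply: steps_eq (_ : steps (5 + (eval_cost f R1 M + (3 +
    (\sum_(i < n) (5 + (eval_cost f (upd R3 x i) M + 3)) + 1)))) _ _) _; last by lia.
  apply: steps_trans (steps_trans s2 (steps_trans _ s')).
    onestep h; rewrite Rd /=; do 3!onestep h; onestep h.
    have -> : upd (upd (upd (upd R d.+3 1) d (upd R d.+3 1 d - upd R d.+3 1 d.+3)) x 0) x
      (upd (upd (upd R d.+3 1) d (upd R d.+3 1 d - upd R d.+3 1 d.+3)) x 0 x +
       upd (upd (upd R d.+3 1) d (upd R d.+3 1 d - upd R d.+3 1 d.+3)) x 0 d) = R1.
      rewrite /R1 !updE !eqxx neq_succ ?Rd ?subn1 //=.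
      by rewrite (gtn_eqF ltx).
    by fin.
  by onestep h'; onestep h'; onestep h'; rewrite updE eqxx.
- by rewrite v1 /R3 !updE !neq_succ a2 ?R1x //; lia.
- have E : \sum_(i < n) eval f (upd R3 x i) M = \sum_(i < n) eval f (upd R x i) M.
    by apply: eq_bigr => i _; have [-> _] := eval_agree M (agi i) bf.
  rewrite v2' E big_ord_recr /= /R3 !updE eqxx !neq_succ v2 Ef a2 ?R1x //; by lia.
by move=> r lt rx; rewrite v3 // R3x.
Qed.

Lemma cexpP e d l R M : code_at l (cexp e d l) -> exp_below d e ->
  exists R', [/\ steps (eval_cost e R M) (State l R M) (State (l + size (cexp e d l)) R' M),
    R' d = eval e R M & agree d R' R].
Proof.
elim: e d l R => [x|c|e IHe f IHf|e IHe f IHf|e IHe|e IHe f IHf g IHg|x e IHe f IHf] d l R /=.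
- move=> h ltx; exists (upd (upd R d 0) d (upd R d 0 d + upd R d 0 x)); split.
  + by do 2!onestep h; rewrite addn2; apply: steps0.
  + by rewrite !updE !eqxx (ltn_eqF ltx).
  + by move=> r lt; rewrite !updE (ltn_eqF lt).
- move=> h _; exists (upd R d c); split.
  + by onestep h; rewrite addn1; apply: steps0.
  + by rewrite updE eqxx.
  + by move=> r lt; rewrite !updE (ltn_eqF lt).
- move=> /code_at_cat[h1 /code_at_cat[h2 h3]] /andP[be bf].
  have [R1 [s1 v1 a1]] := IHe d l R h1 be.
  have [R2 [s2 v2 a2]] := IHf d.+1 _ R1 h2 (exp_belowW (leqnSn d) bf).
  have [Ef Cf] := eval_agree M a1 bf.
  exists (upd R2 d (R2 d + R2 d.+1)); split.
  + apply: steps_trans s1 _; rewrite -Cf; apply: steps_trans s2 _.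
    by onestep h3; fin.
  + by rewrite updE eqxx v2 Ef a2 // v1.
  + by move=> r lt; rewrite updE (ltn_eqF lt) a2 ?a1 // ltnS ltnW.
- move=> /code_at_cat[h1 /code_at_cat[h2 h3]] /andP[be bf].
  have [R1 [s1 v1 a1]] := IHe d l R h1 be.
  have [R2 [s2 v2 a2]] := IHf d.+1 _ R1 h2 (exp_belowW (leqnSn d) bf).
  have [Ef Cf] := eval_agree M a1 bf.
  exists (upd R2 d (R2 d - R2 d.+1)); split.
  + apply: steps_trans s1 _; rewrite -Cf; apply: steps_trans s2 _.
    by onestep h3; fin.
  + by rewrite updE eqxx v2 Ef a2 // v1.
  + by move=> r lt; rewrite updE (ltn_eqF lt) a2 ?a1 // ltnS ltnW.
- move=> /code_at_cat[h1 h2] be.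
  have [R1 [s1 v1 a1]] := IHe d l R h1 be.
  exists (upd R1 d (M (R1 d))); split.
  + by apply: steps_trans s1 _; onestep h2; fin.
  + by rewrite updE eqxx v1.
  + by move=> r lt; rewrite updE (ltn_eqF lt) a1.
- set ce := cexp e d l; set lf := l + size ce + 1; set cf := cexp f d lf.
  set lg := lf + size cf + 2; set cg := cexp g d lg.
  move=> /code_at_cat[h1 h2] /and3P[be bf bg].
  have [R1 [s1 v1 a1]] := IHe d l R h1 be.
  have [jz h3] := code_at_cons h2; rewrite -addn1 -/lf in h3.
  have [hf /= h4] := code_at_cat h3.
  have [ca h5] := code_at_cons h4; have [cj h6] := code_at_cons h5.
  have hg : code_at lg cg by move: h6; congr code_at; rewrite /lg; lia.
  have [Ef Cf] := eval_agree M a1 bf; have [Eg Cg] := eval_agree M a1 bg.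
  case: eqP => [e0|/eqP e0].
    have [R2 [s2 v2 a2]] := IHg d _ R1 hg bg.
    exists R2; split; [|by rewrite v2|exact: agree_trans a2 a1].
    apply: steps_trans s1 _; apply: step_cons jz _; rewrite /= v1 e0 /= -Cg.
    suff -> : l + size (ce ++ Jz d lg :: cf ++ [:: Const d.+1 0, Jz d.+1 (lg + size cg) & cg]) =
              lg + size cg by [].
    by rewrite /lg /lf; do 3!rewrite ?size_cat /=; lia.
  have [R2 [s2 v2 a2]] := IHf d _ R1 hf bf.
  exists (upd R2 d.+1 0); split.
  + apply: steps_trans s1 _; apply: step_cons jz _; rewrite /= v1 (negPf e0) /= -Cf.
    rewrite -[(l + size ce).+1]addn1 -/lf.
    apply: steps_trans s2 _; apply: step_cons ca _ => /=; apply: step_cons cj _ => /=.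
    rewrite updE eqxx /=; rewrite /steps /=; congr State.
    by rewrite /lg /lf; do 3!rewrite ?size_cat /=; lia.
  + by rewrite updE ltn_eqF // v2.
  + move=> r lt; rewrite updE ltn_eqF ?a2 ?a1 //; exact: ltnW.
set ce := cexp e d l; set ll := l + size ce + 3; set cf := cexp f d.+3 (ll + 5).
move=> /code_at_cat[h1 h2] /and3P[ltx be bf].
have [R1 [s1 v1 a1]] := IHe d l R h1 be.
have [h3 /= h4] := @code_at_cat _ [:: _; _; _] _ h2; rewrite -/ll in h4.
have h4' : code_at ll (([:: Jz d (ll + 5 + size cf + 3); Const d.+3 1; Sub d d d.+3;
    Const x 0; Add x x d] ++ cf ++ [:: Add d.+2 d.+2 d.+3; Const d.+3 0; Jz d.+3 ll]) ++
    [:: Const x 0; Add x x d.+1; Const d 0; Add d d d.+2]) by rewrite -!catA.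
have [h5 h6] := code_at_cat h4'.
pose R2 := upd (upd (upd R1 d.+1 0) d.+1 (R1 x)) d.+2 0.
have R2d : R2 d = eval e R M by rewrite /R2 !updE !neq_succ.
have code : code_at (ll + 5) cf.
  by have [_ /code_at_cat[]] := @code_at_cat _ [:: _; _; _; _; _] _ h5.
have bf3 : exp_below d.+3 f by apply: exp_belowW bf; lia.
have [R3 [s3 v3 w3 a3]] := @sum_loopP d ll x f (eval e R M) cf R2 M erefl ltx
  (exp_belowW (leqnn d) bf) h5 (fun R' => IHf d.+3 (ll + 5) R' code bf3) R2d.
have R2x : R2 d.+1 = R x by rewrite /R2 !updE eqxx !neq_succ a1.
have R20 : R2 d.+2 = 0 by rewrite /R2 !updE eqxx.
have ag2 : agree d R2 R.
  move=> r lt; rewrite /R2 !updE !ltn_eqF ?a1 //; lia.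
have h7 : code_at (ll + 5 + size cf + 3) [:: Const x 0; Add x x d.+1; Const d 0; Add d d d.+2].
  by move: h6; congr code_at; do 3!rewrite ?size_cat /=; lia.
have agi i : agree d (upd R2 x i) (upd R x i) by apply: agree_upd.
pose R4 := upd (upd R3 x 0) x (R x); pose R5 := upd (upd R4 d 0) d (R3 d.+2).
exists R5; split.
- have E : \sum_(i < eval e R M) (5 + (eval_cost f (upd R x i) M + 3)) =
           \sum_(i < eval e R M) (5 + (eval_cost f (upd R2 x i) M + 3)).
    by apply: eq_bigr => i _; have [_ ->] := eval_agree M (agi i) bf.
  rewrite E; apply: steps_trans s1 _.
  have st2 : steps 3 (State (l + size ce) R1 M) (State ll R2 M).
    rewrite /ll; do 3!onestep h3.
    have -> : upd (upd (upd R1 d.+1 0) d.+1 (upd R1 d.+1 0 d.+1 + upd R1 d.+1 0 x)) d.+2 0 = R2.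
      by rewrite /R2 !updE eqxx (ltn_eqF (leqW ltx)).
    by fin.
  apply: steps_trans st2 _.
  apply: steps_eq (_ : steps (\sum_(i < eval e R M) (5 + (eval_cost f (upd R2 x i) M + 3)) + 1 + 4)
    _ _) _; last by lia.
  apply: steps_trans s3 _; do 4!onestep h7.
  have -> : upd (upd (upd (upd R3 x 0) x (upd R3 x 0 x + upd R3 x 0 d.+1)) d 0) d
     (upd (upd (upd R3 x 0) x (upd R3 x 0 x + upd R3 x 0 d.+1)) d 0 d +
      upd (upd (upd R3 x 0) x (upd R3 x 0 x + upd R3 x 0 d.+1)) d 0 d.+2) = R5.
    rewrite /R5 /R4 !updE !eqxx (gtn_eqF (leqW ltx)) v3 R2x !add0n.
    have -> : (d.+2 == d) = false by apply/eqP; lia.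
    by have -> : (d.+2 == x) = false by apply/eqP; lia.
  rewrite /steps /=; congr State; rewrite /ll; do 5!rewrite ?size_cat /=; lia.
- rewrite /R5 updE eqxx w3 R20 add0n; apply: eq_bigr => i _.
  by have [-> _] := eval_agree M (agi i) bf.
move=> r lt; rewrite /R5 /R4 !updE (ltn_eqF lt); case: eqP => [->//|/eqP rx].
by rewrite a3 // ag2.
Qed.

(** The registers from [nv] up to [d] hold the counters of the enclosing loops, which a body has to
    preserve. *)
Definition keeps nv d (R' R : nat -> nat) := forall r, nv <= r < d -> R' r = R r.

Lemma for_loopP nv d ll x c n cc R Rs M :
  cc = ccmd c d.+1 (ll + 5) -> nv <= d -> x < nv -> cmd_below nv c ->
  code_at ll ([:: Jz d (ll + 5 + size cc + 2); Const d.+1 1; Sub d d d.+1; Const x 0; Add x x d] ++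
      cc ++ [:: Const d.+1 0; Jz d.+1 ll]) ->
  (forall R' M', exists R'', [/\ steps (run_cost c (R', M')) (State (ll + 5) R' M')
      (State (ll + 5 + size cc) R'' (run c (R', M')).2),
      agree nv R'' (run c (R', M')).1 & keeps nv d.+1 R'' R']) ->
  R d = n -> agree nv R Rs -> exists R',
    let body := fun i (s : memory) => run c (upd s.1 x i, s.2) in
    let cost := fun i (s : memory) => 5 + (run_cost c (upd s.1 x i, s.2) + 2) in
    [/\ steps (loop_cost cost body n (Rs, M) + 1)
        (State ll R M) (State (ll + 5 + size cc + 2) R' (loop body n (Rs, M)).2),
      agree nv R' (loop body n (Rs, M)).1 & keeps nv d R' R].
Proof.
move=> ccE led ltx bc code body; elim: n R Rs M => [|n IH] R Rs M Rd ag /=.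
  exists R; split=> //.
  by case/code_at_cat: code => h _; onestep h; rewrite Rd eqxx.
have [h /code_at_cat[_ h']] := code_at_cat code; rewrite /= in h'.
have ltxd : x < d by apply: leq_trans ltx led.
pose R1 := upd (upd (upd (upd R d.+1 1) d n) x 0) x n.
have ag1 : agree nv R1 (upd Rs x n).
  move=> r lt; have ltd : r < d by apply: leq_trans lt led.
  by rewrite /R1 !updE; case: eqP => // _; rewrite (ltn_eqF ltd) (ltn_eqF (leqW ltd)) ag.
have [R2 [s2 a2 k2]] := body R1 M.
have [ag3 E3 C3] := run_agree M ag1 bc.
pose R3 := upd R2 d.+1 0.
have R3d : R3 d = n.
  by rewrite /R3 !updE neq_succ k2 ?led //= /R1 !updE eqxx (gtn_eqF ltxd).
move: s2 a2 ag3; rewrite E3 C3.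
case: (run c (upd Rs x n, M)) => [Rs' M'] /= s2 a2 ag3.
have ag4 : agree nv R3 Rs'.
  move=> r lt; rewrite /R3 updE ltn_eqF ?a2 ?ag3 //; lia.
have [R' [s' a' k']] := IH R3 Rs' M' R3d ag4.
exists R'; split=> //.
  apply: steps_eq (_ : steps (5 + (run_cost c (upd Rs x n, M) + (2 + (loop_cost
    (fun i (s : memory) => 5 + (run_cost c (upd s.1 x i, s.2) + 2))
    (fun i (s : memory) => run c (upd s.1 x i, s.2)) n (Rs', M') + 1)))) _ _) _; last by lia.
  apply: steps_trans (steps_trans s2 (steps_trans _ s')).
    onestep h; rewrite Rd /=; do 4!onestep h.
    have -> : upd (upd (upd (upd R d.+1 1) d (upd R d.+1 1 d - upd R d.+1 1 d.+1)) x 0) x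
      (upd (upd (upd R d.+1 1) d (upd R d.+1 1 d - upd R d.+1 1 d.+1)) x 0 x +
       upd (upd (upd R d.+1 1) d (upd R d.+1 1 d - upd R d.+1 1 d.+1)) x 0 d) = R1.
      rewrite /R1 !updE !eqxx neq_succ Rd subn1 /=.
      by rewrite (gtn_eqF ltxd).
    by fin.
  by do 2!onestep h'; rewrite updE eqxx.
move=> r /andP[le lt]; rewrite k' ?le //; have rx : (r == x) = false by apply/eqP; lia.
rewrite /R3 !updE ltn_eqF ?k2 /R1 ?updE ?rx ?(ltn_eqF lt) ?(ltn_eqF (leqW lt)) //; first by rewrite le leqW.
exact: leqW.
Qed.

Lemma ccmdP nv c d l R M : nv <= d -> cmd_below nv c -> code_at l (ccmd c d l) ->
  exists R', [/\ steps (run_cost c (R, M)) (State l R M)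
      (State (l + size (ccmd c d l)) R' (run c (R, M)).2),
    agree nv R' (run c (R, M)).1 & keeps nv d R' R].
Proof.
elim: c d l R M => [x e|e f|c1 IH1 c2 IH2|e c IHc|x e c IHc] d l R M led /=.
- case/andP=> ltx be /code_at_cat[h1 h2].
  have [R1 [s1 v1 a1]] := cexpP R M h1 (exp_belowW led be).
  have ltxd := leq_trans ltx led.
  exists (upd (upd R1 x 0) x (R1 d)); split.
  + apply: steps_trans s1 _; do 2!onestep h2; rewrite !updE !eqxx (gtn_eqF ltxd) add0n.
    by fin.
  + move=> r lt; rewrite !updE v1; case: eqP => // _; apply: a1.
    exact: leq_trans lt led.
  + move=> r /andP[le lt]; rewrite !updE gtn_eqF ?a1 //; exact: leq_trans ltx le.
- case/andP=> be bf /code_at_cat[h1 /code_at_cat[h2 h3]].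
  have [R1 [s1 v1 a1]] := cexpP R M h1 (exp_belowW led be).
  have [R2 [s2 v2 a2]] := cexpP R1 M h2 (exp_belowW (leqW led) bf).
  have [Ef Cf] := eval_agree M (agreeW led a1) bf.
  exists R2; split.
  + apply: steps_trans s1 _; rewrite -Cf; apply: steps_trans s2 _; onestep h3.
    by rewrite v2 Ef a2 // v1; fin.
  + by move=> r lt; rewrite a2 ?a1 //; lia.
  + by move=> r lt; rewrite a2 ?a1 //; lia.
- case/andP=> b1 b2 /code_at_cat[h1 h2].
  have [R1 [s1 a1 k1]] := IH1 d l R M led b1 h1.
  move: s1 a1; case: (run c1 (R, M)) => [R' M'] /= s1 a1.
  have [R2 [s2 a2 k2]] := IH2 d _ R1 M' led b2 h2.
  have [a3 E3 C3] := run_agree M' a1 b2; rewrite E3 C3 in s2.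
  exists R2; split.
  + by apply: steps_trans s1 _; rewrite size_cat addnA.
  + exact: agree_trans a2 a3.
  + by move=> r lt; rewrite k2 ?k1.
- case/andP=> be bc /code_at_cat[h1 h2].
  have [R1 [s1 v1 a1]] := cexpP R M h1 (exp_belowW led be).
  have [jz h3] := code_at_cons h2; rewrite -addn1 in h3.
  have agn := agreeW led a1.
  case: eqP => [e0|/eqP e0] /=.
    exists R1; split=> //; last by move=> r /andP[_ lt]; rewrite a1.
    apply: steps_trans s1 _; apply: step_cons jz _; rewrite /= v1 e0 /=.
    by rewrite /steps /=; congr State; rewrite size_cat /=; lia.
  have [R2 [s2 a2 k2]] := IHc d _ R1 M led bc h3.
  have [a3 E3 C3] := run_agree M agn bc; rewrite E3 C3 in s2.
  exists R2; split.
  + apply: steps_trans s1 _; apply: step_cons jz _; rewrite /= v1 (negPf e0) /=.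
    rewrite -[(l + _).+1]addn1; move: s2; congr steps; congr State.
    by rewrite size_cat /=; lia.
  + exact: agree_trans a2 a3.
  + by move=> r lt; rewrite k2 // a1 //; case/andP: lt.
case/and3P=> ltx be bc /code_at_cat[h1 h2].
have [R1 [s1 v1 a1]] := cexpP R M h1 (exp_belowW led be).
set ll := l + size (cexp e d l) in h2 *; set cc := ccmd c d.+1 (ll + 5) in h2 *.
have code : code_at (ll + 5) cc.
  by have [_ /code_at_cat[]] := @code_at_cat _ [:: _; _; _; _; _] _ h2.
have [R2 [s2 a2 k2]] := @for_loopP nv d ll x c _ cc R1 R M erefl led ltx bc h2
  (fun R' M' => IHc d.+1 (ll + 5) R' M' (leqW led) bc code) v1 (agreeW led a1).
exists R2; split=> //.
  apply: steps_trans s1 _; move: s2; congr steps; congr State.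
  by rewrite /ll; do 5!rewrite ?size_cat /=; lia.
by move=> r lt; rewrite k2 // a1 //; case/andP: lt.
Qed.
End Execution.

(** A halted machine stays in its state, so every time bound above the exact cost will do; [0 < nv]
    makes the output register a program variable. *)
Lemma run_outputs nv c R M t : 0 < nv -> cmd_below nv c -> run_cost c (R, M) <= t ->
  outputs (ccmd c nv 0) (init R M) t ((run c (R, M)).1 0).
Proof.
move=> nv0 bc le; have code : code_at (ccmd c nv 0) 0 (ccmd c nv 0) by move=> i _.
have [R' [s a _]] := ccmdP R M (leqnn nv) bc code.
have halt u : iter u (step (ccmd c nv 0)) (State (size (ccmd c nv 0)) R' (run c (R, M)).2) =
    State (size (ccmd c nv 0)) R' (run c (R, M)).2.
  by elim: u => //= u ->; rewrite /step /= onth_default.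
rewrite /outputs -(subnK le) iterD.
have -> : iter (run_cost c (R, M)) (step (ccmd c nv 0)) (init R M) =
    State (size (ccmd c nv 0)) R' (run c (R, M)).2 by [].
by rewrite halt /halted /= leqnn a.
Qed.

(* Register 0 holds the number of vertices.  Loops and sums bounded by it, in
   programs that never assign it, take polynomial time. *)
Fixpoint exp_poly e : bool :=
  match e with
  | Var _ | Cst _ => true
  | Plus e f | Minus e f => exp_poly e && exp_poly f
  | Peek e => exp_poly e
  | Ite e f g => [&& exp_poly e, exp_poly f & exp_poly g]
  | Sum x (Var 0) f => (0 < x) && exp_poly f
  | Sum _ _ _ => false
  end.

Fixpoint cmd_poly c : bool :=
  match c with
  | Assign x e => (0 < x) && exp_poly e
  | Store e f => exp_poly e && exp_poly f
  | Seq c d => cmd_poly c && cmd_poly d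
  | If e c => exp_poly e && cmd_poly c
  | For x (Var 0) c => (0 < x) && cmd_poly c
  | For _ _ _ => false
  end.

Definition poly_bound (cost : (nat -> nat) -> (nat -> nat) -> nat) :=
  exists a k, forall R M, cost R M <= a * (R 0).+1 ^ k.

Lemma poly_bound_const m : poly_bound (fun _ _ => m).
Proof. by exists m, 0 => R M; rewrite muln1. Qed.

Lemma poly_bound_add f g : poly_bound f -> poly_bound g ->
  poly_bound (fun R M => f R M + g R M).
Proof.
case=> a [k hf] [b [l hg]]; exists (a + b), (k + l) => R M.
rewrite mulnDl; apply: leq_add.
  apply: leq_trans (hf R M) _; rewrite leq_mul2l expnD leq_pmulr ?orbT //.
  by rewrite expn_gt0.
apply: leq_trans (hg R M) _; rewrite leq_mul2l expnD leq_pmull ?orbT //.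
by rewrite expn_gt0.
Qed.

Lemma poly_boundW f g : (forall R M, f R M <= g R M) -> poly_bound g -> poly_bound f.
Proof. by move=> le [a [k h]]; exists a, k => R M; apply: leq_trans (le R M) (h R M). Qed.

Lemma eval_cost_poly e : exp_poly e -> poly_bound (eval_cost e).
Proof.
elim: e => [x|c|e IHe f IHf|e IHe f IHf|e IHe|e IHe f IHf g IHg|x e IHe f IHf].
- by move=> _; apply: poly_bound_const.
- by move=> _; apply: poly_bound_const.
- case/andP=> /IHe he /IHf hf; apply: poly_bound_add he (poly_bound_add hf _).
  exact: poly_bound_const.
- case/andP=> /IHe he /IHf hf; apply: poly_bound_add he (poly_bound_add hf _).
  exact: poly_bound_const.
- by move=> /IHe he; apply: poly_bound_add he (poly_bound_const _).
- case/and3P=> /IHe he /IHf hf /IHg hg.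
  apply: poly_boundW (poly_bound_add he (poly_bound_add hf (poly_bound_add hg (poly_bound_const 3)))).
  by move=> R M /=; case: ifP => _; lia.
case: e {IHe} => //= -[|//] /andP[x0 /IHf[a [k h]]].
(* Eight further steps in each round, and ten for the bound of the sum, the initialisation and the
   exit with the restoring of [x]. *)
exists (8 + a + 10), k.+1 => R M /=.
have S : \sum_(i < R 0) (5 + (eval_cost f (upd R x i) M + 3)) <= R 0 * ((8 + a) * (R 0).+1 ^ k).
  rewrite -[X in X * _]card_ord -sum_nat_const; apply: leq_sum => i _.
  have := h (upd R x i) M; rewrite updE (ltn_eqF x0).
  have : 0 < (R 0).+1 ^ k by rewrite expn_gt0.
  by move: (_ ^ k) (eval_cost _ _ _) => u v; nia.
have : 0 < (R 0).+1 ^ k by rewrite expn_gt0.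
rewrite expnS; move: S; move: (\sum_(i < _) _) ((R 0).+1 ^ k) => u v; nia.
Qed.

(** This allows the cost of later commands to be bounded in terms of the initial register 0. *)
Lemma run_reg0 c s : cmd_poly c -> (run c s).1 0 = s.1 0.
Proof.
elim: c s => [x e|e f|c IHc d IHd|e c IHc|x e c IHc] s //=.
- by case/andP=> x0 _; rewrite updE (ltn_eqF x0).
- by case/andP=> pc pd; rewrite IHd ?IHc.
- by case/andP=> _ pc; case: ifP => // _; rewrite IHc.
case: e => // -[|//] /andP[x0 pc] /=.
move: {1}(s.1 0) => m; elim: m s => [|n IH] s //=.
by rewrite IH IHc //= updE (ltn_eqF x0).
Qed.

Lemma run_cost_poly c : cmd_poly c -> poly_bound (fun R M => run_cost c (R, M)).
Proof.
elim: c => [x e|e f|c IHc d IHd|e c IHc|x e c IHc].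
- by case/andP=> _ /eval_cost_poly he; apply: poly_bound_add he (poly_bound_const _).
- case/andP=> /eval_cost_poly he /eval_cost_poly hf.
  exact: poly_bound_add he (poly_bound_add hf (poly_bound_const _)).
- case/andP=> pc pd; have hc := IHc pc; have [a [k h]] := IHd pd.
  apply: poly_bound_add hc _; exists a, k => R M.
  have := h (run c (R, M)).1 (run c (R, M)).2.
  by rewrite -surjective_pairing run_reg0.
- case/andP=> /eval_cost_poly he /IHc hc.
  apply: poly_boundW (poly_bound_add he (poly_bound_add hc (poly_bound_const 1))).
  by move=> R M /=; case: ifP => _; lia.
case: e => // -[|//] /andP[x0 pc]; have [a [k h]] := IHc pc.
(* Seven further steps in each round, and three for the bound of the loop and the final test. *)
exists (7 + a + 3), k.+1 => R M /=.
set cost := fun i s => _; set body := fun i s => _.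
have S n Rs Ms : Rs 0 = R 0 -> loop_cost cost body n (Rs, Ms) <= n * ((7 + a) * (R 0).+1 ^ k).
  elim: n Rs Ms => [|n IH] Rs Ms E //=.
  have := h (upd Rs x n) Ms; rewrite updE (ltn_eqF x0) E => h1.
  have : (body n (Rs, Ms)).1 0 = R 0 by rewrite /body run_reg0 //= updE (ltn_eqF x0).
  case: (body n (Rs, Ms)) => [R' M'] /= /IH => h2.
  rewrite mulSn; apply: leq_add; last exact: h2.
  have : 0 < (R 0).+1 ^ k by rewrite expn_gt0.
  by rewrite /cost /=; move: h1; move: (_ ^ k) (run_cost _ _) => u v; nia.
have := S (R 0) R M erefl; have : 0 < (R 0).+1 ^ k by rewrite expn_gt0.
rewrite expnS; move: (loop_cost _ _ _ _) ((R 0).+1 ^ k) => u v; nia.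
Qed.

(** * The reductions as programs *)

Definition Not e := Ite e (Cst 0) (Cst 1).
Definition And e f := Ite e f (Cst 0).
Definition Or e f := Ite e (Cst 1) f.
Definition Imp e f := Ite e f (Cst 1).
(** Every nonzero value counts as true, which makes truncated subtraction a comparison. *)
Definition Lt e f := Minus f e.
Definition Eq e f := Ite (Plus (Minus e f) (Minus f e)) (Cst 0) (Cst 1).
Definition Ex x e := Sum x (Var 0) e.
Definition All x e := Not (Ex x (Not e)).
Definition Count x e := Sum x (Var 0) (Ite e (Cst 1) (Cst 0)).

Definition holds e R M := eval e R M != 0.

Lemma holds_Not e R M : holds (Not e) R M = ~~ holds e R M.
Proof. by rewrite /holds /=; case: (eval e R M == 0). Qed.

Lemma holds_And e f R M : holds (And e f) R M = holds e R M && holds f R M.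
Proof. by rewrite /holds /=; case: (eval e R M == 0). Qed.

Lemma holds_Or e f R M : holds (Or e f) R M = holds e R M || holds f R M.
Proof. by rewrite /holds /=; case: (eval e R M == 0). Qed.

Lemma holds_Imp e f R M : holds (Imp e f) R M = (holds e R M ==> holds f R M).
Proof. by rewrite /holds /=; case: (eval e R M == 0). Qed.

Lemma holds_Lt e f R M : holds (Lt e f) R M = (eval e R M < eval f R M).
Proof. by rewrite /holds /= subn_eq0 -ltnNge. Qed.

Lemma holds_Eq e f R M : holds (Eq e f) R M = (eval e R M == eval f R M).
Proof. by rewrite /holds /= addn_eq0 !subn_eq0 -eqn_leq; case: ifP. Qed.

Lemma holds_Ex n x e R M : R 0 = n ->
  holds (Ex x e) R M = [exists i : 'I_n, holds e (upd R x i) M].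
Proof.
by move=> R0; rewrite /holds /= R0 sum_nat_eq0 negb_forall.
Qed.

Lemma holds_All n x e R M : R 0 = n ->
  holds (All x e) R M = [forall i : 'I_n, holds e (upd R x i) M].
Proof.
move=> R0; rewrite holds_Not (holds_Ex _ _ _ R0) negb_exists.
by apply: eq_forallb => i; rewrite holds_Not negbK.
Qed.

Lemma eval_Count n x e R M : R 0 = n ->
  eval (Count x e) R M = #|[set i : 'I_n | holds e (upd R x i) M]|.
Proof.
move=> R0; rewrite -sum1dep_card /= R0.
transitivity (\sum_(i < n) if holds e (upd R x i) M then 1 else 0); last by rewrite -big_mkcond.
by apply: eq_bigr => i _; rewrite /holds; case: (eval e _ M == 0).
Qed.

Section Formulas.
Variables (n : nat) (G : sgraph 'I_n).
Implicit Types (X W : {set 'I_n}) (R M : nat -> nat) (u v w : 'I_n).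

Definition env R := (R 0 = n) /\ (R 2 = n * n).

Definition graph_encoded M := forall u v, M (u * n + v) = G u v.

Definition sets_encoded X W M :=
  (forall u, M (n * n + u) = (u \in X)) /\ (forall u, M (n * n + n + u) = (u \notin W)).

Lemma env_upd R x i : env R -> 2 < x -> env (upd R x i).
Proof. by case=> R0 R2 lt; split; rewrite updE ltn_eqF // (leq_trans _ lt). Qed.

(* Register 0 holds n, register 1 the first player and register 2 the number n^2.
   The cells n^2 + u mark the modulator X and the cells n^2 + n + u the deleted
   vertices. *)
Definition InX x := Peek (Plus (Var 2) (Var x)).
Definition Alive x := Not (Peek (Plus (Plus (Var 2) (Var 0)) (Var x))).
(* x * n as a sum, since the machine does not multiply. *)
Definition Row x := Sum 40 (Var 0) (Ite (Lt (Var 40) (Var x)) (Var 0) (Cst 0)).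
Definition Adj x y := Peek (Plus (Row x) (Var y)).
(** Each quantifier owns a fixed register, with larger numbers further inside; the bounds on the
    free registers in the lemmas below exclude capture. *)
Definition SameLink x y := All 30 (Imp (InX 30) (Eq (Adj x 30) (Adj y 30))).
Definition InClique y x :=
  And (Not (InX x)) (And (Alive x) (Or (Eq (Var x) (Var y)) (Adj y x))).
Definition TwinCount y := Count 25 (And (InClique y 25) (SameLink 25 y)).
Definition HasTwin x z :=
  Ex 24 (And (InClique x 24) (And (Not (Eq (Var 24) (Var z))) (SameLink 24 z))).
(** Sets of links are compared by mutual inclusion, vertex by vertex, so that no such set is ever
    stored. The filter [E] covers both all links and the repeated ones. *)
Definition LinksSubIf (E : nat -> nat -> exp) x y :=
  All 22 (Imp (And (InClique x 22) (E x 22))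
    (Ex 23 (And (And (InClique y 23) (E y 23)) (SameLink 22 23)))).
Definition LinksSub := LinksSubIf (fun _ _ => Cst 1).
Definition TwinLinksSub := LinksSubIf HasTwin.
Definition SameKind x y :=
  And (SameLink x y) (And (And (LinksSub x y) (LinksSub y x))
    (And (TwinLinksSub x y) (TwinLinksSub y x))).
Definition KinCount y :=
  Count 21 (And (And (Alive 21) (Not (InX 21))) (SameKind 21 y)).
Definition InducedPath x y z :=
  And (Adj x y) (And (Adj y z) (And (Not (Eq (Var x) (Var z))) (Not (Adj x z)))).

Section Meaning.
Variables (X W : {set 'I_n}) (M : nat -> nat).
Hypotheses (encG : graph_encoded M) (encS : sets_encoded X W M).

Lemma holds_InX R x u : env R -> R x = u -> holds (InX x) R M = (u \in X).
Proof. by case=> _ R2 Rx; rewrite /holds /= R2 Rx encS.1; case: (u \in X). Qed.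

Lemma holds_Alive R x u : env R -> R x = u -> holds (Alive x) R M = (u \in W).
Proof.
case=> R0 R2 Rx; rewrite holds_Not /holds /= R2 R0 Rx encS.2.
by case: (u \in W).
Qed.

Lemma eval_Row R x u : env R -> x < 40 -> R x = u -> eval (Row x) R M = u * n.
Proof.
case=> R0 R2 lt Rx; rewrite /= R0.
transitivity (\sum_(i < n) if i < u then n else 0).
  apply: eq_bigr => i _; rewrite !updE /= (ltn_eqF lt) Rx subn_eq0.
  by rewrite leqNgt; case: ltnP.
rewrite -big_mkcond sum_nat_cond_const; congr (_ * _).
rewrite -[RHS]card_ord -sum1_card -sum1_card.
rewrite [RHS](big_ord_widen_cond n (fun=> true) (fun=> 1) (ltnW (ltn_ord u))).
by apply: eq_bigl => i; rewrite inE.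
Qed.

Lemma holds_Adj R x y u v : env R -> x < 40 -> R x = u -> R y = v ->
  holds (Adj x y) R M = G u v.
Proof.
move=> eR lt Rx Ry; have E := eval_Row eR lt Rx.
by rewrite /holds /Adj; cbn [eval]; rewrite E /= Ry encG; case: (G u v).
Qed.

Lemma eval_Adj R x y u v : env R -> x < 40 -> R x = u -> R y = v ->
  eval (Adj x y) R M = G u v.
Proof.
move=> eR lt Rx Ry; have E := eval_Row eR lt Rx.
by rewrite /Adj; cbn [eval]; rewrite E /= Ry encG.
Qed.

Lemma upd_neq R x y i : (x == y) = false -> upd R y i x = R x.
Proof. by rewrite updE => ->. Qed.

Lemma upd_eq R x i : upd R x i x = i.
Proof. by rewrite updE eqxx. Qed.

Lemma holds_SameLink R x y u v : env R -> x < 30 -> y < 30 -> R x = u -> R y = v ->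
  holds (SameLink x y) R M = (link G X u == link G X v).
Proof.
move=> eR ltx lty Rx Ry; have [R0 _] := eR.
have e30 i : env (upd R 30 i) by apply: env_upd.
have Ux i : upd R 30 i x = u by rewrite upd_neq ?Rx // ltn_eqF.
have Uy i : upd R 30 i y = v by rewrite upd_neq ?Ry // ltn_eqF.
rewrite (holds_All _ _ _ R0); apply/forallP/eqP => [h|E i].
  apply/setP => w; have := h w; rewrite !inE.
  rewrite holds_Imp holds_Eq (@holds_InX _ _ w) ?upd_eq //.
  case: (w \in X) => //; rewrite implyTb.
  rewrite (@eval_Adj _ _ _ u w) ?upd_eq ?(leq_trans ltx) //.
  rewrite (@eval_Adj _ _ _ v w) ?upd_eq ?(leq_trans lty) //.
  by case: (G u w); case: (G v w).
rewrite holds_Imp holds_Eq (@holds_InX _ _ i) ?upd_eq //.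
rewrite (@eval_Adj _ _ _ u i) ?upd_eq ?(leq_trans ltx) //.
rewrite (@eval_Adj _ _ _ v i) ?upd_eq ?(leq_trans lty) //.
by apply/implyP => iX; move/setP/(_ i): E; rewrite !inE iX /= => ->.
Qed.

Lemma holds_InClique R x y u v : env R -> y < 40 -> R x = u -> R y = v ->
  holds (InClique y x) R M = (u \in clique_of G X W v).
Proof.
move=> eR lt Rx Ry; rewrite 2!holds_And holds_Not holds_Or holds_Eq clique_ofE.
by rewrite (holds_InX eR Rx) (holds_Alive eR Rx) (holds_Adj eR lt Ry Rx) /= Rx Ry.
Qed.

Lemma eval_TwinCount R y v : env R -> y < 25 -> R y = v ->
  eval (TwinCount y) R M = #|twins_of G X W v|.
Proof.
move=> eR lt Ry; have [R0 _] := eR; rewrite (eval_Count _ _ _ R0).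
apply: eq_card => i; rewrite in_set holds_And [RHS]in_set.
have e1 : env (upd R 25 i) by apply: env_upd.
have Uy : upd R 25 i y = v by rewrite upd_neq ?Ry // ltn_eqF.
rewrite (@holds_InClique _ _ _ i v) ?upd_eq ?(leq_trans lt) //.
by rewrite (@holds_SameLink _ _ _ i v) ?upd_eq ?(leq_trans lt).
Qed.

Lemma holds_HasTwin R x z u w : env R -> x < 24 -> z < 24 -> R x = u -> R z = w ->
  holds (HasTwin x z) R M =
  [exists w' in clique_of G X W u, (w' != w) && (link G X w' == link G X w)].
Proof.
move=> eR ltx ltz Rx Rz; have [R0 _] := eR; rewrite (holds_Ex _ _ _ R0).
apply: eq_existsb => i; have e1 : env (upd R 24 i) by apply: env_upd.
have Ux : upd R 24 i x = u by rewrite upd_neq ?Rx // ltn_eqF.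
have Uz : upd R 24 i z = w by rewrite upd_neq ?Rz // ltn_eqF.
rewrite holds_And (@holds_InClique _ _ _ i u) ?upd_eq ?(leq_trans ltx) //.
rewrite holds_And holds_Not holds_Eq (@holds_SameLink _ _ _ i w) ?upd_eq ?(leq_trans ltz) //=.
by rewrite Uz.
Qed.

Lemma holds_LinksSubIf E (p : 'I_n -> pred 'I_n) R x y u v :
  (forall R x z u w, env R -> x < 24 -> z < 24 -> R x = u -> R z = w ->
     holds (E x z) R M = p u w) ->
  env R -> x < 22 -> y < 22 -> R x = u -> R y = v ->
  holds (LinksSubIf E x y) R M =
    ([set link G X w | w in clique_of G X W u & p u w] \subset
     [set link G X w | w in clique_of G X W v & p v w]).
Proof.
move=> Ep eR ltx lty Rx Ry; have [R0 _] := eR; rewrite (holds_All _ _ _ R0).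
have body (i : 'I_n) : holds (Imp (And (InClique x 22) (E x 22))
    (Ex 23 (And (And (InClique y 23) (E y 23)) (SameLink 22 23)))) (upd R 22 i) M =
    ((i \in clique_of G X W u) && p u i ==>
      (link G X i \in [set link G X w | w in clique_of G X W v & p v w])).
  have e1 : env (upd R 22 i) by apply: env_upd.
  have Ux : upd R 22 i x = u by rewrite upd_neq ?Rx // ltn_eqF.
  have Uy : upd R 22 i y = v by rewrite upd_neq ?Ry // ltn_eqF.
  rewrite holds_Imp holds_And (@holds_InClique _ _ _ i u) ?upd_eq ?(leq_trans ltx) //.
  rewrite (Ep _ _ _ u i) ?upd_eq ?(leq_trans ltx) //.
  congr (_ ==> _); rewrite (holds_Ex _ _ _ e1.1).
  have in_links (j : 'I_n) : holds (And (And (InClique y 23) (E y 23)) (SameLink 22 23))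
      (upd (upd R 22 i) 23 j) M =
      ((j \in clique_of G X W v) && p v j) && (link G X i == link G X j).
    have e2 : env (upd (upd R 22 i) 23 j) by apply: env_upd.
    have Uy' : upd (upd R 22 i) 23 j y = v by rewrite upd_neq // ltn_eqF // leqW.
    rewrite 2!holds_And (@holds_InClique _ _ _ j v) ?upd_eq ?(leq_trans lty) //.
    rewrite (Ep _ _ _ v j) ?upd_eq ?(leq_trans lty) //.
    by rewrite (@holds_SameLink _ _ _ i j) ?upd_eq // upd_neq ?upd_eq.
  apply/existsP/imsetP => [[j]|[j]].
    by rewrite in_links => /andP[jC /eqP E']; exists j; rewrite // inE.
  by rewrite inE => jC E'; exists j; rewrite in_links jC E' eqxx.
apply/forallP/subsetP => [h tau /imsetP[i]|h i].
  by rewrite inE => ip ->; have := h i; rewrite body ip.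
by rewrite body; apply/implyP => ip; apply: h; apply: imset_f; rewrite inE.
Qed.

Lemma holds_LinksSub R x y u v : env R -> x < 22 -> y < 22 -> R x = u -> R y = v ->
  holds (LinksSub x y) R M = (links G X W u \subset links G X W v).
Proof.
move=> eR ltx lty Rx Ry.
have linksE w : [set link G X w' | w' in clique_of G X W w & true] = links G X W w.
  by apply/setP => tau; apply/imsetP/imsetP => -[w' wC ->]; exists w' => //;
     move: wC; rewrite inE andbT.
by rewrite -!linksE (@holds_LinksSubIf _ (fun _ => xpredT) _ _ _ u v).
Qed.

Lemma holds_TwinLinksSub R x y u v : env R -> x < 22 -> y < 22 -> R x = u -> R y = v ->
  holds (TwinLinksSub x y) R M = (twin_links G X W u \subset twin_links G X W v).
Proof. exact: holds_LinksSubIf holds_HasTwin. Qed.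

Lemma holds_SameKind R x y u v : env R -> x < 22 -> y < 22 -> R x = u -> R y = v ->
  holds (SameKind x y) R M = same_kind G X W u v.
Proof.
move=> eR ltx lty Rx Ry; rewrite 4!holds_And.
rewrite (holds_SameLink eR _ _ Rx Ry) ?(leq_trans ltx) ?(leq_trans lty) //.
rewrite (holds_LinksSub eR ltx lty Rx Ry) (holds_LinksSub eR lty ltx Ry Rx).
rewrite (holds_TwinLinksSub eR ltx lty Rx Ry) (holds_TwinLinksSub eR lty ltx Ry Rx).
by rewrite -!eqEsubset.
Qed.

Lemma eval_KinCount R y v : env R -> y < 21 -> R y = v ->
  eval (KinCount y) R M = #|kin G X W v|.
Proof.
move=> eR lt Ry; have [R0 _] := eR; rewrite (eval_Count _ _ _ R0).
apply: eq_card => i; rewrite in_set 2!holds_And [RHS]in_set in_setD.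
have e1 : env (upd R 21 i) by apply: env_upd.
have Uy : upd R 21 i y = v by rewrite upd_neq ?Ry // ltn_eqF.
rewrite (@holds_Alive _ _ i) ?upd_eq // holds_Not (@holds_InX _ _ i) ?upd_eq //.
by rewrite (@holds_SameKind _ _ _ i v) ?upd_eq ?(leq_trans lt) // (andbC (i \in W)).
Qed.

Lemma holds_InducedPath R x y z u v w : env R -> x < 40 -> y < 40 -> z < 40 ->
  R x = u -> R y = v -> R z = w ->
  holds (InducedPath x y z) R M = induced_path G u v w.
Proof.
move=> eR ltx lty ltz Rx Ry Rz; rewrite 3!holds_And holds_Not holds_Eq holds_Not.
rewrite (holds_Adj eR ltx Rx Ry) (holds_Adj eR lty Ry Rz) (holds_Adj eR ltx Rx Rz).
by rewrite /= Rx Rz.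
Qed.
End Meaning.
End Formulas.

(** * Loop invariants of the reduction programs *)

Lemma loop_ind (Inv : nat -> memory -> Prop) body m s : Inv m s ->
  (forall k s, k < m -> Inv k.+1 s -> Inv k (body k s)) -> Inv 0 (loop body m s).
Proof.
elim: m s => [|m IH] s //= i0 st; apply: IH; first exact: st.
by move=> k s' lt; apply: st; apply: ltnW.
Qed.

Lemma run_If e c s : run (If e c) s = if holds e s.1 s.2 then run c s else s.
Proof. by rewrite /holds /=; case: ifP. Qed.

Definition xaddr x := Plus (Var 2) (Var x).
Definition dead_addr x := Plus (Plus (Var 2) (Var 0)) (Var x).

Definition pack_body :=
  If (And (Not (InX 10)) (And (Not (InX 11)) (And (Not (InX 12)) (InducedPath 10 11 12))))
    (Seq (Store (xaddr 10) (Cst 1)) (Seq (Store (xaddr 11) (Cst 1)) (Store (xaddr 12) (Cst 1)))).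
Definition pack_cmd := For 10 (Var 0) (For 11 (Var 0) (For 12 (Var 0) pack_body)).

Definition twin_body :=
  If (And (Alive 10) (And (Not (InX 10)) (Lt (Cst 2) (TwinCount 10))))
    (Store (dead_addr 10) (Cst 1)).
Definition twin_cmd := For 10 (Var 0) twin_body.

(** The test avoids [Alive], which the loop itself alters; marking a dead vertex again does no
    harm. *)
Definition delete_cmd :=
  For 11 (Var 0) (If (And (Not (InX 11)) (Or (Eq (Var 11) (Var 10)) (Adj 10 11)))
    (Store (dead_addr 11) (Cst 1))).
Definition kind_body :=
  If (And (Alive 10) (And (Not (InX 10)) (Lt (Cst 13) (KinCount 10)))) delete_cmd.
Definition kind_cmd := For 10 (Var 0) kind_body.

Section Reduction.
Variables (n : nat) (G : sgraph 'I_n) (pc : nat).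
Implicit Types (X W : {set 'I_n}) (s : memory) (u v w : 'I_n).

Definition well_formed X W s :=
  [/\ env n s.1, s.1 1 = pc, graph_encoded G s.2 & sets_encoded X W s.2].

(** Indices run downwards: [Inv k] describes the state in which the vertices from [k] on have been
    treated. *)
Lemma for_ind (Inv : nat -> memory -> Prop) x c s : s.1 0 = n -> Inv n s ->
  (forall u s, Inv u.+1 s -> Inv u (run c (upd s.1 x u, s.2))) ->
  Inv 0 (run (For x (Var 0) c) s).
Proof.
move=> s0 i0 st /=; rewrite s0; apply: loop_ind => // k s' lt.
exact: (st (Ordinal lt)).
Qed.

Lemma well_formed_upd X W R M x i : 2 < x -> well_formed X W (R, M) ->
  well_formed X W (upd R x i, M).
Proof.
move=> lt [eR R1 gM sM]; split=> //; first exact: env_upd.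
by rewrite /= upd_neq // ltn_eqF // ltnW.
Qed.

Lemma entry_lt u v : u * n + v < n * n.
Proof. by have := ltn_ord u; have := ltn_ord v; nia. Qed.

Lemma well_formed_store X W R M a i : n * n + (n + n) <= a ->
  well_formed X W (R, M) -> well_formed X W (R, upd M a i).
Proof.
move=> le [eR R1 gM [xM wM]]; split=> //=.
  by move=> u v; rewrite upd_neq // ltn_eqF //; have := entry_lt u v; lia.
by split=> u; rewrite upd_neq // ltn_eqF //; have := ltn_ord u; lia.
Qed.

Lemma well_formed_X X W R M u : well_formed X W (R, M) ->
  well_formed (u |: X) W (R, upd M (n * n + u) 1).
Proof.
move=> [eR R1 gM [xM wM]]; split=> //=.
  by move=> v w; rewrite upd_neq // ltn_eqF //; have := entry_lt v w; lia.
split=> v /=.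
  by rewrite updE eqn_add2l (inj_eq val_inj) in_setU1; case: (v == u) => //=.
by rewrite upd_neq // gtn_eqF //; have := ltn_ord u; lia.
Qed.

Lemma well_formed_dead X W R M u : well_formed X W (R, M) ->
  well_formed X (W :\ u) (R, upd M (n * n + n + u) 1).
Proof.
move=> [eR R1 gM [xM wM]]; split=> //=.
  by move=> v w; rewrite upd_neq // ltn_eqF //; have := entry_lt v w; lia.
split=> v /=.
  by rewrite upd_neq // ltn_eqF //; have := ltn_ord v; lia.
by rewrite updE eqn_add2l (inj_eq val_inj) in_setD1 negb_and negbK; case: (v == u) => //=.
Qed.

Definition unpacked X u v w := [&& u \notin X, v \notin X, w \notin X & induced_path G u v w].

(** A triple once excluded stays excluded while X grows, so one pass over all triples yields a
    maximal packing. *)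
Lemma unpacked_mono X X' u v w : X \subset X' -> ~~ unpacked X u v w -> ~~ unpacked X' u v w.
Proof.
move=> sX; apply: contra => /and4P[h1 h2 h3 h4].
by apply/and4P; split=> //; [move: h1 | move: h2 | move: h3]; apply: contra; apply: (subsetP sX).
Qed.

Lemma pack_bodyP X R M u v w : well_formed X setT (R, M) -> packed G X ->
  R 10 = u -> R 11 = v -> R 12 = w -> exists M' X',
  [/\ run pack_body (R, M) = (R, M'), well_formed X' setT (R, M'), packed G X',
      X \subset X' & ~~ unpacked X' u v w].
Proof.
move=> wf pX R10 R11 R12; have [eR R1 gM sM] := wf; rewrite /= in eR R1 gM sM.
have c : holds (And (Not (InX 10)) (And (Not (InX 11)) (And (Not (InX 12))
    (InducedPath 10 11 12)))) R M = unpacked X u v w.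
  rewrite 3!holds_And (holds_InducedPath gM eR _ _ _ R10 R11 R12) //.
  by rewrite !holds_Not (holds_InX sM eR R10) (holds_InX sM eR R11) (holds_InX sM eR R12).
have E : run pack_body (R, M) = if unpacked X u v w then
    (R, upd (upd (upd M (n * n + u) 1) (n * n + v) 1) (n * n + w) 1) else (R, M).
  have [R0 R2] := eR.
  rewrite /pack_body; cbn [run fst snd]; rewrite -c /holds; case: eqP => //= _.
  by rewrite R2 R10 R11 R12.
case unp: (unpacked X u v w); rewrite unp in E; last first.
  by exists M, X; rewrite unp.
exists (upd (upd (upd M (n * n + u) 1) (n * n + v) 1) (n * n + w) 1), (w |: (v |: (u |: X))).
split=> //.
- by do 3!apply: well_formed_X.
- have /and4P[uX vX wX ip] := unp.
  have -> : w |: (v |: (u |: X)) = X :|: [set u; v; w].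
    apply/setP => x; rewrite !inE.
    by case: (x == u); case: (x == v); case: (x == w); rewrite ?orbT ?orbF.
  exact: packed_add.
- by apply/subsetP => x xX; rewrite !inE xX !orbT.
- by rewrite /unpacked !inE eqxx !orbT.
Qed.

Lemma pack_cmdP s : well_formed set0 setT s -> exists X,
  [/\ well_formed X setT (run pack_cmd s), packed G X & cluster_off G X].
Proof.
move=> wf.
(* The invariants of the three nested loops together say that all lexicographically larger triples
   are excluded. *)
pose Inv1 k s := exists X, [/\ well_formed X setT s, packed G X &
  forall u v w, k <= u -> ~~ unpacked X u v w].
have : Inv1 0 (run pack_cmd s).
  apply: for_ind; first by have [[]] := wf.
    exists set0; split=> //; first exact: packed0.
    by move=> u v w; rewrite leqNgt ltn_ord.
  move=> u s1 [X [wf1 pX done1]].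
  pose Inv2 k s := s.1 10 = u /\ exists X, [/\ well_formed X setT s, packed G X,
    forall u' v w, u < u' -> ~~ unpacked X u' v w &
    forall v w, k <= v -> ~~ unpacked X u v w].
  suff [_ [X' [wf' pX' d1 d2]]] : Inv2 0 (run (For 11 (Var 0) (For 12 (Var 0) pack_body))
      (upd s1.1 10 u, s1.2)).
    exists X'; split=> // u' v w; rewrite leq_eqVlt => /orP[/eqP/val_inj <-|].
      exact: d2.
    exact: d1.
  apply: for_ind; first by have [[]] := wf1.
    split; first by rewrite /= upd_eq.
    exists X; split=> //.
    by move=> v w; rewrite leqNgt ltn_ord.
  move=> v s2 [s2u [X2 [wf2 pX2 d1 d2]]].
  pose Inv3 k s := [/\ s.1 10 = u, s.1 11 = v & exists X, [/\ well_formed X setT s, packed G X,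
    forall u' v w, u < u' -> ~~ unpacked X u' v w,
    forall v' w, v < v' -> ~~ unpacked X u v' w &
    forall w, k <= w -> ~~ unpacked X u v w]].
  suff [s3u _ [X' [wf' pX' e1 e2 e3]]] : Inv3 0 (run (For 12 (Var 0) pack_body)
      (upd s2.1 11 v, s2.2)).
    split=> //; exists X'; split=> // v' w; rewrite leq_eqVlt => /orP[/eqP/val_inj <-|].
      exact: e3.
    exact: e2.
  apply: for_ind; first by have [[]] := wf2.
    split; rewrite /= ?upd_eq ?upd_neq //.
    exists X2; split=> //.
    by move=> w; rewrite leqNgt ltn_ord.
  move=> w [R M]; cbn [fst snd]; move=> [s3u s3v [X3 [wf3 pX3 e1 e2 e3]]].
  have wf4 : well_formed X3 setT (upd R 12 w, M) by apply: well_formed_upd.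
  have [|||M' [X' [-> wf' pX' sX np]]] := @pack_bodyP X3 (upd R 12 w) M u v w wf4 pX3.
  - by rewrite upd_neq.
  - by rewrite upd_neq.
  - by rewrite upd_eq.
  split; rewrite /= ?upd_neq //; exists X'; split=> //.
  - by move=> u' v' w' lt; apply: unpacked_mono sX (e1 _ _ _ lt).
  - by move=> v' w' lt; apply: unpacked_mono sX (e2 _ _ lt).
  move=> w'; rewrite leq_eqVlt => /orP[/eqP/val_inj <-|lt] //.
  exact: unpacked_mono sX (e3 _ lt).
case=> X [wf' pX np]; exists X; split=> // u v w uX vX wX uv vw uw.
apply/negPn/negP => nuw; have := np u v w (leq0n _).
by rewrite /unpacked uX vX wX /induced_path uv vw uw nuw.
Qed.

Lemma twin_cmdP X s : cluster_off G X -> well_formed X setT s -> exists W,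
  well_formed X W (run twin_cmd s) /\ twin_reduced G X W setT.
Proof.
move=> cl wf; pose Inv k s := exists W, well_formed X W s /\
  twin_reduced G X W [set v : 'I_n | k <= v].
have : Inv 0 (run twin_cmd s).
  apply: for_ind; first by have [[]] := wf.
    exists setT; split=> //; split=> // v; rewrite inE leqNgt ltn_ord //.
  move=> v [R M]; cbn [fst snd]; move=> [W [wf1 red]]; exists (twin_step G X W v).
  have wf2 : well_formed X W (upd R 10 v, M) by apply: well_formed_upd.
  have [eR R1 gM sM] := wf2; rewrite /= in eR R1 gM sM.
  have c : holds (And (Alive 10) (And (Not (InX 10)) (Lt (Cst 2) (TwinCount 10))))
      (upd R 10 v) M = [&& v \in W, v \notin X & 2 < #|twins_of G X W v|].
    rewrite 2!holds_And (holds_Alive sM eR (upd_eq _ _ _)).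
    rewrite holds_Not (holds_InX sM eR (upd_eq _ _ _)) holds_Lt.
    by rewrite (eval_TwinCount gM sM eR _ (upd_eq _ _ _)).
  split.
    rewrite /twin_step -c /holds /twin_body; cbn [run fst snd]; case: eqP => //= _.
    have [-> ->] := eR; rewrite upd_eq; exact: well_formed_dead.
  have -> : [set v0 : 'I_n | v <= v0] = v |: [set v0 : 'I_n | v < v0].
    by apply/setP => x; rewrite !inE leq_eqVlt (inj_eq val_inj) eq_sym.
  exact: twin_stepP.
by case=> W [wf' red]; exists W; split.
Qed.

Lemma delete_cmdP X W R M v : X \subset W -> well_formed X W (R, M) -> R 10 = v ->
  well_formed X (W :\: clique_of G X W v) (run delete_cmd (R, M)).
Proof.
move=> XW wf R10.
pose Inv k s := s.1 10 = v /\
  well_formed X (W :\: [set w in clique_of G X W v | k <= w]) s.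
have inDS k x : (x \in W :\: [set w in clique_of G X W v | k <= w]) =
    ~~ ((x \in clique_of G X W v) && (k <= x)) && (x \in W) by rewrite in_setD in_set.
have : Inv 0 (run delete_cmd (R, M)).
  apply: for_ind; first by have [[]] := wf.
    split=> //=; have -> // : W :\: [set w in clique_of G X W v | n <= w] = W.
    by apply/setP => w; rewrite in_setD in_set leqNgt ltn_ord andbF.
  move=> w [R' M']; cbn [fst snd]; move=> [R10' wf1]; set W1 := W :\: _ in wf1.
  have wf2 : well_formed X W1 (upd R' 11 w, M') by apply: well_formed_upd.
  have [eR R1 gM sM] := wf2; rewrite /= in eR R1 gM sM.
  have R10u : upd R' 11 w 10 = v by rewrite upd_neq.
  have c : holds (And (Not (InX 11)) (Or (Eq (Var 11) (Var 10)) (Adj 10 11)))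
     (upd R' 11 w) M' = (w \notin X) && ((w == v) || G v w).
    rewrite holds_And holds_Not (holds_InX sM eR (upd_eq _ _ _)) holds_Or holds_Eq.
    rewrite (@holds_Adj _ _ _ gM _ _ _ _ _ eR _ R10u (upd_eq _ _ _)) //.
    by rewrite /= upd_eq R10u.
  rewrite run_If; cbn [fst snd]; rewrite c; case: ifP => cw; split; (try by rewrite /= upd_neq); last first.
    have -> : W :\: [set w0 in clique_of G X W v | w <= w0] = W1 => //.
    apply/setP => x; rewrite !inDS leq_eqVlt (inj_eq val_inj).
    have [<-|_] := eqVneq w x; last by [].
    by rewrite clique_ofE; move: cw; case: (w \notin X) => //= ->; rewrite andbF.
  have [E0 E2] := eR; cbn [run eval fst snd dead_addr]; rewrite E0 E2 upd_eq.
  have -> : W :\: [set w0 in clique_of G X W v | w <= w0] = W1 :\ w.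
    apply/setP => x; rewrite in_setD1 !inDS leq_eqVlt (inj_eq val_inj) eq_sym.
    have [->|_] /= := eqVneq x w; last by [].
    rewrite clique_ofE andbT; case/andP: cw => -> ->.
    by case: (w \in W).
  exact: well_formed_dead.
case=> _; have -> // : [set w in clique_of G X W v | 0 <= w] = clique_of G X W v.
by apply/setP => w; rewrite inE andbT.
Qed.

Lemma kind_cmdP X W s : cluster_off G X -> well_formed X W s -> twin_reduced G X W setT ->
  exists W', well_formed X W' (run kind_cmd s) /\ kind_reduced G X W' setT.
Proof.
move=> cl wf [XW out tw].
pose Inv k s := exists W, well_formed X W s /\ kind_reduced G X W [set v : 'I_n | k <= v].
have : Inv 0 (run kind_cmd s).
  apply: for_ind; first by have [[]] := wf.
    exists W; split=> //; split=> // [v|v]; first by apply: tw; rewrite inE.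
    by rewrite inE leqNgt ltn_ord.
  move=> v [R M]; cbn [fst snd]; move=> [W1 [wf1 red]]; exists (kind_step G X W1 v).
  have wf2 : well_formed X W1 (upd R 10 v, M) by apply: well_formed_upd.
  have [eR R1 gM sM] := wf2; rewrite /= in eR R1 gM sM.
  have c : holds (And (Alive 10) (And (Not (InX 10)) (Lt (Cst 13) (KinCount 10))))
      (upd R 10 v) M = [&& v \in W1, v \notin X & 13 < #|kin G X W1 v|].
    rewrite 2!holds_And (holds_Alive sM eR (upd_eq _ _ _)).
    rewrite holds_Not (holds_InX sM eR (upd_eq _ _ _)) holds_Lt.
    by rewrite (eval_KinCount gM sM eR _ (upd_eq _ _ _)).
  split.
    rewrite /kind_step -c /holds /kind_body.
    have [XW1 _ _ _] := red.
    have del := delete_cmdP XW1 wf2 (upd_eq _ _ _).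
    move: del; move: delete_cmd => dc del; cbn [run fst snd].
    by case: eqP.
  have -> : [set v0 : 'I_n | v <= v0] = v |: [set v0 : 'I_n | v < v0].
    by apply/setP => x; rewrite !inE leq_eqVlt (inj_eq val_inj) eq_sym.
  exact: kind_stepP.
by case=> W' [wf' red]; exists W'; split.
Qed.
End Reduction.

(** * Evaluation of all positions of the kernel *)

Section Codes.
Variables (n : nat) (W : {set 'I_n}).
Implicit Types (A B : {set 'I_n}) (u v w : 'I_n).

(* A position is coded in base 3, with digit 1 for the vertices of Staller and 2
   for those of Dominator, so that every move increases the code. *)
Definition rest k := #|[set w in W | k <= w]|.
Definition weight (v : nat) := 3 ^ rest v.+1.
Definition digit A B v := (v \in A) + (v \in B).*2.
Definition tail A B k := \sum_(v in W | k <= v) digit A B v * weight v.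
Definition code A B := tail A B 0.

Lemma rest_out k : n <= k -> rest k = 0.
Proof.
move=> le; apply: eq_card0 => v; rewrite !inE leqNgt (leq_trans (ltn_ord v)) //.
by rewrite andbF.
Qed.

Lemma tail_out A B k : n <= k -> tail A B k = 0.
Proof.
move=> le; apply: big1 => v /andP[_]; rewrite leqNgt (leq_trans (ltn_ord v)) //.
Qed.

Lemma restS v : rest v = (v \in W) + rest v.+1.
Proof.
rewrite /rest (cardsD1 v) !inE leqnn andbT; congr (_ + _); apply: eq_card => x.
rewrite !inE (ltn_neqAle v x); case: eqVneq => [->|xv]; first by rewrite eqxx andbF.
by rewrite (inj_eq val_inj) eq_sym xv.
Qed.

Lemma tailS A B v : tail A B v = (v \in W) * (digit A B v * weight v) + tail A B v.+1.
Proof.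
have E (x : 'I_n) : (x \in W) && (v < x) = ((x \in W) && (v <= x)) && (x != v).
  by rewrite ltn_neqAle -andbA (inj_eq val_inj) eq_sym [(x != v) && _]andbC.
rewrite /tail (eq_bigl _ _ E); case vW: (v \in W).
  by rewrite (bigD1 v) /= ?vW ?leqnn // mul1n.
rewrite mul0n add0n; apply: eq_bigl => x.
by case: eqVneq => [->|]; rewrite ?vW // andbT.
Qed.

Lemma digit_le2 A B v : [disjoint A & B] -> digit A B v <= 2.
Proof.
move=> dis; rewrite /digit; case vA: (v \in A); last by case: (v \in B).
by rewrite (disjointFr dis vA).
Qed.

(** Exponents count surviving vertices only, so [3 ^ #|W|] table entries are enough, whatever [n]
    is. *)
Lemma tail_lt A B k : [disjoint A & B] -> tail A B k < 3 ^ rest k.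
Proof.
move=> dis; have [le|lt] := leqP n k; first by rewrite tail_out // rest_out.
rewrite -(subKn (ltnW lt)); move: (n - k) (leq_subr k n) => m.
elim: m => [|m IH] le; first by rewrite subn0 tail_out // rest_out.
have lt' : n - m.+1 < n by lia.
have E : n - m = (Ordinal lt').+1 by rewrite /=; lia.
have := IH (ltnW le); rewrite E => h.
have := tailS A B (Ordinal lt'); have := restS (Ordinal lt'); have := digit_le2 (Ordinal lt') dis.
move: h; rewrite /weight /=; move: (rest (n - m.+1)) (rest _.+1) => r r' h d -> ->.
move: h; rewrite expnD; move: (3 ^ r') (tail _ _ _) (digit _ _ _) d => p t d d2.
by case: (_ \in W); rewrite ?expn1 ?expn0 ?mul1n ?mul0n; nia.
Qed.

Lemma codeE A B : code A B = \sum_(v in W) digit A B v * weight v.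
Proof. by apply: eq_bigl => v; rewrite andbT. Qed.

Lemma code_addA A B v : v \in W -> v \notin A -> code (v |: A) B = code A B + weight v.
Proof.
move=> vW vA; rewrite !codeE (bigD1 v) //= [in RHS](bigD1 v) //=.
rewrite {1 3}/digit in_setU1 eqxx (negPf vA) add0n /=.
have -> : \sum_(i in W | i != v) digit (v |: A) B i * weight i =
          \sum_(i in W | i != v) digit A B i * weight i.
  by apply: eq_bigr => x /andP[_ xv]; rewrite /digit in_setU1 (negPf xv).
by move: (\sum_(_ | _) _) (weight v) ((v \in B).*2) => S p d; nia.
Qed.

Lemma code_addB A B v : v \in W -> v \notin B ->
  code A (v |: B) = code A B + (weight v + weight v).
Proof.
move=> vW vB; rewrite !codeE (bigD1 v) //= [in RHS](bigD1 v) //=.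
rewrite {1 3}/digit in_setU1 eqxx (negPf vB) addn0 /=.
have -> : \sum_(i in W | i != v) digit A (v |: B) i * weight i =
          \sum_(i in W | i != v) digit A B i * weight i.
  by apply: eq_bigr => x /andP[_ xv]; rewrite /digit in_setU1 (negPf xv).
by move: (\sum_(_ | _) _) (weight v) => S p; nia.
Qed.

Lemma code0 : code set0 set0 = 0.
Proof. by rewrite codeE big1 // => v _; rewrite /digit !inE. Qed.
End Codes.

(* The powers of 3, the digits of the current position and the table start at the
   cells n^2 + 2n, n^2 + 3n and n^2 + 4n.  Register 3 ends up with the number of
   positions; registers 5, 6 and 7 hold the current code, what is left of it to
   decode, and the player to move. *)
Definition weight_addr x := Plus (Plus (Var 2) (Plus (Var 0) (Var 0))) (Var x).
Definition digit_addr x := Plus (Plus (Var 2) (Plus (Var 0) (Plus (Var 0) (Var 0)))) (Var x).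
Definition table_addr e :=
  Plus (Plus (Var 2) (Plus (Plus (Var 0) (Var 0)) (Plus (Var 0) (Var 0)))) e.
Definition Weight x := Peek (weight_addr x).
Definition Digit x := Peek (digit_addr x).
Definition Table e := Peek (table_addr e).

Definition weights_body := If (Alive 10)
  (Seq (Store (weight_addr 10) (Var 3)) (Assign 3 (Plus (Var 3) (Plus (Var 3) (Var 3))))).
Definition weights_cmd := Seq (Assign 3 (Cst 1)) (For 10 (Var 0) weights_body).

(* Vertex 0 has the largest weight, so its digit comes first, while loops run
   downwards. *)
Definition decode_body :=
  Seq (Assign 11 (Minus (Minus (Var 0) (Cst 1)) (Var 10)))
  (If (Alive 11)
    (Seq (Store (digit_addr 11) (Plus (Ite (Lt (Var 6) (Weight 11)) (Cst 0) (Cst 1))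
            (Ite (Lt (Var 6) (Plus (Weight 11) (Weight 11))) (Cst 0) (Cst 1))))
         (Assign 6 (Minus (Var 6) (Plus (Ite (Lt (Cst 0) (Digit 11)) (Weight 11) (Cst 0))
            (Ite (Lt (Cst 1) (Digit 11)) (Weight 11) (Cst 0))))))).
Definition decode_cmd := Seq (Assign 6 (Var 5)) (For 10 (Var 0) decode_body).

(** The player to move is not part of the code of a position: every claimed vertex flips the
    turn. *)
Definition turn_body := If (And (Alive 10) (Digit 10)) (Assign 7 (Minus (Cst 1) (Var 7))).
Definition turn_cmd := Seq (Assign 7 (Var 1)) (For 10 (Var 0) turn_body).

Definition Free x := And (Alive x) (Not (Digit x)).
Definition Lost := Ex 20 (And (Alive 20) (All 21 (Imp
  (And (Alive 21) (Or (Eq (Var 21) (Var 20)) (Adj 20 21))) (Eq (Digit 21) (Cst 1))))).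
Definition StallerMove := Ex 20 (And (Free 20) (Table (Plus (Var 5) (Weight 20)))).
Definition DominatorMoves :=
  All 20 (Imp (Free 20) (Table (Plus (Var 5) (Plus (Weight 20) (Weight 20))))).
Definition Value := Ite (Ex 20 (Free 20)) (Ite (Var 7) DominatorMoves StallerMove) Lost.

Definition solve_body :=
  Seq decode_cmd (Seq turn_cmd (Store (table_addr (Var 5)) (Ite Value (Cst 1) (Cst 0)))).
Definition solve_cmd := For 5 (Var 3) solve_body.

Section Solve.
Variables (n : nat) (G : sgraph 'I_n) (dom_first : bool) (X W : {set 'I_n}).
Implicit Types (A B : {set 'I_n}) (R M : nat -> nat) (s : memory) (u v w : 'I_n).

Notation wf := (well_formed G dom_first X W).
Notation weight := (weight W).
Notation rest := (rest W).
Notation digit := (@digit n).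
Notation tail := (tail W).
Notation code := (code W).
Notation wbase := (n * n + (n + n)).
Notation dbase := (n * n + (n + (n + n))).
Notation tbase := (n * n + ((n + n) + (n + n))).

Definition weighted s :=
  [/\ wf s, s.1 3 = 3 ^ rest 0 & forall w, w \in W -> s.2 (wbase + w) = weight w].

Lemma run_Seq c d s : run (Seq c d) s = run d (run c s). Proof. by []. Qed.

Lemma weights_cmdP s : wf s -> weighted (run weights_cmd s).
Proof.
move=> wfs; pose Inv k s := [/\ wf s, s.1 3 = 3 ^ rest k &
  forall w, w \in W -> k <= w -> s.2 (wbase + w) = weight w].
suff [wf' r3 ws] : Inv 0 (run weights_cmd s) by split=> // w wW; apply: ws.
rewrite /weights_cmd run_Seq; apply: (for_ind (n := n)); first by have [[]] := wfs.
  split=> //; first by rewrite rest_out.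
  by move=> w _; rewrite leqNgt ltn_ord.
move=> u [R M]; cbn [fst snd]; move=> [wf1 R3 ws]; cbn [fst snd] in R3, ws.
have wf2 : wf (upd R 10 u, M) by apply: well_formed_upd.
have [eR R1 gM sM] := wf2; cbn [fst snd] in eR, R1, gM, sM; have [R0 R2] := eR.
rewrite run_If; cbn [fst snd]; rewrite (holds_Alive sM eR (upd_eq _ _ _)).
have ru := restS W u; case: ifP => uW; rewrite uW in ru; last first.
  split=> //; first by rewrite /= upd_neq // R3 ru.
  move=> w wW; rewrite leq_eqVlt => /orP[/eqP/val_inj E|]; last exact: ws.
  by rewrite E wW in uW.
have E : run (Seq (Store (weight_addr 10) (Var 3)) (Assign 3 (Plus (Var 3) (Plus (Var 3) (Var 3)))))
   (upd R 10 u, M) = (upd (upd R 10 u) 3 (R 3 + (R 3 + R 3)), upd M (wbase + u) (R 3)).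
  by cbn [run eval fst snd weight_addr]; rewrite R0 R2 upd_eq upd_neq.
rewrite E; split.
- apply: well_formed_upd => //; apply: well_formed_store => //; exact: leq_addr.
- by rewrite /= upd_eq R3 ru add1n expnS; lia.
move=> w wW; rewrite leq_eqVlt => /orP[/eqP/val_inj <-|lt].
  by rewrite /= upd_eq R3.
rewrite /= upd_neq ?ws //; apply/eqP => /addnI /val_inj E'.
by rewrite E' ltnn in lt.
Qed.

Lemma weighted_upd R M x i : 3 < x -> weighted (R, M) -> weighted (upd R x i, M).
Proof.
move=> lt [wfs r3 ws]; split=> //; first by apply: well_formed_upd => //; apply: ltnW.
by cbn [fst snd] in *; rewrite upd_neq ?r3 // ltn_eqF.
Qed.

Lemma weighted_store R M a i : dbase <= a -> weighted (R, M) -> weighted (R, upd M a i).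
Proof.
move=> le [wfs r3 ws]; split=> //; first by apply: well_formed_store => //; lia.
move=> w wW; cbn [fst snd] in *; rewrite upd_neq ?ws // ltn_eqF //.
by have := ltn_ord w; lia.
Qed.

Lemma eval_Weight R M x v : weighted (R, M) -> v \in W -> R x = v ->
  eval (Weight x) R M = weight v.
Proof.
by case=> -[[R0 R2] _ _ _] _ ws vW Rx; cbn [fst snd] in *; rewrite /= R0 R2 Rx ws.
Qed.

Lemma eval_Digit R M x v : weighted (R, M) -> R x = v ->
  eval (Digit x) R M = M (dbase + v).
Proof. by case=> -[[R0 R2] _ _ _] _ _ Rx; cbn [fst snd] in *; rewrite /= R0 R2 Rx. Qed.

Lemma eval_Table R M e : weighted (R, M) ->
  eval (Table e) R M = M (tbase + eval e R M).
Proof. by case=> -[[R0 R2] _ _ _] _ _; cbn [fst snd] in *; rewrite /= R0 R2. Qed.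

Lemma decode_bodyP R M u : weighted (R, M) -> R 10 = u ->
  let v := rev_ord u in
  let d := (weight v <= R 6) + (weight v + weight v <= R 6) in
  run decode_body (R, M) =
  if v \in W then (upd (upd R 11 v) 6 (R 6 - ((0 < d) * weight v + (1 < d) * weight v)),
                   upd M (dbase + v) d)
  else (upd R 11 v, M).
Proof.
move=> wR R10 v d; have [[eR _ gM sM] _ _] := wR; cbn [fst snd] in *.
have E : run (Assign 11 (Minus (Minus (Var 0) (Cst 1)) (Var 10))) (R, M) = (upd R 11 v, M).
  have [R0 _] := eR; cbn [run eval fst snd]; rewrite R0 R10.
  by rewrite -subnDA add1n.
rewrite /decode_body run_Seq E run_If; cbn [fst snd].
have w1 : weighted (upd R 11 v, M) by apply: weighted_upd.
have [[eR1 _ _ _] _ _] := w1; cbn [fst snd] in eR1.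
rewrite (holds_Alive sM eR1 (upd_eq _ _ _)); case: ifP => // vW.
have W1 := eval_Weight w1 vW (upd_eq _ _ _).
rewrite run_Seq.
have E2 : run (Store (digit_addr 11) (Plus (Ite (Lt (Var 6) (Weight 11)) (Cst 0) (Cst 1))
            (Ite (Lt (Var 6) (Plus (Weight 11) (Weight 11))) (Cst 0) (Cst 1))))
   (upd R 11 v, M) = (upd R 11 v, upd M (dbase + v) d).
  have [R0 R2] := eR1; cbn [run fst snd]; congr (_, upd M _ _).
    by cbn [eval digit_addr]; rewrite R0 R2 upd_eq.
  by cbn [eval Lt]; rewrite W1 upd_neq.
rewrite E2.
have w2 : weighted (upd R 11 v, upd M (dbase + v) d) by apply: weighted_store => //; apply: leq_addr.
have W2 := eval_Weight w2 vW (upd_eq _ _ _).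
have D2 := eval_Digit w2 (upd_eq R 11 v); rewrite upd_eq in D2.
cbn [run fst snd]; congr (upd _ _ _, _).
cbn [eval Lt]; rewrite W2 D2 upd_neq //.
by case: (d) => [|[|k]]; rewrite ?mul1n ?mul0n.
Qed.

(** Comparisons with one and two weights find the next digit, because the tail behind it is smaller
    than one weight. *)
Lemma decode_cmdP s : weighted s ->
  let s' := run decode_cmd s in
  [/\ weighted s', s'.1 5 = s.1 5, forall a, tbase <= a -> s'.2 a = s.2 a &
    forall A B, [disjoint A & B] -> code A B = s.1 5 ->
      forall w, w \in W -> s'.2 (dbase + w) = digit A B w].
Proof.
case: s => Rs Ms ws s'; set s := (Rs, Ms) in ws s' *.
pose Inv k t := [/\ weighted t, t.1 5 = s.1 5,
    forall a, tbase <= a -> t.2 a = s.2 a &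
    forall A B, [disjoint A & B] -> code A B = s.1 5 -> t.1 6 = tail A B (n - k) /\
      forall w, w \in W -> w < n - k -> t.2 (dbase + w) = digit A B w].
suff [w' r5 ta dg] : Inv 0 s'.
  split=> // A B dis cE w wW; have [_ ->] := dg A B dis cE => //.
  by rewrite subn0.
rewrite /s' /decode_cmd run_Seq; have [[[R0 R2] _ _ _] _ _] := ws.
apply: (for_ind (n := n)) => //.
  split=> //=.
  by move=> A B dis <-; rewrite subnn /code upd_eq; split.
move=> u [R M]; cbn [fst snd]; move=> [w1 R5 ta dg]; cbn [fst snd] in R5, ta, dg.
have w2 : weighted (upd R 10 u, M) by apply: weighted_upd.
have ltu := ltn_ord u.
have Eu : n - u = (rev_ord u).+1 by rewrite /=; lia.
have Eu1 : n - u.+1 = rev_ord u by [].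
rewrite (decode_bodyP w2 (upd_eq _ _ _)) upd_neq //; set v := rev_ord u in Eu Eu1 *.
case: ifP => vW.
  split.
  - do 2!apply: weighted_upd => //; apply: weighted_store; rewrite ?leq_addr //.
  - by rewrite /= !upd_neq.
  - move=> a le; rewrite /= upd_neq ?ta // gtn_eqF //; have := ltn_ord v; lia.
  move=> A B dis cE; have [r6 dgs] := dg A B dis cE.
  have tS := tailS W A B v; rewrite vW mul1n in tS.
  have tl : tail A B v.+1 < weight v by apply: tail_lt.
  have d2 := digit_le2 v dis; rewrite Eu1 tS in r6.
  have dE : (weight v <= R 6) + (weight v + weight v <= R 6) = digit A B v.
    rewrite r6; move: d2 tl; move: (digit A B v) (weight v) (tail A B v.+1).
    by move=> [|[|[|d]]] // p t _ lt; nia.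
  rewrite dE Eu; split; cbn [fst snd].
    rewrite upd_eq r6; move: d2; move: (digit A B v) (weight v) (tail A B v.+1).
    by move=> [|[|[|d]]] // p t _ /=; lia.
  move=> w wW; rewrite ltnS leq_eqVlt => /orP[/eqP/val_inj ->|lt].
    by rewrite upd_eq.
  rewrite upd_neq ?dgs // ?Eu1 //; apply/eqP => /addnI /val_inj E'.
  by rewrite E' ltnn in lt.
split=> // A B dis cE; have [r6 dgs] := dg A B dis cE.
cbn [fst snd]; rewrite !upd_neq // r6 Eu1 Eu tailS vW mul0n; split=> // w wW.
rewrite ltnS leq_eqVlt => /orP[/eqP/val_inj E'|lt]; last by apply: dgs; rewrite ?Eu1.
by rewrite E' vW in wW.
Qed.

(** Parity settles the turn for all pairs of sets, including those that no play reaches; their table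
    entries are filled like the others. *)
Definition dominator_turn A B := dom_first (+) odd (#|A| + #|B|).

Definition position_value A B :=
  staller_wins (undominated G W) (W :\: (A :|: B)) A (~~ dominator_turn A B).

Definition claimed M k := #|[set w in W | (k <= w) && (M (dbase + w) != 0)]|.

Lemma claimedS M u : claimed M u = (u \in W) && (M (dbase + u) != 0) + claimed M u.+1.
Proof.
rewrite /claimed (cardsD1 u) !inE leqnn; congr (_ + _); apply: eq_card => x.
rewrite !inE ltn_neqAle (inj_eq val_inj) eq_sym.
by case: (u != x); rewrite ?andbF.
Qed.

Lemma turn_cmdP R M : weighted (R, M) -> exists R',
  [/\ run turn_cmd (R, M) = (R', M), weighted (R', M), R' 5 = R 5 &
      R' 7 = dom_first (+) odd (claimed M 0)].
Proof.
move=> wR; pose Inv k s := [/\ s.2 = M, weighted s, s.1 5 = R 5 &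
  s.1 7 = dom_first (+) odd (claimed M k)].
suff [m w r5 r7] : Inv 0 (run turn_cmd (R, M)).
  move: m w r5 r7; case: (run turn_cmd (R, M)) => R' M'; cbn [fst snd] => -> w r5 r7.
  by exists R'.
rewrite /turn_cmd run_Seq; have [[[R0 R2] R1 _ _] _ _] := wR; cbn [fst snd] in *.
apply: (for_ind (n := n)) => //.
  split=> //; cbn [run fst snd eval].
  rewrite upd_eq R1 /claimed eq_card0 ?addbF // => w.
  by rewrite !inE [n <= w]leqNgt ltn_ord andbF.
move=> u [R' M']; cbn [fst snd]; case; cbn [fst snd]; move=> -> w1 R5 R7.
have w2 : weighted (upd R' 10 u, M) by apply: weighted_upd.
have [[eR _ gM sM] _ _] := w2; cbn [fst snd] in eR, sM.
rewrite /turn_body run_If; cbn [fst snd]; rewrite holds_And (holds_Alive sM eR (upd_eq _ _ _)).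
have -> : holds (Digit 10) (upd R' 10 u) M = (M (dbase + u) != 0).
  by rewrite /holds (eval_Digit w2 (upd_eq _ _ _)).
have cS := claimedS M u; case: ifP => h; rewrite h in cS.
  split=> //; cbn [run fst snd eval].
  rewrite upd_eq upd_neq // R7 cS add1n /=.
  by case: dom_first; case: (odd _).
by split; rewrite // cS.
Qed.

Lemma claimed_digits A B M : A \subset W -> B \subset W -> [disjoint A & B] ->
  (forall w, w \in W -> M (dbase + w) = digit A B w) -> claimed M 0 = #|A| + #|B|.
Proof.
move=> AW BW dis dg; have -> : #|A| + #|B| = #|A :|: B|.
  by rewrite cardsU (disjoint_setI0 dis) cards0 subn0.
apply: eq_card => w; rewrite !inE; case wW: (w \in W) => /=.
  rewrite dg // /digit; by case: (w \in A); case: (w \in B).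
apply/esym/negbTE; rewrite negb_or; apply/andP.
by split; apply: contraFN wW; apply: subsetP.
Qed.

Lemma claimed_code A B v : v \in W :\: (A :|: B) -> [/\ v \in W, v \notin A & v \notin B].
Proof. by rewrite !inE negb_or => /andP[/andP[-> ->] ->]. Qed.

Lemma setDU_A A B v : W :\: ((v |: A) :|: B) = (W :\: (A :|: B)) :\ v.
Proof. by apply/setP => x; rewrite !inE; case: (x == v). Qed.

Lemma setDU_B A B v : W :\: (A :|: (v |: B)) = (W :\: (A :|: B)) :\ v.
Proof. by rewrite setUCA -setDU_A setUA. Qed.

Lemma weight_gt0 v : 0 < weight v. Proof. by rewrite expn_gt0. Qed.

(** Every move increases the code, so the entries above [code A B] determine the value by one
    unfolding of [staller_wins]. *)
Lemma holds_Value A B R M : weighted (R, M) -> A \subset W -> B \subset W ->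
  [disjoint A & B] -> R 5 = code A B -> R 7 = dominator_turn A B ->
  (forall w, w \in W -> M (dbase + w) = digit A B w) ->
  (forall A' B', A' \subset W -> B' \subset W -> [disjoint A' & B'] ->
     code A B < code A' B' -> M (tbase + code A' B') = position_value A' B') ->
  holds Value R M = position_value A B.
Proof.
move=> wR AW BW dis R5 R7 dg tab; have [[[R0 R2] R1 gM sM] _ _] := wR; cbn [fst snd] in *.
set F := W :\: (A :|: B).
have FreeE R' x v : weighted (R', M) -> R' x = v -> holds (Free x) R' M = (v \in F).
  move=> wR' Rx; have [[eR' _ _ _] _ _] := wR'; cbn [fst snd] in eR'.
  rewrite holds_And holds_Not (holds_Alive sM eR' Rx) /holds (eval_Digit wR' Rx) negbK.
  rewrite !in_setD in_setU; case vW: (v \in W); rewrite ?andbF //= andbT dg //.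
  by rewrite /digit; case: (v \in A); case: (v \in B).
have w20 v : weighted (upd R 20 v, M) by apply: weighted_upd.
have anyE : holds (Ex 20 (Free 20)) R M = (F != set0).
  rewrite (holds_Ex _ _ _ R0); apply/existsP/set0Pn => -[v].
    by rewrite (FreeE _ _ v) ?upd_eq // => ?; exists v.
  by move=> vF; exists v; rewrite (FreeE _ _ v) ?upd_eq.
have IteE e f g : holds (Ite e f g) R M = if holds e R M then holds f R M else holds g R M.
  by rewrite /holds /=; case: (eval e R M == 0).
rewrite /Value 2!IteE anyE /position_value -/F.
have [F0|F0] /= := eqVneq F set0.
  rewrite F0 staller_wins0 /Lost (holds_Ex _ _ _ R0).
  have AB v : v \in W -> (v \in A) || (v \in B).
    by move=> vW; have := in_set0 v; rewrite -F0 !inE vW andbT => /negbFE.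
  apply: eq_existsb => v; have [[e20 _ _ _] _ _] := w20 v; cbn [fst snd] in e20.
  rewrite holds_And (holds_Alive sM e20 (upd_eq _ _ _)); congr (_ && _).
  have [e0 _] := e20; rewrite (holds_All _ _ _ e0).
  have w21 w : weighted (upd (upd R 20 v) 21 w, M) by apply: weighted_upd.
  have body w : holds (Imp (And (Alive 21) (Or (Eq (Var 21) (Var 20)) (Adj 20 21)))
      (Eq (Digit 21) (Cst 1))) (upd (upd R 20 v) 21 w) M =
      ((w \in nbhd G W v) ==> (w \in A)).
    have [[e21 _ _ _] _ _] := w21 w; cbn [fst snd] in e21.
    have R20 : upd (upd R 20 v) 21 w 20 = v by rewrite upd_neq // upd_eq.
    rewrite holds_Imp holds_And (holds_Alive sM e21 (upd_eq _ _ _)) holds_Or 2!holds_Eq.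
    rewrite (holds_Adj gM e21 _ R20 (upd_eq _ _ _)) // (eval_Digit (w21 w) (upd_eq _ _ _)).
    have E21 : eval (Var 21) (upd (upd R 20 v) 21 w) M = w by rewrite /= upd_eq.
    have E20 : eval (Var 20) (upd (upd R 20 v) 21 w) M = v by rewrite /= R20.
    rewrite E20 E21 [w \in nbhd _ _ _]inE; case wW: (w \in W) => //=.
    congr (_ ==> _); rewrite dg // /digit.
    have := AB w wW; have := disjointFr dis (x := w).
    by case: (w \in A); case: (w \in B) => //= /(_ isT).
  apply/forallP/subsetP => [h w wv|h w].
    by have := h w; rewrite body wv.
  by rewrite body; apply/implyP; apply: h.
have holds7 : holds (Var 7) R M = dominator_turn A B.
  by rewrite /holds /= R7; case: (dominator_turn A B).
have tabE e R' : weighted (R', M) -> holds (Table e) R' M = (M (tbase + eval e R' M) != 0).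
  by move=> wR'; rewrite /holds (eval_Table _ wR').
have b_neq0 (c : bool) : ((c : nat) != 0) = c by case: c.
rewrite holds7; case E: (dominator_turn A B) => /=.
  rewrite staller_winsD // (holds_All _ _ _ R0); apply: eq_forallb => v.
  rewrite holds_Imp (FreeE _ _ v) ?upd_eq //; case vF: (v \in F) => //=.
  have [vW vA vB] := claimed_code vF.
  have W20 := eval_Weight (w20 v) vW (upd_eq _ _ _).
  rewrite tabE //; cbn [eval]; rewrite W20 upd_neq // R5 -code_addB //.
  rewrite tab ?b_neq0 //.
  - rewrite /position_value setDU_B; congr staller_wins.
    by rewrite /dominator_turn cardsU1 vB addnCA oddD addbCA -/(dominator_turn A B) E.
  - by rewrite subUset sub1set vW.
  - rewrite disjoint_sym disjoint_subset; apply/subsetP => x; rewrite !inE.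
    by case/orP => [/eqP -> //|xB]; rewrite (disjointFl dis xB).
  - by rewrite code_addB // -{1}[code A B]addn0 ltn_add2l addn_gt0 weight_gt0.
rewrite staller_winsS // (holds_Ex _ _ _ R0); apply: eq_existsb => v.
rewrite holds_And (FreeE _ _ v) ?upd_eq //; case vF: (v \in F) => //=.
have [vW vA vB] := claimed_code vF.
have W20 := eval_Weight (w20 v) vW (upd_eq _ _ _).
rewrite tabE //; cbn [eval]; rewrite W20 upd_neq // R5 -code_addA //.
rewrite tab ?b_neq0 //.
- rewrite /position_value setDU_A; congr staller_wins.
  by rewrite /dominator_turn cardsU1 vA -addnA oddD addbCA -/(dominator_turn A B) E.
- by rewrite subUset sub1set vW.
- rewrite disjoint_subset; apply/subsetP => x; rewrite !inE.
  by case/orP => [/eqP -> //|xA]; rewrite (disjointFr dis xA).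
- by rewrite code_addA // -{1}[code A B]addn0 ltn_add2l weight_gt0.
Qed.

Lemma solve_cmdP s : weighted s ->
  (run solve_cmd s).1 0 = n /\
  eval (Table (Cst 0)) (run solve_cmd s).1 (run solve_cmd s).2 =
  outcome G W (~~ dom_first).
Proof.
move=> ws; pose Inv k t := weighted t /\ forall A B, A \subset W -> B \subset W ->
  [disjoint A & B] -> k <= code A B -> t.2 (tbase + code A B) = position_value A B.
suff [w' tab] : Inv 0 (run solve_cmd s).
  have [[[r0 _] _ _ _] _ _] := w'; split=> //; move: w' tab.
  case: (run solve_cmd s) => R M w' tab; rewrite (eval_Table _ w').
  have := tab set0 set0 (sub0set _) (sub0set _); rewrite code0 -setI_eq0 setI0 eqxx.
  cbn [fst snd eval] => -> //; rewrite /position_value setU0 setD0 /outcome.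
  by rewrite /dominator_turn cards0 addbF.
have [_ r3 _] := ws; have -> : run solve_cmd s =
    loop (fun i t => run solve_body (upd t.1 5 i, t.2)) (s.1 3) s by [].
rewrite r3; apply: loop_ind.
  (* No code reaches [3 ^ rest 0], so nothing is required of the table at the start. *)
  split=> // A B _ _ dis; rewrite leqNgt; have := tail_lt W 0 dis.
  by rewrite /code => ->.
move=> k [R M] _ [w1 tab]; cbn [fst snd] in *.
have w2 : weighted (upd R 5 k, M) by apply: weighted_upd.
have [] := decode_cmdP w2; rewrite /solve_body 2!run_Seq.
case: (run decode_cmd (upd R 5 k, M)) => R1 M1; cbn [fst snd]; rewrite upd_eq.
move=> w3 R15 ta dg; have [R2 [-> w4 R25 R27]] := turn_cmdP w3.
have [[[r0 r2] _ _ _] _ _] := w4; cbn [fst snd] in r0, r2.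
have E : run (Store (table_addr (Var 5)) (Ite Value (Cst 1) (Cst 0))) (R2, M1) =
    (R2, upd M1 (tbase + k) (holds Value R2 M1)).
  cbn [run fst snd table_addr]; congr (_, upd _ _ _).
    by rewrite /= r0 r2 R25 R15.
  by rewrite /holds; move: Value => e /=; case: (eval e R2 M1 == 0).
rewrite E; split; first by apply: weighted_store => //; lia.
move=> A B AW BW dis le; cbn [fst snd]; have [cE|ck] := eqVneq (code A B) k; last first.
  rewrite upd_neq; last by rewrite eqn_add2l; apply: negbTE.
  by rewrite ta ?leq_addr // tab // ltn_neqAle eq_sym ck.
have dgE := dg A B dis cE.
rewrite cE upd_eq (@holds_Value A B) //.
- by rewrite R25 R15.
- by rewrite R27 (claimed_digits AW BW dis dgE).
move=> A' B' AW' BW' dis'; rewrite cE => lt.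
by rewrite ta ?leq_addr // tab.
Qed.
End Solve.

(** * The algorithm *)

(** The bound of [kind_reduced_card] with [3 * d] in place of [#|X|]. *)
Definition kernel_size d := 3 * d + 13 * (2 ^ (3 * d) * (2 ^ 2 ^ (3 * d) * 2 ^ 2 ^ (3 * d))).

Definition double x := Plus (Var x) (Var x).
Definition triple x := Plus (Var x) (double x).

(** [FPT] demands a computable time bound. Powers arise by repeated doubling and tripling, products
    by nested sums. *)
Definition bound_cmd a :=
  Seq (Assign 1 (triple 0))
  (Seq (Seq (Assign 2 (Cst 1)) (For 10 (Var 1) (Assign 2 (double 2))))
  (Seq (Seq (Assign 3 (Cst 1)) (For 10 (Var 2) (Assign 3 (double 3))))
  (Seq (Assign 6 (Plus (Var 1) (Sum 10 (Cst 13) (Sum 11 (Var 2) (Sum 12 (Var 3) (Var 3))))))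
  (Seq (Seq (Assign 7 (Cst a)) (For 10 (Var 6) (Assign 7 (triple 7))))
       (Assign 0 (Var 7)))))).

Lemma run_power c e r b a R M : r != 10 -> r != b -> (forall R M, eval e R M = c * R r) ->
  exists R', [/\ run (Seq (Assign r (Cst a)) (For 10 (Var b) (Assign r e))) (R, M) = (R', M),
    R' r = a * c ^ R b & forall x, x != 10 -> x != r -> R' x = R x].
Proof.
move=> r10 rb ce; rewrite run_Seq.
have -> : run (For 10 (Var b) (Assign r e)) (run (Assign r (Cst a)) (R, M)) =
    loop (fun i s => (upd (upd s.1 10 i) r (eval e (upd s.1 10 i) s.2), s.2)) (upd R r a b)
      (upd R r a, M) by [].
rewrite [upd R r a b]upd_neq; last by rewrite eq_sym; apply: negbTE.
have : forall a1 R1, R1 r = a1 -> (forall x, x != 10 -> x != r -> R1 x = R x) -> exists R',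
    [/\ loop (fun i s => (upd (upd s.1 10 i) r (eval e (upd s.1 10 i) s.2), s.2)) (R b) (R1, M) =
      (R', M), R' r = a1 * c ^ R b & forall x, x != 10 -> x != r -> R' x = R x].
  elim: (R b) => [|m IH] a1 R1 R1r R1x /=; first by exists R1; rewrite muln1.
  have [|x x10 xr|R' [-> Rr Rx]] := IH (c * a1) (upd (upd R1 10 m) r (eval e (upd R1 10 m) M)).
  - by rewrite upd_eq ce upd_neq ?R1r //; apply: negbTE.
  - by rewrite !upd_neq ?R1x //; apply: negbTE.
  by exists R'; split=> //; rewrite Rr expnS mulnCA mulnA.
by apply; rewrite ?upd_eq // => x _ xr; rewrite upd_neq //; apply: negbTE.
Qed.

Lemma sum_ord_const m c : \sum_(i < m) c = m * c.
Proof. by rewrite big_const_ord iter_addn_0 mulnC. Qed.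

Lemma computable_bound a : computable (fun d => a * 3 ^ kernel_size d).
Proof.
(* The scratch registers start at 20, above all variables of [bound_cmd]. *)
exists (ccmd (bound_cmd a) 20 0) => d; set R := upd _ _ _; set M := fun=> 0.
exists (run_cost (bound_cmd a) (R, M)).
suff -> : a * 3 ^ kernel_size d = (run (bound_cmd a) (R, M)).1 0 by apply: run_outputs.
rewrite /bound_cmd run_Seq.
have -> : run (Assign 1 (triple 0)) (R, M) = (upd R 1 (3 * d), M).
  by rewrite /= /R upd_eq; congr (upd _ _ _, _); lia.
rewrite run_Seq.
have dbl r R' M' : eval (double r) R' M' = 2 * R' r by rewrite /=; lia.
have tpl r R' M' : eval (triple r) R' M' = 3 * R' r by rewrite /=; lia.
have [R1 [-> R12 R1x]] := @run_power 2 (double 2) 2 1 1 (upd R 1 (3 * d)) M erefl erefl (dbl 2).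
rewrite run_Seq.
have [R2 [-> R23 R2x]] := @run_power 2 (double 3) 3 2 1 R1 M erefl erefl (dbl 3).
rewrite run_Seq.
have R21 : R2 1 = 3 * d by rewrite R2x // R1x.
have R22 : R2 2 = 2 ^ (3 * d) by rewrite R2x // R12 mul1n.
have {}R23 : R2 3 = 2 ^ 2 ^ (3 * d) by rewrite R23 R12 !mul1n.
have -> : run (Assign 6 (Plus (Var 1) (Sum 10 (Cst 13) (Sum 11 (Var 2) (Sum 12 (Var 3) (Var 3))))))
    (R2, M) = (upd R2 6 (kernel_size d), M).
  by rewrite /= /upd /= !sum_ord_const R21 R22 R23.
rewrite run_Seq.
have [R3 [-> R37 R3x]] := @run_power 3 (triple 7) 7 6 a (upd R2 6 (kernel_size d)) M erefl erefl
  (tpl 7).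
by rewrite /= R37.
Qed.

Definition prepare_cmd :=
  Seq (Assign 2 (Sum 40 (Var 0) (Var 0)))
  (Seq pack_cmd (Seq twin_cmd (Seq kind_cmd weights_cmd))).
Definition answer_exp := Ite (Table (Cst 0)) (Cst 0) (Cst 1).
Definition main_cmd := Seq prepare_cmd (Seq solve_cmd (Assign 0 answer_exp)).

Lemma prepare_poly : cmd_poly prepare_cmd. Proof. by []. Qed.
Lemma solve_body_poly : cmd_poly solve_body. Proof. by []. Qed.
Lemma answer_poly : exp_poly answer_exp. Proof. by []. Qed.

Lemma loop_cost_le x c m B n s : 0 < x -> cmd_poly c -> s.1 0 = n ->
  (forall t, t.1 0 = n -> 5 + (run_cost c t + 2) <= B) ->
  loop_cost (fun i t => 5 + (run_cost c (upd t.1 x i, t.2) + 2))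
    (fun i t => run c (upd t.1 x i, t.2)) m s <= m * B.
Proof.
move=> x0 pc s0 h; elim: m s s0 => [|m IH] s s0 //=.
have u0 : upd s.1 x m 0 = n by rewrite upd_neq ?s0 // ltn_eqF.
rewrite mulSn leq_add ?h // IH // run_reg0 //.
Qed.

(** Only the loop of [solve_cmd] is not bounded by the number of vertices: [prepare_cmd] leaves its
    number of rounds in register 3, and each round takes polynomial time. *)
Lemma main_cost : exists a k, forall s,
  run_cost main_cmd s <= a * (run prepare_cmd s).1 3 * (s.1 0).+1 ^ k + a * (s.1 0).+1 ^ k.
Proof.
have h1 := run_cost_poly prepare_poly; have h2 := run_cost_poly solve_body_poly.
have h3 := eval_cost_poly answer_poly.
have [a [k h]] := poly_bound_add h1 (poly_bound_add (poly_bound_add h2 (poly_bound_const 7))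
  (poly_bound_add h3 (poly_bound_const 5))).
exists (2 * a), k => -[R M]; cbn [fst snd].
set B := a * (R 0).+1 ^ k.
have hB R' M' : R' 0 = R 0 -> [/\ run_cost prepare_cmd (R', M') <= B,
    5 + (run_cost solve_body (R', M') + 2) <= B & eval_cost answer_exp R' M' + 5 <= B].
  by move=> E; have := h R' M'; rewrite E -/B => le; split; lia.
have -> : run_cost main_cmd (R, M) = run_cost prepare_cmd (R, M) +
    (run_cost solve_cmd (run prepare_cmd (R, M)) +
     run_cost (Assign 0 answer_exp) (run solve_cmd (run prepare_cmd (R, M)))) by [].
have [c1 _ _] := hB R M erefl.
have r0 : (run prepare_cmd (R, M)).1 0 = R 0 by rewrite run_reg0.
case: (run prepare_cmd (R, M)) r0 => R1 M1; cbn [fst snd] => r0.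
have -> : run_cost solve_cmd (R1, M1) = 2 +
    (loop_cost (fun i t => 5 + (run_cost solve_body (upd t.1 5 i, t.2) + 2))
      (fun i t => run solve_body (upd t.1 5 i, t.2)) (R1 3) (R1, M1) + 1) by [].
have c2 : loop_cost (fun i t => 5 + (run_cost solve_body (upd t.1 5 i, t.2) + 2))
      (fun i t => run solve_body (upd t.1 5 i, t.2)) (R1 3) (R1, M1) <= R1 3 * B.
  apply: (@loop_cost_le 5 solve_body (R1 3) B (R 0) (R1, M1) erefl solve_body_poly r0).
  by case=> R' M' E; have [_] := hB R' M' E.
have r1 : (run solve_cmd (R1, M1)).1 0 = R 0.
  have -> : run solve_cmd (R1, M1) =
    loop (fun i t => run solve_body (upd t.1 5 i, t.2)) (R1 3) (R1, M1) by [].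
  apply: (@loop_ind (fun _ t => t.1 0 = R 0)); first exact: r0.
  by move=> i t _ t0; rewrite (run_reg0 _ solve_body_poly); cbn [fst snd]; rewrite upd_neq.
move: r1; case: (run solve_cmd (R1, M1)) => R2 M2; cbn [fst snd] => r1.
have [_ _ c3] := hB R2 M2 r1.
have -> : run_cost (Assign 0 answer_exp) (R2, M2) = eval_cost answer_exp R2 M2 + 2 by [].
have -> : 2 * a * R1 3 * (R 0).+1 ^ k + 2 * a * (R 0).+1 ^ k = 2 * (R1 3 * B) + 2 * B.
  by rewrite /B; move: (_ ^ k) (R1 3) => u p; lia.
move: c1 c2 c3; move: (run_cost prepare_cmd _) (loop_cost _ _ _ _) (eval_cost _ _ _) => x y z.
move: (R1 3 * B) => q; lia.
Qed.

Section Instance.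
Variables (n : nat) (G : sgraph 'I_n) (first : player).

Let R0 := upd (upd (fun=> 0) 0 n) 1 (player_code first).
Let M0 := adj_matrix G.

Lemma adj_matrixE (u v : 'I_n) : M0 (u * n + v) = G u v.
Proof.
have n0 : 0 < n by apply: leq_ltn_trans (ltn_ord u).
rewrite /M0 /adj_matrix divnMDl // modnMDl divn_small // modn_small // addn0.
by rewrite !valK.
Qed.

(** The marks stored behind the matrix are thus zero at the start: X is empty and every vertex is
    alive. *)
Lemma adj_matrix_out a : n * n <= a -> M0 a = 0.
Proof.
rewrite /M0 /adj_matrix; case: (posnP n) => [n0|n0] le.
  by case: insubP => // i; have := ltn_ord i; rewrite [in X in _ < X]n0.
by rewrite insubF // ltnNge leq_divRL // le.
Qed.

Lemma prepared : exists X W,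
  [/\ weighted G (is_dominator first) X W (run prepare_cmd (R0, M0)), packed G X &
      kind_reduced G X W setT].
Proof.
rewrite /prepare_cmd; do 4!rewrite run_Seq.
have -> : run (Assign 2 (Sum 40 (Var 0) (Var 0))) (R0, M0) = (upd R0 2 (n * n), M0).
  by rewrite /= /upd /= sum_ord_const.
have wf : well_formed G (is_dominator first) set0 setT (upd R0 2 (n * n), M0).
  split=> //=; first exact: adj_matrixE.
  by split=> u; rewrite !inE adj_matrix_out //; lia.
have [X [wf1 pX clX]] := pack_cmdP wf.
have [W1 [wf2 red1]] := twin_cmdP clX wf1.
have [W [wf3 red2]] := kind_cmdP clX wf2 red1.
exists X, W; split=> //; exact: weights_cmdP.
Qed.

Lemma main_correct : (run main_cmd (R0, M0)).1 0 = ~~ outcome G setT (~~ is_dominator first).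
Proof.
have [X [W [wp _ [_ out _ _]]]] := prepared.
rewrite /main_cmd 2!run_Seq; have [_] := solve_cmdP wp.
rewrite -out; move: (run solve_cmd _) => s tE.
have -> : run (Assign 0 answer_exp) s = (upd s.1 0 (eval answer_exp s.1 s.2), s.2) by [].
cbn [fst snd]; rewrite upd_eq /answer_exp.
have -> : eval (Ite (Table (Cst 0)) (Cst 0) (Cst 1)) s.1 s.2 =
  if eval (Table (Cst 0)) s.1 s.2 == 0 then 1 else 0 by [].
by rewrite tE; case: (outcome _ _ _).
Qed.

(** The parameter enters here: the packing bounds X by the distance, and X bounds the kernel. *)
Lemma main_table : (run prepare_cmd (R0, M0)).1 3 <= 3 ^ kernel_size (dist_to_cluster G).
Proof.
have [X [W [[_ -> _] pX red]]] := prepared.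
rewrite leq_exp2l //; have -> : rest W 0 = #|W| by apply: eq_card => w; rewrite inE andbT.
apply: leq_trans (kind_reduced_card red) _; have le := packed_dist pX.
have p1 : 2 ^ #|X| <= 2 ^ (3 * dist_to_cluster G) by rewrite leq_exp2l.
have p2 : 2 ^ 2 ^ #|X| <= 2 ^ 2 ^ (3 * dist_to_cluster G) by rewrite leq_exp2l.
by apply: leq_add => //; rewrite leq_mul2l; apply/orP; right; do 2?apply: leq_mul.
Qed.
End Instance.

Theorem theorem5p2 :
  @FPT MB_Dom_Game (fun x : mbdg_instance => dist_to_cluster (graph x)).
Proof.
have [a [k cost]] := main_cost.
(* The scratch registers start at 50, above register 40 of [Row]. The factor 2 absorbs the purely
   polynomial term of [main_cost], as the power of 3 is positive. *)
exists (ccmd main_cmd 50 0), (fun d => (2 * a) * 3 ^ kernel_size d), k.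
split; first exact: computable_bound.
case=> n G first; set o := outcome G setT (~~ is_dominator first).
exists (~~ o : nat).
  exists (if o then Staller else Dominator); last by case: o.
  by apply: outcome_strategy; rewrite -/o; case: o.
rewrite -(main_correct G first); apply: run_outputs => //.
apply: leq_trans (cost _) _; cbn [fst snd].
have -> : upd (upd (fun=> 0) 0 n) 1 (player_code first) 0 = n by [].
have p0 : 0 < 3 ^ kernel_size (dist_to_cluster G) by rewrite expn_gt0.
move: p0 (main_table G first); cbn [isize MB_Dom_Game nvertices graph].
move: (3 ^ _) ((run prepare_cmd _).1 3) (n.+1 ^ k) => p q u p0 le; nia.
Qed.
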